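(* Let $n\in\mathbb{N}_+$, $b_i\in(0,\infty)$, $a_i,k_i\in(0,\infty]$ satisfy $\frac{n}{a_i^{-1}n+b_i}<\min\{2,k_i\}$ ($i=1,2$) and $$k_1<\left(\frac{n}{a_2^{-1}n+b_2}\right)'\ \text{ whenever }\frac{n}{a_2^{-1}n+b_2}\geq1,\qquad k_2<\left(\frac{n}{a_1^{-1}n+b_1}\right)'\ \text{ whenever }\frac{n}{a_1^{-1}n+b_1}\geq1.$$ Then there is a constant $c>0$ depending only on $n,a_i,b_i,k_i$ ($i=1,2$) such that for every $0\neq u_0\in\mathscr{S}(\mathbb{R}^n)$, every $t\in\mathbb{R}\setminus\{0\}$ and all $x_0,x_1\in\mathbb{R}^n$, $$\left(\frac{\left\||x-x_0|^{b_1}u_0\right\|_{L_x^{a_1}(\mathbb{R}^n)}}{\|u_0\|_{L^{k_1}(\mathbb{R}^n)}}\right)^{\frac{1}{a_2}+\frac{b_2}{n}-\frac{1}{k_2}}\left(\frac{\left\||x-x_1|^{b_2}e^{it\Delta}u_0\right\|_{L_x^{a_2}(\mathbb{R}^n)}}{\|e^{it\Delta}u_0\|_{L^{k_2}(\mathbb{R}^n)}}\right)^{\frac{1}{a_1}+\frac{b_1}{n}-\frac{1}{k_1}}\geq c\,|t|^{n(\frac{1}{a_1}+\frac{b_1}{n}-\frac{1}{k_1})(\frac{1}{a_2}+\frac{b_2}{n}-\frac{1}{k_2})}.$$ In particular, if $a\in(0,\infty]$, $b\in(0,\infty)$ and $\frac{n}{a^{-1}n+b}<2$, then for every $0\neq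 u_0\in\mathscr{S}(\mathbb{R}^n)$ there is a constant $c'>0$ depending only on $u_0,n,a,b$ such that $$\left\||x-x_0|^be^{it\Delta}u_0\right\|_{L_x^a(\mathbb{R}^n)}\geq c'\,|t|^{n(\frac1a+\frac bn-\frac12)},\quad t\in\mathbb{R}\setminus\{0\},\ x_0\in\mathbb{R}^n.$$
   Context: $\mathscr{S}(\mathbb{R}^n)$ is the Schwartz class. $e^{it\Delta}$ is the free Schrödinger propagator: $u(t,x)=e^{it\Delta}u_0(x)$ solves $i\partial_tu+\Delta u=0$, $u(0,\cdot)=u_0$. $L^p$ for $0<p<1$ carries the usual quasi-norm. For $p\in[1,\infty]$, $p'$ is the conjugate exponent, $\frac1p+\frac1{p'}=1$. Convention: $1/\infty=0$. *)

(* Defs.v *)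
From HB Require Import structures.
From mathcomp Require Import all_boot all_order all_algebra.
From mathcomp Require Import complex.
From mathcomp Require Import all_classical all_reals all_analysis.

Set Implicit Arguments.
Unset Strict Implicit.
Unset Printing Implicit Defensive.
Import Order.TTheory GRing.Theory Num.Theory.
Import numFieldNormedType.Exports.

Local Open Scope classical_set_scope.
Local Open Scope ring_scope.

(* Lebesgue measure on R^n is built by recursion on n, as a measure on
   n.-tuple R with the product sigma-algebra of the library: the measure in
   dimension n.+1 is the image of the product measure on R * R^n. *)
Section lebesgue_tuple.
Context {R : realType}.
Local Notation mR := (measurableTypeR R).

Definition tuple_cons n (p : mR * n.-tuple mR) : n.+1.-tuple mR :=
  [the n.+1.-tuple mR of p.1 :: p.2].

Definition tuple_uncons n (t : n.+1.-tuple mR) : mR * n.-tuple mR :=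
  (tnth t ord0, [tuple of behead t]).

Lemma measurable_tuple_cons n :
  measurable_fun [set: mR * n.-tuple mR] (@tuple_cons n).
Proof.
by apply: measurable_cons; [exact: measurable_fst | exact: measurable_snd].
Qed.

HB.instance Definition _ n :=
  isMeasurableFun.Build _ _ _ _ (@tuple_cons n) (@measurable_tuple_cons n).

Lemma measurable_tuple_uncons n :
  measurable_fun [set: n.+1.-tuple mR] (@tuple_uncons n).
Proof.
apply: measurable_fun_pair; first exact: measurable_tnth.
exact: measurable_behead.
Qed.

Lemma tuple_consK n : cancel (@tuple_cons n) (@tuple_uncons n).
Proof.
by move=> [x t]; rewrite /tuple_uncons /tuple_cons; congr (_, _); exact/val_inj.
Qed.

Section step.
Variables (n : nat) (mu : {sigma_finite_measure set (n.-tuple mR) -> \bar R}).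

Let leb : {sigma_finite_measure set mR -> \bar R} := @lebesgue_measure R.

Definition lebesgue_step : set (n.+1.-tuple mR) -> \bar R :=
  pushforward (leb \x mu)%E (@tuple_cons n).

Let lebesgue_step0 : lebesgue_step set0 = 0%E.
Proof. exact: measure0. Qed.

Let lebesgue_step_ge0 A : (0 <= lebesgue_step A)%E.
Proof. exact: measure_ge0. Qed.

Let lebesgue_step_sigma_additive : semi_sigma_additive lebesgue_step.
Proof. exact: measure_semi_sigma_additive. Qed.

HB.instance Definition _ := isMeasure.Build _ _ _ lebesgue_step
  lebesgue_step0 lebesgue_step_ge0 lebesgue_step_sigma_additive.

Let lebesgue_step_sigma_finite : sigma_finite setT lebesgue_step.
Proof.
have /sigma_finiteP[F [TF ndF Foo]] := sigma_finiteT leb.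
have /sigma_finiteP[G [TG ndG Goo]] := sigma_finiteT mu.
exists (fun k => @tuple_uncons n @^-1` (F k `*` G k)).
  rewrite -preimage_bigcup (_ : \bigcup_k _ = setT) ?preimage_setT//.
  rewrite -setXTT TF TG predeqE => -[x y]; split.
    by move=> [k _ []/= ? ?]; split; exists k.
  move=> [/= [k _ Fkx] [l _ Gly]]; exists (maxn k l) => //; split.
  - by move: x Fkx; exact/subsetPset/ndF/leq_maxl.
  - by move: y Gly; exact/subsetPset/ndG/leq_maxr.
move=> k; have [mF Fk] := Foo k; have [mG Gk] := Goo k; split.
  rewrite -[X in measurable X]setTI; apply: measurable_tuple_uncons => //.
  exact: measurableX.
rewrite /lebesgue_step /pushforward -comp_preimage (_ : _ \o _ = id)//.
  by rewrite product_measure1E// lte_mul_pinfty// ge0_fin_numE.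
exact/funext/tuple_consK.
Qed.

HB.instance Definition _ := @Measure_isSigmaFinite.Build _ _ _ lebesgue_step
  lebesgue_step_sigma_finite.

End step.

Fixpoint lebesgue_tuple n : {sigma_finite_measure set (n.-tuple mR) -> \bar R} :=
  match n with
  | 0 => dirac [tuple]
  | n'.+1 => lebesgue_step (lebesgue_tuple n')
  end.

(* lebesgue_tuple is the product measure: it multiplies on boxes. *)
Lemma lebesgue_tuple_box n (A : 'I_n -> set mR) :
  (forall i, measurable (A i)) ->
  lebesgue_tuple n [set t | forall i, A i (tnth t i)] =
  (\prod_(i < n) @lebesgue_measure R (A i))%E.
Proof.
elim: n A => [|n IH] A mA.
  by rewrite big_ord0 /= diracE mem_set// => -[].
rewrite big_ord_recl -IH; last by move=> i; exact: mA.
rewrite /= /lebesgue_step /pushforward.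
rewrite (_ : _ @^-1` _ =
  A ord0 `*` [set t : n.-tuple mR | forall i, A (lift ord0 i) (tnth t i)]).
  rewrite product_measure1E//.
  rewrite (_ : mkset _ = \bigcap_(i in [set: 'I_n])
    ((fun t : n.-tuple mR => tnth t i) @^-1` A (lift ord0 i))).
    apply: fin_bigcap_measurable => // i _; rewrite -[X in measurable X]setTI.
    exact: measurable_tnth.
  by apply/seteqP; split => t /= tA i; [move=> _|]; apply: tA.
apply/seteqP; split => -[x t] /=.
  move=> xtA; split; first exact: (xtA ord0).
  by move=> i; have := xtA (lift ord0 i); rewrite tnthS.
move=> [xA tA] i; by have [j ->|->//] := unliftP ord0 i; rewrite tnthS.
Qed.

End lebesgue_tuple.

Local Open Scope complex_scope.

Section euclidean_space.
Context {R : realType} {n : nat}.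

(* The norm `|x| of the library on 'rV[R]_n is the sup norm. *)
Definition euclidean_norm (x : 'rV[R]_n) : R :=
  Num.sqrt (\sum_(i < n) x ord0 i ^+ 2).

(* L^p (quasi-)norm of f : R^n -> C, for 0 < p <= +oo. *)
Definition Lp_norm (p : \bar R) (f : 'rV[R]_n -> R[i]) : \bar R :=
  Lnorm (lebesgue_tuple n) p
    (fun t => (ComplexField.Normc.normc (f (\row_i tnth t i)))%:E).

Definition weighted (b : R) (x0 : 'rV[R]_n) (f : 'rV[R]_n -> R[i]) :
    'rV[R]_n -> R[i] :=
  fun x => (euclidean_norm (x - x0) `^ b)%:C * f x.

End euclidean_space.

(* R[i] carries no normed R-module structure in the library, so derivatives of
   complex-valued functions are taken on real and imaginary parts. *)
Section complex_valued.
Context {R : realType} {V : normedModType R}.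
Implicit Types (f : V -> R[i]) (x v : V).

Definition re_part f : V -> R := fun x => complex.Re (f x).
Definition im_part f : V -> R := fun x => complex.Im (f x).

Definition cdifferentiable f x :=
  differentiable (re_part f) x /\ differentiable (im_part f) x.

Definition cderivable f x v :=
  derivable (re_part f) x v /\ derivable (im_part f) x v.

Definition cderive v f x : R[i] :=
  ('D_v (re_part f) x) +i* ('D_v (im_part f) x).

End complex_valued.

Section schwartz.
Context {R : realType} {n : nat}.
Local Notation Rn := 'rV[R]_n.

Definition partial (j : 'I_n) (f : Rn -> R[i]) : Rn -> R[i] :=
  cderive (delta_mx ord0 j) f.

(* The multi-index beta is given as the list of the variables in which one
   differentiates. *)
Definition partials (beta : seq 'I_n) (f : Rn -> R[i]) : Rn -> R[i] :=
  foldr partial f beta.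

Definition laplacian (f : Rn -> R[i]) : Rn -> R[i] :=
  fun x => \sum_(j < n) partial j (partial j f) x.

Definition monomial (alpha : 'I_n -> nat) (x : Rn) : R :=
  \prod_(i < n) x ord0 i ^+ alpha i.

Definition smooth (f : Rn -> R[i]) :=
  forall beta x, cdifferentiable (partials beta f) x.

(* F is a bounded subset of the Schwartz space: every seminorm
   sup_x |x^alpha d^beta f(x)| is bounded uniformly in f. *)
Definition schwartz_bounded (F : set (Rn -> R[i])) :=
  (forall f, F f -> smooth f) /\
  (forall alpha beta, exists M : R, forall f x, F f ->
     ComplexField.Normc.normc ((monomial alpha x)%:C * partials beta f x) <= M).

Definition schwartz (f : Rn -> R[i]) := schwartz_bounded [set f].

(* u(t, .) = e^{it Laplacian} u0: the solution of the Cauchy problem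
   i d_t u + Laplacian u = 0, u(0, .) = u0, in the class of flows in the
   Schwartz space that are bounded on compact time intervals. A decay
   condition of this kind is needed for uniqueness, which fails among merely
   smooth solutions. *)
Definition free_schrodinger (u0 : Rn -> R[i]) (u : R -> Rn -> R[i]) :=
  [/\ u 0 = u0,
      forall T : R, schwartz_bounded (u @` `[- T, T]),
      forall (t : R) x, cderivable (fun s : R^o => u s x) t 1 &
      forall (t : R) x,
         (0 +i* 1) * cderive (1 : R^o) (fun s : R^o => u s x) t
         + laplacian (u t) x = 0].

End schwartz.

Section exponents.
Context {R : realType}.
Implicit Types (a k : \bar R) (b : R).

(* 1 / a for 0 < a <= +oo, with 1 / +oo = 0 *)
Definition recip a : R := fine (a^-1)%E.

Definition crit_exp (n : nat) a b : R := n%:R / (recip a * n%:R + b).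

Definition gap_exp (n : nat) a b k : R := recip a + b / n%:R - recip k.

End exponents.

(* Main.v *)
Require Import Defs.
From HB Require Import structures.
From mathcomp Require Import all_boot all_order all_algebra.
From mathcomp Require Import complex ring lra.
From mathcomp Require Import all_classical all_reals all_analysis.
From mathcomp Require Import measurable_realfun ess_sup_inf.
Import Order.TTheory GRing.Theory Num.Theory.
Import numFieldNormedType.Exports.
Local Open Scope classical_set_scope.
Local Open Scope ring_scope.
Local Open Scope complex_scope.

(** Write 1/p_i = 1/a_i + b_i/n for the critical exponents, d_i = 1/p_i - 1/k_i for
the gaps, and let X be the quotient || |x-x_0|^b_1 u_0 ||_a_1 / ||u_0||_k_1 raised
to the power 1/d_1, with Y the analogous quantity for u(t).  Both scale like the
volume of the region in which the function lives, and the claim is that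
X Y >= c |t|^n: the initial datum and the solution cannot both be concentrated.

Two facts are played against each other.  _Localization_ (ln_localization): for
q > p_1 and s >= k_1 one has ||u_0||_q <= C X^(1/q - 1/s) ||u_0||_s, because
outside a ball the weighted norm controls u_0, inside it the other norm does, and
the radius can be optimized.  _Dispersion_ (dispersive): for 1 <= q <= 2,
||u(t)||_q' <= C |t-s|^(-n(1/q-1/2)) ||u(s)||_q, in both directions of time.  The
hypotheses on k_1 and k_2 leave room for exponents q_1, q_2 in [1,2) with
q_i > p_i, q_2' >= k_1 and q_1' >= k_2 (exists_dual_exponent).  With
e = 1/q_1 + 1/q_2 - 1 > 0 the cycle

  ||u_0||_q_1 <= C X^e ||u_0||_q_2' <= C X^e |t|^(-n(1/q_2-1/2)) ||u(t)||_q_2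
   <= C (X Y)^e |t|^(-n(1/q_2-1/2)) ||u(t)||_q_1' <= C (X Y / |t|^n)^e ||u_0||_q_1

closes (ln_uncertainty), and the norm of u_0 cancels.  The second assertion is the
case k_1 = k_2 = 2, where the norms of u_0 and u(t) are comparable.  All norms
being positive, these estimates are proved for logarithms, where they are linear.

Dispersion needs u(t) as an oscillatory integral, while u is only given as a
solution of the equation.  Let E(s,y) = exp(-z |x-y|^2 / 4) with
z = 1/(eps + i(t-s)).  Integration by parts shows that the mean I of u(s) E(s)
satisfies I' = -(i n z / 2) I, so |I|^4 (Re z)^n is constant in s (mean_conserved).
At s = t the Gaussian is a heat kernel and I, normalized, tends to u(t,x) as eps
tends to 0; at any other s it tends to an integral of u(s,y) against
exp(i |x-y|^2 / (4(t-s))).  Comparing the two limits gives |u(t,x)|, which is all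
that is needed (propagator_formula).  Expanding |x-y|^2, this integral is, up to a
unimodular factor, a Fourier transform of u(s,y) exp(i |y|^2 / (4(t-s))), so
dispersion is the Hausdorff-Young inequality: trivial for q = 1, Plancherel for
q = 2 (plancherel_le), and real interpolation in between (marcinkiewicz). *)

Set Implicit Arguments.
Unset Strict Implicit.
Unset Printing Implicit Defensive.

(** * Integration over tuples *)

Section tuple_integral.
Context {R : realType}.
Local Notation mR := (measurableTypeR R).
Local Notation leb := (@lebesgue_measure R).
Local Notation mu := (@lebesgue_tuple R).

Lemma ge0_integral_tuple_prod n (f : n.+1.-tuple mR -> \bar R) :
  measurable_fun [set: n.+1.-tuple mR] f -> (forall t, 0 <= f t)%E ->
  (\int[mu n.+1]_t f t = \int[leb \x mu n]_p f (tuple_cons p))%E.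
Proof.
move=> mf f0.
rewrite (@eq_measure_integral _ _ _ setT (pushforward (leb \x mu n)%E (@tuple_cons R n)))//.
by rewrite ge0_integral_pushforward//= preimage_setT.
Qed.

Lemma ge0_integral_tupleS n (f : n.+1.-tuple mR -> \bar R) :
  measurable_fun [set: n.+1.-tuple mR] f -> (forall t, 0 <= f t)%E ->
  (\int[mu n.+1]_t f t = \int[leb]_x \int[mu n]_t f (tuple_cons (x, t)))%E.
Proof.
move=> mf f0; rewrite ge0_integral_tuple_prod// fubini_tonelli1//=.
apply: measurableT_comp => //; exact: measurable_tuple_cons.
Qed.

Lemma integrable_tuple_prod n (f : n.+1.-tuple mR -> R) :
  (mu n.+1).-integrable setT (EFin \o f) ->
  (leb \x mu n)%E.-integrable setT (fun p => (f (tuple_cons p))%:E).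
Proof.
move=> /integrableP[mf ltf]; apply/integrableP; split.
  by apply: (measurableT_comp mf); exact: measurable_tuple_cons.
rewrite ge0_integral_tuple_prod// in ltf.
by apply: measurableT_comp.
Qed.

Lemma integral_tuple_prod n (f : n.+1.-tuple mR -> R) :
  (mu n.+1).-integrable setT (EFin \o f) ->
  (\int[mu n.+1]_t (f t)%:E = \int[leb \x mu n]_p (f (tuple_cons p))%:E)%E.
Proof.
move=> fi; have /integrableP[mf ltf] := fi.
rewrite (@eq_measure_integral _ _ _ setT (pushforward (leb \x mu n)%E (@tuple_cons R n)))//.
rewrite integral_pushforward//= ?preimage_setT//.
exact: integrable_tuple_prod.
Qed.

Lemma integral_tupleS n (f : n.+1.-tuple mR -> R) :
  (mu n.+1).-integrable setT (EFin \o f) ->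
  (\int[mu n.+1]_t (f t)%:E = \int[leb]_x \int[mu n]_t (f (tuple_cons (x, t)))%:E)%E.
Proof.
move=> fi; rewrite integral_tuple_prod//.
by rewrite -integral12_prod_meas1//; exact: integrable_tuple_prod.
Qed.

Lemma integral_tupleS' n (f : n.+1.-tuple mR -> R) :
  (mu n.+1).-integrable setT (EFin \o f) ->
  (\int[mu n.+1]_t (f t)%:E = \int[mu n]_t \int[leb]_x (f (tuple_cons (x, t)))%:E)%E.
Proof.
move=> fi; rewrite integral_tuple_prod//.
by rewrite -integral21_prod_meas1//; exact: integrable_tuple_prod.
Qed.

Lemma measurable_prod_tnth n (g : 'I_n -> R -> R) :
  (forall i, measurable_fun setT (g i)) ->
  measurable_fun [set: n.-tuple mR] (fun t => \prod_(i < n) g i (tnth t i)).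
Proof.
move=> mg; apply: measurable_prod => i _.
by apply: (measurableT_comp (mg i)); exact: measurable_tnth.
Qed.

Lemma integral_tuple_prodE n (g : 'I_n -> R -> R) :
  (forall i, measurable_fun setT (g i)) -> (forall i x, 0 <= g i x) ->
  (\int[mu n]_t (\prod_(i < n) g i (tnth t i))%:E =
   \prod_(i < n) \int[leb]_x (g i x)%:E)%E.
Proof.
elim: n g => [|n IH] g mg g0.
  rewrite big_ord0 /= integral_dirac// ?diracT ?mul1e ?big_ord0//.
  by apply/measurable_EFinP; apply: (@measurable_prod_tnth 0 g).
rewrite ge0_integral_tupleS; last 2 first.
- by apply/measurable_EFinP; apply: measurable_prod_tnth.
- by move=> t; rewrite lee_fin prodr_ge0.
rewrite big_ord_recl -IH// -ge0_integralZr//; last 3 first.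
- by apply/measurable_EFinP; exact: mg.
- by move=> x _; rewrite lee_fin.
- by apply: integral_ge0 => t _; rewrite lee_fin prodr_ge0.
apply: eq_integral => x _.
rewrite -(ge0_integralZl _ measurableT); last 3 first.
- by apply/measurable_EFinP; apply: (@measurable_prod_tnth n (fun i => g (lift ord0 i))).
- by move=> t _; rewrite lee_fin prodr_ge0.
- by rewrite lee_fin.
apply: eq_integral => t _.
rewrite big_ord_recl -EFinM; congr (_ * _)%:E.
by apply: eq_bigr => i _; rewrite /tuple_cons tnthS.
Qed.

End tuple_integral.

Section measurable_row.
Context {R : realType}.
Local Notation mR := (measurableTypeR R).
Local Notation leb := (@lebesgue_measure R).
Local Notation mu := (@lebesgue_tuple R).

Definition row_of n (t : n.-tuple mR) : 'rV[R]_n := \row_i tnth t i.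

Lemma rV_norm_le n (x : 'rV[R]_n) (e : R) : 0 <= e -> (forall i, `|x ord0 i| <= e) ->
  `|x| <= e.
Proof.
move=> e0 xe; have [->//|x0] := eqVneq `|x| 0.
by have [[i j] E] := mx_norm_neq0 x0; rewrite [leLHS]E /= (ord1 i).
Qed.

Lemma measurable_countable_comp d d' (T : measurableType d) (V : measurableType d') (K : countType)
  (z : T -> K) (F : K -> V) : (forall k, measurable (z @^-1` [set k])) ->
  measurable_fun setT (F \o z).
Proof.
move=> mz _ B mB; rewrite setTI.
rewrite (_ : _ @^-1` B = \bigcup_(k in [set: K]) (if k \in F @^-1` B then z @^-1` [set k] else set0)).
  apply: countable_bigcupT_measurable => [|k]; first exact: countableP.
  by case: ifP.
apply/seteqP; split => t /=.
  by move=> FB; exists (z t) => //=; rewrite mem_set.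
by move=> [k _]; case: ifPn => //; rewrite inE /= => + ->.
Qed.

Definition grid n m (t : n.-tuple mR) : n.-tuple int :=
  [tuple Num.floor (tnth t i * m.+1%:R) | i < n].

Lemma measurable_grid n m (k : n.-tuple int) :
  measurable ((@grid n m) @^-1` [set k]).
Proof.
rewrite (_ : _ @^-1` _ = \bigcap_(i in [set: 'I_n])
    ((fun t : n.-tuple mR => tnth t i) @^-1`
       [set` `[(tnth k i)%:~R / m.+1%:R, (tnth k i + 1)%:~R / m.+1%:R[ ])).
  apply: fin_bigcap_measurable => // i _; rewrite -[X in measurable X]setTI.
  exact: measurable_tnth.
have m0 : 0 < m.+1%:R :> R by [].
have E (x : R) (j : int) : (Num.floor (x * m.+1%:R) == j) =
   (x \in `[j%:~R / m.+1%:R, (j + 1)%:~R / m.+1%:R[).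
  by rewrite floor_eq in_itv /= ler_pdivrMr// ltr_pdivlMr.
apply/seteqP; split => t /=.
  by move=> <- i _ /=; rewrite -E tnth_mktuple.
move=> H; apply: eq_from_tnth => i; rewrite tnth_mktuple; apply/eqP.
by rewrite E; exact: H.
Qed.

(** A continuous function is the pointwise limit of its values at the nodes of finer
and finer grids, and a function that is constant on the countably many cells of a
grid is measurable. *)
Lemma measurable_row_comp n (f : 'rV[R]_n -> R) : continuous f ->
  measurable_fun [set: n.-tuple mR] (fun t => f (row_of t)).
Proof.
move=> cf.
pose F m (k : n.-tuple int) := f (\row_i ((tnth k i)%:~R / m.+1%:R)).
apply: (@measurable_fun_cvg _ _ _ _ (fun m => F m \o @grid n m)) => [m|t _].
  by apply: measurable_countable_comp => k; exact: measurable_grid.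
rewrite /F /=; apply: continuous_cvg; first exact: cf.
apply/cvgrPdist_le => e e0.
near=> m; apply: rV_norm_le => [|i]; first exact: ltW.
rewrite !mxE tnth_mktuple.
have m0 : 0 < m.+1%:R :> R by [].
have /andP[h1 h2] := floor_itv (tnth t i * m.+1%:R).
have h3 : m.+1%:R^-1 <= e by near: m; apply: filterS (near_infty_natSinv_lt (PosNum e0)) => k /ltW; apply.
apply: le_trans h3.
rewrite -{1}(mulfK (lt0r_neq0 m0) (tnth t i)) -mulrBl normrM.
rewrite (@ger0_norm _ m.+1%:R^-1)// ler_piMl//.
rewrite ger0_norm ?subr_ge0// lerBlDl ltW//.
by move: h2; rewrite intrD.
Unshelve. all: end_near. Qed.

Lemma measurable_tuple_consr n (x : R) :
  measurable_fun [set: n.-tuple mR] (fun t => tuple_cons (x : mR, t)).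
Proof.
apply: (measurableT_comp (@measurable_tuple_cons R n)).
by apply: measurable_fun_pair.
Qed.

End measurable_row.

(** * Integrals on the line *)

Section real_integrable.
Context d (T : measurableType d) (R : realType) (mu : {measure set T -> \bar R}).
Implicit Types f g : T -> R.

Lemma integrable_EFinZ k f : mu.-integrable setT (fun x => (f x)%:E) ->
  mu.-integrable setT (fun x => (k * f x)%:E).
Proof.
move=> fi; rewrite (_ : (fun x => _) = (fun x => k%:E * (f x)%:E)%E).
  exact: integrableZl.
by apply/funext => x; rewrite EFinM.
Qed.

Lemma integrable_EFinD f g : mu.-integrable setT (fun x => (f x)%:E) ->
  mu.-integrable setT (fun x => (g x)%:E) ->
  mu.-integrable setT (fun x => (f x + g x)%:E).
Proof.
move=> fi gi; rewrite (_ : (fun x => _) = (fun x => (f x)%:E + (g x)%:E)%E).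
  exact: integrableD.
by apply/funext => x; rewrite EFinD.
Qed.

Lemma integrable_EFinB f g : mu.-integrable setT (fun x => (f x)%:E) ->
  mu.-integrable setT (fun x => (g x)%:E) ->
  mu.-integrable setT (fun x => (f x - g x)%:E).
Proof.
move=> fi gi; rewrite (_ : (fun x => _) = (fun x => (f x)%:E - (g x)%:E)%E).
  exact: integrableB.
by apply/funext => x; rewrite EFinB.
Qed.

Lemma integrable_EFin_le f g : measurable_fun setT f ->
  (forall x, `|f x| <= g x) -> mu.-integrable setT (fun x => (g x)%:E) ->
  mu.-integrable setT (fun x => (f x)%:E).
Proof.
move=> mf fg gi; apply: le_integrable gi => //; first exact/measurable_EFinP.
by move=> x _ /=; rewrite lee_fin (le_trans (fg x))// ler_norm.
Qed.

Lemma integrable_EFin_measurable f : mu.-integrable setT (fun x => (f x)%:E) ->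
  measurable_fun setT f.
Proof. by move=> /integrableP[/measurable_EFinP]. Qed.

Lemma ge0_integrable_EFin f c : measurable_fun setT f -> (forall x, 0 <= f x) ->
  (\int[mu]_x (f x)%:E = c%:E)%E -> mu.-integrable setT (fun x => (f x)%:E).
Proof.
move=> mf f0 fc; apply/integrableP; split; first exact/measurable_EFinP.
by under eq_integral do rewrite gee0_abs ?lee_fin//; rewrite fc ltry.
Qed.

Lemma EFin_Rintegral f : mu.-integrable setT (fun x => (f x)%:E) ->
  ((\int[mu]_x f x)%:E = \int[mu]_x (f x)%:E)%E.
Proof. by move=> fi; rewrite /Rintegral fineK//; exact: integrable_fin_num. Qed.

End real_integrable.

Section one_dim.
Context {R : realType}.
Local Notation leb := (@lebesgue_measure R).

Lemma cvgr_scaled_inv_sqr (M : R) : M / (1 + x ^+ 2) @[x --> +oo%R] --> (0 : R).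
Proof.
rewrite -[X in _ --> X](mulr0 M); apply: cvgMr => //.
apply: (@squeeze_cvgr _ _ _ _ (cst 0) (fun x => x^-1)); last 2 first.
- exact: cvg_cst.
- by apply/gtr0_cvgV0; [exact: nbhs_pinfty_gt | exact: cvg_id].
near=> x; have x1 : 1 <= x by near: x; exact: nbhs_pinfty_ge.
have x2 : 0 < 1 + x ^+ 2 by rewrite ltr_wpDr// sqr_ge0.
rewrite /= invr_ge0 (ltW x2)/= lef_pV2 ?posrE//; nra.
Unshelve. all: end_near. Qed.

Lemma ge0_integral_split (G : R -> R) : continuous G -> (forall x, 0 <= G x) ->
  (\int[leb]_x (G x)%:E =
   \int[leb]_(x in `[0%R, +oo[) (G (- x))%:E + \int[leb]_(x in `[0%R, +oo[) (G x)%:E)%E.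
Proof.
move=> cG G0; have mG : measurable_fun setT (EFin \o G).
  by apply/measurable_EFinP; exact: continuous_measurable_fun.
rewrite -(setUv `]-oo, 0%R]%classic) ge0_integral_setU//=; last 4 first.
- exact: measurableC.
- by rewrite setUv.
- by move=> x _; rewrite lee_fin.
- exact/disj_setPCl.
rewrite setCitvl; congr (_ + _)%E; last first.
  by rewrite integral_itv_obnd_cbnd//; apply: measurable_funTS.
rewrite -{1}oppr0 ge0_integration_by_substitutionNy//.
exact: continuous_subspaceT.
Qed.

Lemma ge0_integral_oppr (G : R -> R) : continuous G -> (forall x, 0 <= G x) ->
  (\int[leb]_x (G x)%:E = \int[leb]_x (G (- x))%:E)%E.
Proof.
move=> cG G0; rewrite ge0_integral_split// [RHS]ge0_integral_split//.
  by under [in RHS]eq_integral do rewrite opprK; rewrite addeC.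
move=> x; apply: (@continuous_comp _ _ _ -%R G); first exact: opp_continuous.
exact: cG.
Qed.

Lemma ge0_FTC2y (f F : R -> R) a (l : R) :
  (forall x, a <= x -> 0 <= f x)%R -> continuous f ->
  F x @[x --> +oo%R] --> l ->
  (forall x : R, is_derive x 1 F (f x)) ->
  (\int[leb]_(x in `[a, +oo[) (f x)%:E = (l - F a)%:E)%E.
Proof.
move=> f0 cf Fl dF; rewrite EFinB; apply: ge0_continuous_FTC2y => //.
- exact: continuous_subspaceT.
- apply: cvg_at_right_filter; apply: differentiable_continuous.
  by apply/derivable1_diffP; have := dF a.
- by move=> x _; rewrite derive1E derive_val.
Qed.

Lemma ge0_FTC2 (f F : R -> R) (lp lm : R) :
  (forall x, 0 <= f x)%R -> continuous f ->
  F x @[x --> +oo%R] --> lp -> F (- x) @[x --> +oo%R] --> lm ->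
  (forall x : R, is_derive x 1 F (f x)) ->
  (\int[leb]_x (f x)%:E = (lp - lm)%:E)%E.
Proof.
move=> f0 cf Fp Fm dF; rewrite ge0_integral_split//.
rewrite (@ge0_FTC2y f F 0 lp)//.
have -> : (\int[leb]_(x in `[0%R, +oo[) (f (- x))%:E = (- lm - (- F (- 0))%R)%:E)%E.
  apply: (@ge0_FTC2y (fun x => f (- x)) (fun x => - F (- x))) => //.
  - move=> x; apply: (@continuous_comp _ _ _ -%R f); first exact: opp_continuous.
    exact: cf.
  - exact: cvgN.
  - move=> x; apply: is_derive_eq.
    by rewrite mulrN1 opprK.
by rewrite -EFinD oppr0; congr EFin; ring.
Qed.

Definition cauchy_weight (x : R) : R := (1 + x ^+ 2)^-1.

Lemma cauchy_den_gt0 (x : R) : 0 < 1 + x ^+ 2.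
Proof. by rewrite ltr_wpDr// sqr_ge0. Qed.

Lemma cauchy_weight_gt0 x : 0 < cauchy_weight x.
Proof. by rewrite invr_gt0 cauchy_den_gt0. Qed.

Lemma continuous_of_is_derive (F f : R -> R) :
  (forall x : R, is_derive x 1 F (f x)) -> continuous F.
Proof.
move=> dF x; apply: differentiable_continuous; apply/derivable1_diffP.
by have := dF x.
Qed.

Lemma continuous_inv_gt0 (f : R -> R) : (forall x, 0 < f x) -> continuous f ->
  continuous (fun x => (f x)^-1).
Proof. by move=> f0 cf x; apply: cvgV; [rewrite gt_eqF|exact: cf]. Qed.

Lemma continuous_cauchy_weight : continuous cauchy_weight.
Proof.
apply: continuous_inv_gt0 => [x|]; first exact: cauchy_den_gt0.
by move=> x; apply: cvgD; [exact: cvg_cst|exact: exprn_continuous].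
Qed.

Lemma integral_cauchy_weight : (\int[leb]_x (cauchy_weight x)%:E = pi%:E)%E.
Proof.
rewrite (@ge0_FTC2 cauchy_weight atan (pi / 2) (- (pi / 2))).
- by congr EFin; field.
- by move=> x; apply: ltW; exact: cauchy_weight_gt0.
- exact: continuous_cauchy_weight.
- exact: cvgy_atan.
- under eq_fun do rewrite atanN.
  by apply: cvgN; exact: cvgy_atan.
Qed.

Lemma cvgy_affine (c y : R) : 0 < c -> c * (x - y) @[x --> +oo%R] --> +oo%R.
Proof.
move=> c0; apply/cvgryPge => A; near=> x.
have : A / c + y <= x by near: x; apply: nbhs_pinfty_ge; exact: num_real.
by rewrite -lerBrDr ler_pdivrMr// mulrC.
Unshelve. all: end_near. Qed.

Lemma integral_poisson (e k y : R) : 0 < e -> 0 < k ->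
  (\int[leb]_x (2 * e / (e ^+ 2 + (k * (y - x)) ^+ 2))%:E = (2 * pi / k)%:E)%E.
Proof.
move=> e0 k0; pose c : R := k / e.
have c0 : 0 < c by rewrite divr_gt0.
have h2 (x : R) : 0 < e ^+ 2 + (k * (y - x)) ^+ 2.
  by rewrite ltr_pwDl ?exprn_gt0 ?sqr_ge0.
have dt : forall x : R, is_derive x 1 (fun x => (2 / k) * atan (c * (x - y)))
   (2 * e / (e ^+ 2 + (k * (y - x)) ^+ 2)).
  move=> x; apply: is_derive_eq.
  rewrite /GRing.scale /= /c.
  have h : 0 < 1 + (k / e * (x - y)) ^+ 2 by exact: cauchy_den_gt0.
  by have := h2 x; move=> h2x; field; rewrite !gt_eqF//=.
rewrite (ge0_FTC2 (F := fun x => (2 / k) * atan (c * (x - y)))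
  (lp := 2 / k * (pi / 2)) (lm := 2 / k * - (pi / 2)))//.
- by congr EFin; field; rewrite gt_eqF.
- by move=> x; rewrite divr_ge0 ?mulr_ge0 ?(ltW e0)// ltW.
- move=> x; apply: cvgMr.
  apply: (@continuous_inv_gt0 (fun x => e ^+ 2 + (k * (y - x)) ^+ 2)) => // z.
  apply: cvgD; first exact: cvg_cst.
  apply: (@continuous_comp _ _ _ (fun x => k * (y - x)) (fun x => x ^+ 2)).
    apply: cvgMr; apply: cvgB; [exact: cvg_cst|exact: cvg_id].
  exact: exprn_continuous.
- apply: cvgMr; exact: (cvg_comp _ _ (cvgy_affine y c0) (@cvgy_atan R)).
- rewrite (_ : (fun x => _) = (fun x => 2 / k * - atan (c * (x - - y)))).
    apply: cvgMr; apply: cvgN.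
    exact: (cvg_comp _ _ (cvgy_affine (- y) c0) (@cvgy_atan R)).
  by apply/funext => x; rewrite -atanN; congr (_ * atan _); ring.
Qed.

Lemma cvgy_expRN (e : R) : 0 < e -> expR (- (e * x)) @[x --> +oo%R] --> (0 : R).
Proof.
move=> e0; have := cvgy_affine 0 e0.
under eq_fun do rewrite subr0.
by move=> h; exact: (cvg_comp _ _ h (@cvgr_expR R)).
Qed.

Lemma cvg0_bounded_mul (F : set_system R) {FF : Filter F} (f g : R -> R) (M : R) :
  f x @[x --> F] --> (0 : R) -> (forall x, `|g x| <= M) ->
  f x * g x @[x --> F] --> (0 : R).
Proof.
move=> f0 gM; apply: norm_cvg0.
apply: (@squeeze_cvgr _ _ _ _ (cst 0) (fun x => `|f x| * M)); last 2 first.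
- exact: cvg_cst.
- rewrite -[X in _ --> X](mul0r M); apply: cvgMl.
  by rewrite -(@normr0 _ R); apply: cvg_norm.
by apply: nearW => x; rewrite normr_ge0 normrM ler_wpM2l.
Qed.

Definition laplace_weight (e x : R) : R := expR (- (e * `|x|)).

Lemma continuous_laplace_weight e : continuous (laplace_weight e).
Proof.
move=> x; apply: (@continuous_comp _ _ _ (fun x => - (e * `|x|)) expR).
  by apply: cvgN; apply: cvgMr; exact: norm_continuous.
exact: continuous_expR.
Qed.

Lemma integral_laplace_half (e : R) : 0 < e ->
  (\int[leb]_(x in `[0%R, +oo[) (laplace_weight e x)%:E = (e^-1)%:E)%E.
Proof.
move=> e0; transitivity (\int[leb]_(x in `[0%R, +oo[) (expR (- (e * x)))%:E)%E.
  by apply: eq_integral => x; rewrite inE/= in_itv/= andbT => x0; rewrite /laplace_weight ger0_norm.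
have dF : forall x : R, is_derive x 1 (fun x => - e^-1 * expR (- (e * x))) (expR (- (e * x))).
  by move=> x; apply: is_derive_eq; rewrite /GRing.scale /=; field; rewrite gt_eqF.
rewrite (ge0_FTC2y (F := fun x => - e^-1 * expR (- (e * x))) (l := - e^-1 * 0)) //.
- by rewrite !mulr0 oppr0 expR0; congr EFin; ring.
- move=> x; apply: (@continuous_comp _ _ _ (fun x => - (e * x)) expR).
    by apply: cvgN; apply: cvgMr; exact: cvg_id.
  exact: continuous_expR.
- by apply: cvgMr; exact: cvgy_expRN.
Qed.

Lemma integral_laplace_cos_half (e a : R) : 0 < e ->
  (\int[leb]_(x in `[0%R, +oo[) (laplace_weight e x * (1 + cos (a * x)))%:E =
   (e^-1 + e / (e ^+ 2 + a ^+ 2))%:E)%E.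
Proof.
move=> e0; transitivity (\int[leb]_(x in `[0%R, +oo[)
    (expR (- (e * x)) * (1 + cos (a * x)))%:E)%E.
  by apply: eq_integral => x; rewrite inE/= in_itv/= andbT => x0; rewrite /laplace_weight ger0_norm.
have h : 0 < e ^+ 2 + a ^+ 2 by rewrite ltr_pwDl ?exprn_gt0 ?sqr_ge0.
have dF : forall x : R, is_derive x 1
  (fun x => expR (- (e * x)) * (- e^-1 + (a * sin (a * x) - e * cos (a * x)) / (e ^+ 2 + a ^+ 2)))
  (expR (- (e * x)) * (1 + cos (a * x))).
  move=> x; apply: is_derive_eq.
  rewrite /GRing.scale /=; field.
  by rewrite !gt_eqF.
rewrite (ge0_FTC2y (F := fun x => expR (- (e * x)) *
  (- e^-1 + (a * sin (a * x) - e * cos (a * x)) / (e ^+ 2 + a ^+ 2))) (l := 0)) //.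
- rewrite !mulr0 oppr0 expR0 sin0 cos0; congr EFin; ring.
- move=> x; apply: cvgM.
    apply: (@continuous_comp _ _ _ (fun x => - (e * x)) expR).
      by apply: cvgN; apply: cvgMr; exact: cvg_id.
    exact: continuous_expR.
  apply: cvgD; first exact: cvg_cst.
  apply: (@continuous_comp _ _ _ (fun x => a * x) cos); last exact: continuous_cos.
  by apply: cvgMr; exact: cvg_id.
- apply: (cvg0_bounded_mul (M := e^-1 + (`|a| + e) / (e ^+ 2 + a ^+ 2))).
    exact: cvgy_expRN.
  move=> x; apply: (le_trans (ler_normD _ _)); rewrite normrN ger0_norm ?invr_ge0 ?(ltW e0)//.
  rewrite lerD2l normrM (@ger0_norm _ (_^-1)) ?invr_ge0 ?(ltW h)//.
  rewrite ler_pM2r ?invr_gt0//; apply: (le_trans (ler_normB _ _)).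
  rewrite !normrM (gtr0_norm e0) lerD//.
    by rewrite ler_piMr// ler_norml sin_geN1 sin_le1.
  by rewrite ler_piMr ?(ltW e0)// ler_norml cos_geN1 cos_le1.
Qed.

Lemma measurable_of_continuous (f : R -> R) : continuous f -> measurable_fun setT f.
Proof. exact: continuous_measurable_fun. Qed.

Lemma laplace_weight_ge0 e x : 0 <= laplace_weight e x.
Proof. exact: expR_ge0. Qed.

Lemma laplace_weightN e x : laplace_weight e (- x) = laplace_weight e x.
Proof. by rewrite /laplace_weight normrN. Qed.

Lemma integral_laplace_weight (e : R) : 0 < e ->
  (\int[leb]_x (laplace_weight e x)%:E = (2 / e)%:E)%E.
Proof.
move=> e0; rewrite ge0_integral_split; last 2 first.
- exact: continuous_laplace_weight.
- exact: laplace_weight_ge0.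
under eq_integral do rewrite laplace_weightN.
by rewrite integral_laplace_half// -EFinD; congr EFin; field; rewrite gt_eqF.
Qed.

Lemma integrable_laplace_weight (e : R) : 0 < e ->
  leb.-integrable setT (fun x => (laplace_weight e x)%:E).
Proof.
move=> e0; apply/integrableP; split.
  by apply/measurable_EFinP; apply: measurable_of_continuous; exact: continuous_laplace_weight.
under eq_integral do rewrite gee0_abs ?lee_fin ?laplace_weight_ge0//.
by rewrite integral_laplace_weight// ltry.
Qed.

Lemma integrable_laplace_weightM (e : R) (f : R -> R) (M : R) : 0 < e ->
  continuous f -> (forall x, `|f x| <= M) ->
  leb.-integrable setT (fun x => (laplace_weight e x * f x)%:E).
Proof.
move=> e0 cf fM.
have M0 : 0 <= M by exact: le_trans (fM 0).
apply: (@le_integrable _ _ _ leb _ _ _ (fun x => (M * laplace_weight e x)%:E)) => //.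
- apply/measurable_EFinP; apply: measurable_funM.
    by apply: measurable_of_continuous; exact: continuous_laplace_weight.
  exact: measurable_of_continuous.
- move=> x _ /=; rewrite lee_fin !normrM mulrC ler_pM//.
  by rewrite (le_trans (fM x))// ler_norm.
- by apply: integrable_EFinZ; exact: integrable_laplace_weight.
Qed.

Lemma continuous_cosM (a : R) : continuous (fun x : R => cos (a * x)).
Proof.
move=> x; apply: (@continuous_comp _ _ _ (fun x => a * x) cos); last exact: continuous_cos.
by apply: cvgMr; exact: cvg_id.
Qed.

Lemma continuous_sinM (a : R) : continuous (fun x : R => sin (a * x)).
Proof.
move=> x; apply: (@continuous_comp _ _ _ (fun x => a * x) sin); last exact: continuous_sin.
by apply: cvgMr; exact: cvg_id.
Qed.

Lemma norm_cos_le1 (x : R) : `|cos x| <= 1.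
Proof. by rewrite ler_norml cos_geN1 cos_le1. Qed.

Lemma norm_sin_le1 (x : R) : `|sin x| <= 1.
Proof. by rewrite ler_norml sin_geN1 sin_le1. Qed.

Lemma Rintegral_laplace_cos (e a : R) : 0 < e ->
  \int[leb]_x (laplace_weight e x * cos (a * x)) = 2 * e / (e ^+ 2 + a ^+ 2).
Proof.
move=> e0.
have h : 0 < e ^+ 2 + a ^+ 2 by rewrite ltr_pwDl ?exprn_gt0 ?sqr_ge0.
have i1 := integrable_laplace_weight e0.
have i2 := integrable_laplace_weightM e0 (@continuous_cosM a) (fun x => norm_cos_le1 (a * x)).
have H : \int[leb]_x (laplace_weight e x * (1 + cos (a * x))) =
   2 * (e^-1 + e / (e ^+ 2 + a ^+ 2)).
  rewrite /Rintegral ge0_integral_split; last 2 first.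
  - move=> x; apply: cvgM; first exact: continuous_laplace_weight.
    by apply: cvgD; [exact: cvg_cst|exact: continuous_cosM].
  - by move=> x; rewrite mulr_ge0 ?laplace_weight_ge0// -lerBlDl sub0r cos_geN1.
  under eq_integral do rewrite laplace_weightN mulrN cosN.
  rewrite integral_laplace_cos_half// -EFinD /=; ring.
have : \int[leb]_x (laplace_weight e x * (1 + cos (a * x))) =
   \int[leb]_x (laplace_weight e x) + \int[leb]_x (laplace_weight e x * cos (a * x)).
  by rewrite -RintegralD//; apply: eq_Rintegral => x _; rewrite mulrDr mulr1.
rewrite H /Rintegral integral_laplace_weight//= -/(Rintegral _ _ _) => E.
apply: (addrI (2 / e)); rewrite -E; field.
by rewrite !gt_eqF.
Qed.

Lemma Rintegral_laplace_sin (e a : R) : 0 < e ->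
  \int[leb]_x (laplace_weight e x * sin (a * x)) = 0.
Proof.
move=> e0.
have i1 := integrable_laplace_weight e0.
have i2 := integrable_laplace_weightM e0 (@continuous_sinM a) (fun x => norm_sin_le1 (a * x)).
have : \int[leb]_x (laplace_weight e x * (1 + sin (a * x))) =
       \int[leb]_x (laplace_weight e x * (1 - sin (a * x))).
  rewrite /Rintegral ge0_integral_oppr; last 2 first.
  - move=> x; apply: cvgM; first exact: continuous_laplace_weight.
    by apply: cvgD; [exact: cvg_cst|exact: continuous_sinM].
  - by move=> x; rewrite mulr_ge0 ?laplace_weight_ge0// -lerBlDl sub0r sin_geN1.
  by congr fine; apply: eq_integral => x _; rewrite laplace_weightN mulrN sinN.
under eq_Rintegral do rewrite mulrDr mulr1.
under [RHS]eq_Rintegral do rewrite mulrBr mulr1.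
by rewrite RintegralD// RintegralB//; lra.
Qed.

End one_dim.

(** * Integration by parts *)

Section n_dim.
Context {R : realType}.
Local Notation mR := (measurableTypeR R).
Local Notation leb := (@lebesgue_measure R).
Local Notation mu := (@lebesgue_tuple R).

Lemma measurable_cauchy_weight : measurable_fun setT (@cauchy_weight R).
Proof. exact: measurable_of_continuous (@continuous_cauchy_weight R). Qed.

Lemma integrable_cauchy_weight : leb.-integrable setT (fun x => (cauchy_weight x)%:E).
Proof.
apply: (ge0_integrable_EFin _ _ integral_cauchy_weight); first exact: measurable_cauchy_weight.
by move=> x; apply/ltW/cauchy_weight_gt0.
Qed.

Lemma cvg0_cauchy_bound (F : R -> R) M : (forall x, `|F x| <= M * cauchy_weight x) ->
  F x @[x --> +oo%R] --> (0 : R).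
Proof.
move=> FM; apply: norm_cvg0.
apply: (@squeeze_cvgr _ _ _ _ (cst 0) (fun x => M / (1 + x ^+ 2))); last 2 first.
- exact: cvg_cst.
- exact: cvgr_scaled_inv_sqr.
by apply: nearW => x; rewrite normr_ge0 /=; exact: FM.
Qed.

Lemma cauchy_weightN (x : R) : cauchy_weight (- x) = cauchy_weight x.
Proof. by rewrite /cauchy_weight sqrrN. Qed.

(** Adding [M * cauchy_weight] makes the integrand nonnegative, and then the
fundamental theorem needs only the limits of the primitive [M * atan + F]; these
are the limits of [M * atan], since [F] vanishes at infinity. *)
Lemma integral_derive0 (F G : R -> R) M : continuous G ->
  (forall x : R, is_derive x 1 F (G x)) ->
  (forall x, `|F x| <= M * cauchy_weight x) ->
  (forall x, `|G x| <= M * cauchy_weight x) ->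
  (\int[leb]_x (G x)%:E = 0)%E.
Proof.
move=> cG dF FM GM.
have iW : leb.-integrable setT (fun x => (M * cauchy_weight x)%:E).
  apply: integrable_EFinZ; exact: integrable_cauchy_weight.
have iG : leb.-integrable setT (fun x => (G x)%:E).
  by apply: (@integrable_EFin_le _ mR R leb _ (fun x => M * cauchy_weight x)) => //; exact: measurable_of_continuous.
have cW : continuous (fun x => M * cauchy_weight x).
  by move=> x; apply: cvgMr; exact: continuous_cauchy_weight.
have W0 (x : R) : 0 <= M * cauchy_weight x by exact: le_trans (FM x).
have dW : forall x : R, is_derive x 1 (fun x => M * atan x) (M * cauchy_weight x).
  by move=> x; apply: is_derive_eq.
have dWF : forall x : R, is_derive x 1 (fun x => M * atan x + F x) (M * cauchy_weight x + G x).
  by move=> x; apply: is_derive_eq.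
have aty : M * atan x @[x --> +oo%R] --> M * (pi / 2) by apply: cvgMr; exact: cvgy_atan.
have atNy : M * atan (- x) @[x --> +oo%R] --> M * - (pi / 2).
  by under eq_fun do rewrite atanN; apply: cvgMr; apply: cvgN; exact: cvgy_atan.
have E1 : (\int[leb]_x (M * cauchy_weight x)%:E = (M * (pi / 2) - M * - (pi / 2))%:E)%E.
  exact: (ge0_FTC2 W0 cW aty atNy).
have E2 : (\int[leb]_x (M * cauchy_weight x + G x)%:E =
    ((M * (pi / 2) + 0) - (M * - (pi / 2) + 0))%:E)%E.
  apply: (ge0_FTC2 (F := (fun x => M * atan x + F x))) => //.
  - by move=> x; rewrite -lerBlDl sub0r; have := GM x; rewrite ler_norml => /andP[].
  - by move=> x; apply: cvgD; [exact: cW|exact: cG].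
  - by apply: cvgD; [exact: aty|exact: cvg0_cauchy_bound FM].
  - apply: cvgD; first exact: atNy.
    by apply: (@cvg0_cauchy_bound _ M) => x; rewrite -cauchy_weightN.
rewrite -EFin_Rintegral//; congr EFin.
have : \int[leb]_x (M * cauchy_weight x + G x) =
  \int[leb]_x (M * cauchy_weight x) + \int[leb]_x (G x) by rewrite RintegralD.
by rewrite /Rintegral E1 E2 /= -/(Rintegral _ _ _) => h; lra.
Qed.

Lemma integrable_prodE n (g : 'I_n -> R -> R) :
  (forall i x, 0 <= g i x) -> (forall i, leb.-integrable setT (fun x => (g i x)%:E)) ->
  (mu n).-integrable setT (fun t => (\prod_(i < n) g i (tnth t i))%:E) /\
  \int[mu n]_t (\prod_(i < n) g i (tnth t i)) = \prod_(i < n) \int[leb]_x (g i x).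
Proof.
move=> g0 gi.
have mg i : measurable_fun setT (g i) := integrable_EFin_measurable (gi i).
have E : (\int[mu n]_t (\prod_(i < n) g i (tnth t i))%:E =
   (\prod_(i < n) \int[leb]_x (g i x))%:E)%E.
  rewrite integral_tuple_prodE// (big_morph EFin (@EFinM R) erefl); apply: eq_bigr => i _.
  by rewrite EFin_Rintegral.
split; last by rewrite /Rintegral E.
apply: ge0_integrable_EFin E; first exact: measurable_prod_tnth.
by move=> t; rewrite prodr_ge0.
Qed.

(** A positive integrable weight on R^n that splits into one-variable weights: a bound by
it survives the restriction to slices, and its powers absorb polynomial growth. *)
Definition decay n (t : n.-tuple mR) : R := \prod_(i < n) cauchy_weight (tnth t i).

Lemma decay_gt0 n (t : n.-tuple mR) : 0 < decay t.
Proof. by apply: prodr_gt0 => i _; exact: cauchy_weight_gt0. Qed.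

Lemma decay_cons n (x : mR) (t : n.-tuple mR) :
  decay (tuple_cons (x, t)) = cauchy_weight x * decay t.
Proof.
rewrite /decay big_ord_recl; congr (_ * _).
by apply: eq_bigr => i _; rewrite /tuple_cons tnthS.
Qed.

Lemma integrable_decay n : (mu n).-integrable setT (fun t => (decay t)%:E).
Proof.
have [] := @integrable_prodE n (fun=> @cauchy_weight R) => //.
  by move=> _ x; exact/ltW/cauchy_weight_gt0.
by move=> _; exact: integrable_cauchy_weight.
Qed.

Lemma integrable_le_decay n (f : n.-tuple mR -> R) M :
  measurable_fun [set: n.-tuple mR] f -> (forall t, `|f t| <= M * decay t) ->
  (mu n).-integrable setT (fun t => (f t)%:E).
Proof.
move=> mf fM; apply: (integrable_EFin_le (g := fun t => M * decay t)) => //.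
by apply: integrable_EFinZ; exact: integrable_decay.
Qed.

Definition upd n (t : n.-tuple mR) (j : 'I_n) (s : R) : n.-tuple mR :=
  [tuple if i == j then s else tnth t i | i < n].

Lemma upd_cons0 n (x y : mR) (t : n.-tuple mR) :
  upd (tuple_cons (x, t)) ord0 y = tuple_cons (y, t).
Proof.
apply: eq_from_tnth => i; rewrite tnth_mktuple.
by have [j ->|->//] := unliftP ord0 i; rewrite /= /tuple_cons !tnthS.
Qed.

Lemma upd_consS n (x : mR) (t : n.-tuple mR) j y :
  upd (tuple_cons (x, t)) (lift ord0 j) y = tuple_cons (x, upd t j y).
Proof.
apply: eq_from_tnth => i; rewrite tnth_mktuple.
have [k ->|->//] := unliftP ord0 i; rewrite /tuple_cons !tnthS tnth_mktuple.
by rewrite (inj_eq lift_inj).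
Qed.

(** By induction on the dimension Fubini isolates the j-th variable, in which the
integral of a derivative vanishes. *)
Lemma integral_partial0 n (j : 'I_n) (F G : n.-tuple mR -> R) M :
  measurable_fun [set: n.-tuple mR] G ->
  (forall t (s : R), is_derive s 1 (fun s => F (upd t j s)) (G (upd t j s))) ->
  (forall t, continuous (fun s => G (upd t j s))) ->
  (forall t, `|F t| <= M * decay t) -> (forall t, `|G t| <= M * decay t) ->
  (\int[mu n]_t (G t)%:E = 0)%E.
Proof.
elim: n j F G M => [[] []//|n IH] j F G M mG dF cG FM GM.
have iG := integrable_le_decay mG GM.
have [j' jE|jE] := unliftP ord0 j; subst j.
  rewrite integral_tupleS//; apply: integral0_eq => x _.
  apply: (IH j' (fun t => F (tuple_cons (x, t))) (fun t => G (tuple_cons (x, t)))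
       (M * cauchy_weight x)).
  - exact: (measurableT_comp mG (measurable_tuple_consr x)).
  - by move=> t s; have := dF (tuple_cons (x, t)) s; under eq_fun do rewrite upd_consS; rewrite upd_consS.
  - by move=> t; have := cG (tuple_cons (x, t)); under eq_fun do rewrite upd_consS.
  - by move=> t; rewrite -mulrA -decay_cons.
  - by move=> t; rewrite -mulrA -decay_cons.
rewrite integral_tupleS'//; apply: integral0_eq => t _.
apply: (@integral_derive0 (fun x => F (tuple_cons (x : mR, t)))
   (fun x => G (tuple_cons (x : mR, t))) (M * decay t)).
- by have := cG (tuple_cons (0 : mR, t)); under eq_fun do rewrite upd_cons0.
- move=> x; have := dF (tuple_cons (0 : mR, t)) x.
  by under eq_fun do rewrite upd_cons0; rewrite upd_cons0.
- by move=> x; rewrite -mulrA (mulrC (decay t)) -decay_cons.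
- by move=> x; rewrite -mulrA (mulrC (decay t)) -decay_cons.
Qed.

End n_dim.

(** * Dominated integrals and Fubini *)

Section Rintegral_linear.
Context d (T : measurableType d) (R : realType) (mu : {measure set T -> \bar R}).
Implicit Types f g : T -> R.

Lemma Rintegral_scale k f : mu.-integrable setT (fun x => (f x)%:E) ->
  \int[mu]_x (k * f x) = k * \int[mu]_x f x.
Proof. by move=> fi; rewrite RintegralZl. Qed.

Lemma Rintegral_add f g : mu.-integrable setT (fun x => (f x)%:E) ->
  mu.-integrable setT (fun x => (g x)%:E) ->
  \int[mu]_x (f x + g x) = \int[mu]_x f x + \int[mu]_x g x.
Proof. by move=> fi gi; rewrite RintegralD. Qed.

Lemma Rintegral_sub f g : mu.-integrable setT (fun x => (f x)%:E) ->
  mu.-integrable setT (fun x => (g x)%:E) ->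
  \int[mu]_x (f x - g x) = \int[mu]_x f x - \int[mu]_x g x.
Proof. by move=> fi gi; rewrite RintegralB. Qed.

Lemma ler_Rintegral f g : mu.-integrable setT (fun x => (f x)%:E) ->
  mu.-integrable setT (fun x => (g x)%:E) -> (forall x, f x <= g x) ->
  \int[mu]_x f x <= \int[mu]_x g x.
Proof. by move=> fi gi fg; apply: le_Rintegral. Qed.

Lemma integrable_EFin_norm f : mu.-integrable setT (fun x => (f x)%:E) ->
  mu.-integrable setT (fun x => `|f x|%:E).
Proof. by move=> /integrable_norm. Qed.

Lemma ler_norm_Rintegral f : mu.-integrable setT (fun x => (f x)%:E) ->
  `|\int[mu]_x f x| <= \int[mu]_x `|f x|.
Proof. by move=> fi; apply: le_normr_Rintegral. Qed.

End Rintegral_linear.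

Section limits_and_fubini.
Context d1 d2 (T1 : measurableType d1) (T2 : measurableType d2) (R : realType).
Variables (m1 : {sigma_finite_measure set T1 -> \bar R})
          (m2 : {sigma_finite_measure set T2 -> \bar R}).

Lemma fatou_bound (g_ : nat -> T1 -> R) (g : T1 -> R) (C : \bar R) :
  (forall m, measurable_fun setT (g_ m)) -> (forall m x, 0 <= g_ m x) ->
  (forall x, g_ m x @[m --> \oo] --> g x) ->
  (forall m, \int[m1]_x (g_ m x)%:E <= C)%E -> (\int[m1]_x (g x)%:E <= C)%E.
Proof.
move=> mg g0 gg gC.
have := @fatou _ _ _ m1 _ measurableT (fun m x => (g_ m x)%:E)
  
  (fun m => (measurable_EFinP _ _).2 (mg m)) (fun m x _ => g0 m x).
have -> : (\int[m1]_x limn_einf (fun m => (g_ m x)%:E) = \int[m1]_x (g x)%:E)%E.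
  apply: eq_integral => x _.
  have /cvg_limn_einf_sup [] // : (g_ m x)%:E @[m --> \oo] --> (g x)%:E.
  by apply: cvg_EFin; [exact: nearW|exact: gg].
move=> /le_trans; apply; rewrite limn_einf_lim; apply: lime_le.
  exact: is_cvg_einfs.
apply: nearW => m; apply: le_trans (gC m).
by apply: ereal_inf_lbound; exists m => /=.
Qed.

Lemma integrable_prod_mul (f1 : T1 -> R) (f2 : T2 -> R) :
  m1.-integrable setT (fun x => (f1 x)%:E) -> m2.-integrable setT (fun x => (f2 x)%:E) ->
  (m1 \x m2)%E.-integrable setT (fun p => (f1 p.1 * f2 p.2)%:E).
Proof.
move=> i1 i2; have mf1 := integrable_EFin_measurable i1.
have mf2 := integrable_EFin_measurable i2.
apply/integrable12ltyP.
  apply/measurable_EFinP; apply: measurable_funM.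
    exact: (measurableT_comp mf1 measurable_fst).
  exact: (measurableT_comp mf2 measurable_snd).
have /integrableP[_ l1] := i1; have /integrableP[_ l2] := i2.
under eq_integral => x _.
  under eq_integral => y _ do rewrite /= normrM EFinM.
  rewrite ge0_integralZl//; last first.
    by apply/measurable_EFinP; apply: measurableT_comp.
  over.
rewrite ge0_integralZr//; last 2 first.
- by apply/measurable_EFinP; apply: measurableT_comp.
- exact: integral_ge0.
by rewrite lte_mul_pinfty// ?integral_ge0// ge0_fin_numE// integral_ge0.
Qed.

Variables (h : T1 * T2 -> R) (g1 : T1 -> R) (g2 : T2 -> R).
Hypothesis mh : measurable_fun [set: T1 * T2] h.
Hypothesis i1 : m1.-integrable setT (fun x => (g1 x)%:E).
Hypothesis i2 : m2.-integrable setT (fun x => (g2 x)%:E).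
Hypothesis hg : forall x y, `|h (x, y)| <= g1 x * g2 y.

Lemma integrable_dominated_prod : (m1 \x m2)%E.-integrable setT (fun p => (h p)%:E).
Proof.
apply: (integrable_EFin_le (g := fun p => g1 p.1 * g2 p.2)) => //.
  by move=> [x y]; exact: hg.
exact: integrable_prod_mul.
Qed.

Lemma integrable_slice1 x : m2.-integrable setT (fun y => (h (x, y))%:E).
Proof.
apply: (integrable_EFin_le (g := fun y => g1 x * g2 y)) => //.
  by apply: (measurableT_comp mh).
exact: integrable_EFinZ.
Qed.

Lemma integrable_slice2 y : m1.-integrable setT (fun x => (h (x, y))%:E).
Proof.
apply: (integrable_EFin_le (g := fun x => g2 y * g1 x)) => //.
- by apply: (measurableT_comp mh).
- by move=> x; rewrite mulrC.
exact: integrable_EFinZ.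
Qed.

Lemma measurable_Rintegral1 : measurable_fun setT (fun x => \int[m2]_y h (x, y)).
Proof.
apply/measurable_EFinP; have := measurable_fubini_F integrable_dominated_prod.
by apply: eq_measurable_fun => x _; rewrite /= EFin_Rintegral//; exact: integrable_slice1.
Qed.

Lemma Rintegral_fubini :
  \int[m1]_x (\int[m2]_y h (x, y)) = \int[m2]_y (\int[m1]_x h (x, y)).
Proof.
rewrite [LHS]/Rintegral [RHS]/Rintegral; congr fine.
transitivity (\int[m1]_x \int[m2]_y (h (x, y))%:E)%E.
  by apply: eq_integral => x _; rewrite EFin_Rintegral//; exact: integrable_slice1.
rewrite (@Fubini _ _ _ _ _ m1 m2 (fun p => (h p)%:E)); last exact: integrable_dominated_prod.
by apply: eq_integral => y _; rewrite EFin_Rintegral//; exact: integrable_slice2.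
Qed.

Lemma Rintegral_dominated_le x : `|\int[m2]_y h (x, y)| <= g1 x * \int[m2]_y g2 y.
Proof.
apply: (le_trans (le_normr_Rintegral measurableT (integrable_slice1 x))).
rewrite -RintegralZl//; apply: le_Rintegral => //.
- by apply/integrable_norm/integrable_slice1.
- exact: integrable_EFinZ.
Qed.

Lemma integrable_Rintegral1 : m1.-integrable setT (fun x => (\int[m2]_y h (x, y))%:E).
Proof.
apply: (integrable_EFin_le (g := fun x => (\int[m2]_y g2 y) * g1 x)).
- exact: measurable_Rintegral1.
- by move=> x; rewrite mulrC; exact: Rintegral_dominated_le.
- exact: integrable_EFinZ.
Qed.

End limits_and_fubini.

Section laplace_kernel.
Context {R : realType}.
Local Notation mR := (measurableTypeR R).
Local Notation leb := (@lebesgue_measure R).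
Local Notation mu := (@lebesgue_tuple R).

Lemma Rintegral_tupleS n (f : n.+1.-tuple mR -> R) :
  (mu n.+1).-integrable setT (fun t => (f t)%:E) ->
  (forall x : mR, (mu n).-integrable setT (fun t => (f (tuple_cons (x, t)))%:E)) ->
  \int[mu n.+1]_t f t = \int[leb]_x \int[mu n]_t f (tuple_cons (x, t)).
Proof.
move=> fi si; rewrite /Rintegral integral_tupleS//; congr fine.
by apply: eq_integral => x _; rewrite -EFin_Rintegral.
Qed.

Definition dot n (x y : n.-tuple mR) : R := \sum_(i < n) tnth x i * tnth y i.

Lemma dot_cons n (a b : mR) (x y : n.-tuple mR) :
  dot (tuple_cons (a, x)) (tuple_cons (b, y)) = a * b + dot x y.
Proof.
rewrite /dot big_ord_recl; congr (_ + _).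
by apply: eq_bigr => i _; rewrite /tuple_cons !tnthS.
Qed.

Lemma measurable_dot_prod n :
  measurable_fun [set: n.-tuple mR * n.-tuple mR] (fun p => dot p.1 p.2).
Proof.
apply: measurable_sum => i; apply: measurable_funM.
  exact: (measurableT_comp (measurable_tnth i) measurable_fst).
exact: (measurableT_comp (measurable_tnth i) measurable_snd).
Qed.

Lemma measurable_cos : measurable_fun setT (@cos R).
Proof. by apply: measurable_of_continuous; exact: continuous_cos. Qed.

Lemma measurable_sin : measurable_fun setT (@sin R).
Proof. by apply: measurable_of_continuous; exact: continuous_sin. Qed.

(** Damping by this weight makes double integrals of trigonometric kernels absolutely
convergent, and its own transform is a positive kernel. *)
Definition laplace (e : R) n (t : n.-tuple mR) : R := \prod_(i < n) laplace_weight e (tnth t i).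

Lemma laplace_ge0 e n (t : n.-tuple mR) : 0 <= laplace e t.
Proof. by apply: prodr_ge0 => i _; exact: laplace_weight_ge0. Qed.

Lemma laplace_cons e n (x : mR) (t : n.-tuple mR) :
  laplace e (tuple_cons (x, t)) = laplace_weight e x * laplace e t.
Proof.
rewrite /laplace big_ord_recl; congr (_ * _).
by apply: eq_bigr => i _; rewrite /tuple_cons tnthS.
Qed.

Lemma integrable_laplace (e : R) n : 0 < e -> (mu n).-integrable setT (fun t => (laplace e t)%:E).
Proof.
move=> e0; have [] := @integrable_prodE R n (fun=> laplace_weight e) => //.
  by move=> _ x; exact: laplace_weight_ge0.
by move=> _; exact: integrable_laplace_weight.
Qed.

Lemma measurable_laplace e n : measurable_fun [set: n.-tuple mR] (laplace e (n := n)).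
Proof.
apply: (@measurable_prod_tnth R n (fun=> laplace_weight e)) => i.
apply: measurable_of_continuous.
exact: continuous_laplace_weight.
Qed.

Lemma integrable_laplaceM (e : R) n (f : n.-tuple mR -> R) : 0 < e ->
  measurable_fun [set: n.-tuple mR] f -> (forall t, `|f t| <= 1) ->
  (mu n).-integrable setT (fun t => (laplace e t * f t)%:E).
Proof.
move=> e0 mf f1; apply: (integrable_EFin_le (g := fun t => laplace e t)).
- by apply: measurable_funM => //; exact: measurable_laplace.
- by move=> t; rewrite normrM ger0_norm ?laplace_ge0// ler_piMr// laplace_ge0.
- exact: integrable_laplace.
Qed.

(** The product Poisson kernel, written for the frequency [k]: its mass in the variable
[v] does not depend on [e]. *)
Definition poisson (e k : R) n (v : n.-tuple mR) : R :=
  \prod_(i < n) (2 * e / (e ^+ 2 + (k * tnth v i) ^+ 2)).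

Lemma measurable_dotl n (v : n.-tuple mR) : measurable_fun [set: n.-tuple mR] (fun x => dot x v).
Proof.
by apply: measurable_sum => i; apply: measurable_funM => //; exact: measurable_tnth.
Qed.

(** The addition formulas peel off one variable at a time, so the cosine and the sine
integrals have to be computed together; the sine contributions vanish by symmetry. *)
Lemma laplace_kernel (e k : R) n (v : n.-tuple mR) : 0 < e ->
  \int[mu n]_x (laplace e x * cos (k * dot x v)) = poisson e k v /\
  \int[mu n]_x (laplace e x * sin (k * dot x v)) = 0.
Proof.
move=> e0.
have mc m (w : m.-tuple mR) a : measurable_fun [set: m.-tuple mR] (fun x => cos (k * (a + dot x w))).
  apply: measurableT_comp; first exact: measurable_cos.
  by apply: measurable_funM => //; apply: measurable_funD => //; exact: measurable_dotl.
have ms m (w : m.-tuple mR) a : measurable_fun [set: m.-tuple mR] (fun x => sin (k * (a + dot x w))).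
  apply: measurableT_comp; first exact: measurable_sin.
  by apply: measurable_funM => //; apply: measurable_funD => //; exact: measurable_dotl.
have ic m (w : m.-tuple mR) a : (mu m).-integrable setT (fun x => (laplace e x * cos (k * (a + dot x w)))%:E).
  by apply: integrable_laplaceM => // t; exact: norm_cos_le1.
have is_ m (w : m.-tuple mR) a : (mu m).-integrable setT (fun x => (laplace e x * sin (k * (a + dot x w)))%:E).
  by apply: integrable_laplaceM => // t; exact: norm_sin_le1.
have ic0 m (w : m.-tuple mR) : (mu m).-integrable setT (fun x => (laplace e x * cos (k * dot x w))%:E).
  by have := ic m w 0; under eq_fun do rewrite add0r.
have is0 m (w : m.-tuple mR) : (mu m).-integrable setT (fun x => (laplace e x * sin (k * dot x w))%:E).
  by have := is_ m w 0; under eq_fun do rewrite add0r.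
elim: n v => [|n IH] v.
  rewrite /Rintegral !integral_dirac//=; last 2 first.
    by apply/measurable_EFinP; exact: integrable_EFin_measurable (is0 _ v).
    by apply/measurable_EFinP; exact: integrable_EFin_measurable (ic0 _ v).
  rewrite /dot /laplace /poisson !indicT !big_ord0 mulr0 cos0 sin0.
  by rewrite !mulr1 !mulr0.
case/tupleP: v => b v; rewrite -[[tuple of b :: v]]/(tuple_cons (b : mR, v)).
have [IHc IHs] := IH v.
split.
- rewrite Rintegral_tupleS//; last first.
    move=> x; under eq_fun do rewrite laplace_cons dot_cons -mulrA.
    exact: integrable_EFinZ.
  transitivity (\int[leb]_x (poisson e k v * (laplace_weight e x * cos ((k * b) * x)))).
    apply: eq_Rintegral => x _.
    transitivity (\int[mu n]_t (laplace_weight e x * cos ((k * b) * x) * (laplace e t * cos (k * dot t v))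
       - laplace_weight e x * sin ((k * b) * x) * (laplace e t * sin (k * dot t v)))).
      apply: eq_Rintegral => t _; rewrite laplace_cons dot_cons mulrDr cosD.
      by rewrite (_ : k * (x * b) = k * b * x) ; ring.
    rewrite Rintegral_sub; [|exact: integrable_EFinZ|exact: integrable_EFinZ].
    rewrite !Rintegral_scale//.
    by rewrite IHc IHs mulr0 subr0 mulrC.
  rewrite Rintegral_scale; last first.
    by apply: integrable_laplace_weightM => //; [exact: continuous_cosM|move=> x; exact: norm_cos_le1].
  rewrite Rintegral_laplace_cos// /poisson big_ord_recl mulrC; congr (_ * _).
  by apply: eq_bigr => i _; rewrite /tuple_cons tnthS.
- rewrite Rintegral_tupleS//; last first.
    move=> x; under eq_fun do rewrite laplace_cons dot_cons -mulrA.
    exact: integrable_EFinZ.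
  transitivity (\int[leb]_x (poisson e k v * (laplace_weight e x * sin ((k * b) * x)))).
    apply: eq_Rintegral => x _.
    transitivity (\int[mu n]_t (laplace_weight e x * sin ((k * b) * x) * (laplace e t * cos (k * dot t v))
       + laplace_weight e x * cos ((k * b) * x) * (laplace e t * sin (k * dot t v)))).
      apply: eq_Rintegral => t _; rewrite laplace_cons dot_cons mulrDr sinD.
      by rewrite (_ : k * (x * b) = k * b * x); ring.
    rewrite Rintegral_add; [|exact: integrable_EFinZ|exact: integrable_EFinZ].
    rewrite !Rintegral_scale//.
    by rewrite IHc IHs mulr0 addr0 mulrC.
  rewrite Rintegral_scale; last first.
    by apply: integrable_laplace_weightM => //; [exact: continuous_sinM|move=> x; exact: norm_sin_le1].
  by rewrite Rintegral_laplace_sin// mulr0.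
Qed.

End laplace_kernel.

Section fubini2.
Context d1 d2 (T1 : measurableType d1) (T2 : measurableType d2) (R : realType).
Variables (m1 : {sigma_finite_measure set T1 -> \bar R})
          (m2 : {sigma_finite_measure set T2 -> \bar R}).
Variables (h : T1 * T2 -> R) (g1 : T1 -> R) (g2 : T2 -> R).
Hypothesis mh : measurable_fun [set: T1 * T2] h.
Hypothesis i1 : m1.-integrable setT (fun x => (g1 x)%:E).
Hypothesis i2 : m2.-integrable setT (fun x => (g2 x)%:E).
Hypothesis hg : forall x y, `|h (x, y)| <= g1 x * g2 y.

Lemma integrable_Rintegral2 : m2.-integrable setT (fun y => (\int[m1]_x h (x, y))%:E).
Proof.
apply: (@integrable_Rintegral1 _ _ _ _ _ m2 m1 (fun p => h (p.2, p.1)) g2 g1) => //.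
  by apply: (measurableT_comp mh); apply: measurable_fun_pair.
by move=> y x; rewrite mulrC.
Qed.

End fubini2.

(** * The Plancherel inequality *)

Section plancherel.
Context {R : realType}.
Local Notation mR := (measurableTypeR R).
Local Notation leb := (@lebesgue_measure R).
Local Notation mu := (@lebesgue_tuple R).

Definition tsub n (y z : n.-tuple mR) : n.-tuple mR := [tuple tnth y i - tnth z i | i < n].

Lemma dot_tsub n (x y z : n.-tuple mR) : dot x (tsub y z) = dot x y - dot x z.
Proof.
rewrite /dot -sumrB; apply: eq_bigr => i _.
by rewrite tnth_mktuple mulrBr.
Qed.

Lemma poisson_ge0 (e k : R) n (v : n.-tuple mR) : 0 < e -> 0 <= poisson e k v.
Proof.
move=> e0; apply: prodr_ge0 => i _; rewrite divr_ge0 ?mulr_ge0 ?(ltW e0)//.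
by rewrite addr_ge0// sqr_ge0.
Qed.

Lemma poisson_tsubC (e k : R) n (y z : n.-tuple mR) : poisson e k (tsub y z) = poisson e k (tsub z y).
Proof.
apply: eq_bigr => i _; rewrite !tnth_mktuple; congr (_ / (_ + _)).
by rewrite -(sqrrN (k * _)) -mulrN opprB.
Qed.

Lemma continuous_poisson1 (e k : R) : 0 < e ->
  continuous (fun v : R => 2 * e / (e ^+ 2 + (k * v) ^+ 2)).
Proof.
move=> e0 v; apply: cvgMr.
apply: (@continuous_inv_gt0 _ (fun v => e ^+ 2 + (k * v) ^+ 2)) => [x|x].
  by rewrite ltr_pwDl ?exprn_gt0 ?sqr_ge0.
apply: cvgD; first exact: cvg_cst.
apply: (@continuous_comp _ _ _ (fun x => k * x) (fun x => x ^+ 2)).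
  by apply: cvgMr; exact: cvg_id.
exact: exprn_continuous.
Qed.

Lemma measurable_poisson_prod (e k : R) n : 0 < e ->
  measurable_fun [set: n.-tuple mR * n.-tuple mR] (fun p => poisson e k (tsub p.1 p.2)).
Proof.
move=> e0; rewrite /poisson; apply: measurable_prod => i _.
under eq_fun do rewrite tnth_mktuple.
apply: (measurableT_comp (measurable_of_continuous (continuous_poisson1 (k := k) e0))).
apply: measurable_funB.
  exact: (measurableT_comp (measurable_tnth i) measurable_fst).
exact: (measurableT_comp (measurable_tnth i) measurable_snd).
Qed.

Lemma integral_poisson_tuple (e k : R) n (y : n.-tuple mR) : 0 < e -> 0 < k ->
  (\int[mu n]_z (poisson e k (tsub y z))%:E = ((2 * pi / k) ^+ n)%:E)%E.
Proof.
move=> e0 k0.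
transitivity (\int[mu n]_z (\prod_(i < n)
   (2 * e / (e ^+ 2 + (k * (tnth y i - tnth z i)) ^+ 2)))%:E)%E.
  by apply: eq_integral => z _; congr EFin; apply: eq_bigr => i _; rewrite tnth_mktuple.
rewrite (@integral_tuple_prodE R n (fun i x => 2 * e / (e ^+ 2 + (k * (tnth y i - x)) ^+ 2))).
- transitivity ((\prod_(i < n) (2 * pi / k))%:E); last by rewrite prodr_const card_ord.
  rewrite (big_morph EFin (@EFinM R) erefl).
  by apply: eq_bigr => i _; exact: integral_poisson.
- move=> i; apply: (measurableT_comp (measurable_of_continuous (continuous_poisson1 (k := k) e0))).
  exact: measurable_funB.
- move=> i x; rewrite divr_ge0 ?mulr_ge0 ?(ltW e0)//.
  by rewrite addr_ge0// sqr_ge0.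
Qed.

(** The Fourier transform of a real function at frequency [k * x] is
[ft_cos - i ft_sin]. *)
Definition ft_cos k n (f : n.-tuple mR -> R) x := \int[mu n]_y (f y * cos (k * dot x y)).
Definition ft_sin k n (f : n.-tuple mR -> R) x := \int[mu n]_y (f y * sin (k * dot x y)).

Section fixed_function.
Variables (k : R) (n : nat) (f : n.-tuple mR -> R).
Hypothesis k0 : 0 < k.
Hypothesis fi : (mu n).-integrable setT (fun t => (f t)%:E).

Let mf : measurable_fun [set: n.-tuple mR] f := integrable_EFin_measurable fi.

Let fin : (mu n).-integrable setT (fun t => `|f t|%:E).
Proof. exact: integrable_EFin_norm. Qed.

Let N1 := \int[mu n]_y `|f y|.

Lemma measurable_cos_dot_prod :
  measurable_fun [set: n.-tuple mR * n.-tuple mR] (fun p => cos (k * dot p.1 p.2)).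
Proof.
apply: (measurableT_comp (@measurable_cos R)); apply: measurable_funM => //.
exact: measurable_dot_prod.
Qed.

Lemma measurable_sin_dot_prod :
  measurable_fun [set: n.-tuple mR * n.-tuple mR] (fun p => sin (k * dot p.1 p.2)).
Proof.
apply: (measurableT_comp (@measurable_sin R)); apply: measurable_funM => //.
exact: measurable_dot_prod.
Qed.

Lemma integrable_mul_bounded (g : n.-tuple mR -> R) : measurable_fun [set: n.-tuple mR] g ->
  (forall x, `|g x| <= 1) -> (mu n).-integrable setT (fun t => (f t * g t)%:E).
Proof.
move=> mg g1; apply: (integrable_EFin_le (g := fun t => `|f t|)) => //.
- exact: measurable_funM.
- by move=> x; rewrite normrM ler_piMr.
Qed.

Lemma measurable_cos_dot x : measurable_fun [set: n.-tuple mR] (fun y => cos (k * dot x y)).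
Proof. exact: (measurableT_comp measurable_cos_dot_prod (measurable_pair1 x)). Qed.

Lemma measurable_sin_dot x : measurable_fun [set: n.-tuple mR] (fun y => sin (k * dot x y)).
Proof. exact: (measurableT_comp measurable_sin_dot_prod (measurable_pair1 x)). Qed.

Lemma integrable_ft_cos x : (mu n).-integrable setT (fun y => (f y * cos (k * dot x y))%:E).
Proof.
apply: integrable_mul_bounded; first exact: measurable_cos_dot.
by move=> y; exact: norm_cos_le1.
Qed.

Lemma integrable_ft_sin x : (mu n).-integrable setT (fun y => (f y * sin (k * dot x y))%:E).
Proof.
apply: integrable_mul_bounded; first exact: measurable_sin_dot.
by move=> y; exact: norm_sin_le1.
Qed.

Lemma norm_ft_cos_le x : `|ft_cos k f x| <= N1.
Proof.
apply: (le_trans (ler_norm_Rintegral (integrable_ft_cos x))).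
apply: ler_Rintegral => //; first by apply: integrable_EFin_norm; exact: integrable_ft_cos.
by move=> y; rewrite normrM ler_piMr// norm_cos_le1.
Qed.

Lemma norm_ft_sin_le x : `|ft_sin k f x| <= N1.
Proof.
apply: (le_trans (ler_norm_Rintegral (integrable_ft_sin x))).
apply: ler_Rintegral => //; first by apply: integrable_EFin_norm; exact: integrable_ft_sin.
by move=> y; rewrite normrM ler_piMr// norm_sin_le1.
Qed.

Lemma laplace_gt0 (e : R) (t : n.-tuple mR) : 0 < laplace e t.
Proof. by apply: prodr_gt0 => i _; exact: expR_gt0. Qed.

Lemma measurable_ft (c : n.-tuple mR * n.-tuple mR -> R) :
  measurable_fun [set: n.-tuple mR * n.-tuple mR] c -> (forall p, `|c p| <= 1) ->
  measurable_fun [set: n.-tuple mR] (fun x => \int[mu n]_y (f y * c (x, y))).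
Proof.
move=> mc c1.
have ml := @measurable_laplace R 1 n.
have il := @integrable_laplace R 1 n ltr01.
have mh : measurable_fun [set: n.-tuple mR * n.-tuple mR]
    (fun p => laplace 1 p.1 * (f p.2 * c p)).
  apply: measurable_funM; first exact: (measurableT_comp ml measurable_fst).
  by apply: measurable_funM => //; exact: (measurableT_comp mf measurable_snd).
have hb x y : `|laplace 1 x * (f y * c (x, y))| <= laplace 1 x * `|f y|.
  by rewrite normrM (ger0_norm (laplace_ge0 _ _)) ler_wpM2l ?laplace_ge0// normrM ler_piMr.
have := measurable_Rintegral1 mh il fin hb => /= mI.
rewrite (_ : (fun x => _) = (fun x => (laplace 1 x)^-1 *
   \int[mu n]_y (laplace 1 x * (f y * c (x, y))))).
  apply: measurable_funM => //.
  rewrite (_ : (fun x => _) = (fun x => laplace 1 x `^ (-1))).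
    exact: (measurableT_comp (measurable_powR (-1)) ml).
  by apply/funext => x; rewrite powR_inv1// laplace_ge0.
apply/funext => x; rewrite Rintegral_scale.
  by rewrite mulrA mulVf ?mul1r// gt_eqF// laplace_gt0.
by apply: integrable_mul_bounded => // ; exact: (measurableT_comp mc (measurable_pair1 x)).
Qed.

Lemma measurable_ft_cos : measurable_fun [set: n.-tuple mR] (ft_cos k f).
Proof.
apply: (measurable_ft measurable_cos_dot_prod) => p; exact: norm_cos_le1.
Qed.

Lemma measurable_ft_sin : measurable_fun [set: n.-tuple mR] (ft_sin k f).
Proof.
apply: (measurable_ft measurable_sin_dot_prod) => p; exact: norm_sin_le1.
Qed.

Lemma ler_normM2 (a b M : R) : `|a| <= 1 -> `|b| <= M -> `|a * b| <= M.
Proof.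
move=> a1 bM; rewrite normrM; apply: le_trans bM.
by rewrite -[leRHS]mul1r ler_wpM2r.
Qed.

(* The inverse transform of the transform of f, damped by the Laplace weight. *)
Let A e y := \int[mu n]_x (laplace e x *
  (cos (k * dot x y) * ft_cos k f x + sin (k * dot x y) * ft_sin k f x)).

Let H1 e (p : n.-tuple mR * n.-tuple mR) := laplace e p.1 * (f p.2 *
  (cos (k * dot p.1 p.2) * ft_cos k f p.1 + sin (k * dot p.1 p.2) * ft_sin k f p.1)).

Let mH1 e : measurable_fun [set: n.-tuple mR * n.-tuple mR] (H1 e).
Proof.
apply: measurable_funM; first exact: (measurableT_comp (@measurable_laplace R e n) measurable_fst).
apply: measurable_funM; first exact: (measurableT_comp mf measurable_snd).
apply: measurable_funD; apply: measurable_funM.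
- exact: measurable_cos_dot_prod.
- exact: (measurableT_comp measurable_ft_cos measurable_fst).
- exact: measurable_sin_dot_prod.
- exact: (measurableT_comp measurable_ft_sin measurable_fst).
Qed.

Let H1_le e x y : `|H1 e (x, y)| <= (2 * N1) * laplace e x * `|f y|.
Proof.
rewrite /H1 normrM (ger0_norm (laplace_ge0 _ _)) /= normrM.
rewrite (mulrC (2 * N1)) -mulrA ler_wpM2l ?laplace_ge0// mulrC ler_wpM2r//.
rewrite (le_trans (ler_normD _ _))// mulr_natl mulr2n lerD//.
- by apply: ler_normM2; [exact: norm_cos_le1|exact: norm_ft_cos_le].
- by apply: ler_normM2; [exact: norm_sin_le1|exact: norm_ft_sin_le].
Qed.

Let iL2 e : 0 < e -> (mu n).-integrable setT (fun x => ((2 * N1) * laplace e x)%:E).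
Proof. by move=> e0; apply: integrable_EFinZ; exact: integrable_laplace. Qed.

Let H1_int1 e x : \int[mu n]_y H1 e (x, y) =
  laplace e x * (ft_cos k f x ^+ 2 + ft_sin k f x ^+ 2).
Proof.
rewrite /H1 /=.
transitivity (\int[mu n]_y (laplace e x * (ft_cos k f x) * (f y * cos (k * dot x y)) +
   laplace e x * (ft_sin k f x) * (f y * sin (k * dot x y)))).
  by apply: eq_Rintegral => y _; ring.
rewrite Rintegral_add.
- rewrite !Rintegral_scale; [|exact: integrable_ft_sin|exact: integrable_ft_cos].
  rewrite -/(ft_cos k f x) -/(ft_sin k f x); ring.
- by apply: integrable_EFinZ; exact: integrable_ft_cos.
- by apply: integrable_EFinZ; exact: integrable_ft_sin.
Qed.

Let H1_int2 e y : 0 < e -> \int[mu n]_x H1 e (x, y) = f y * A e y.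
Proof.
move=> e0; rewrite /A -Rintegral_scale.
  by apply: eq_Rintegral => x _; rewrite /H1 /=; ring.
apply: (integrable_EFin_le (g := fun x => (2 * N1) * laplace e x)); last exact: iL2.
  apply: measurable_funM; first exact: measurable_laplace.
  apply: measurable_funD; apply: measurable_funM.
  - exact: (measurableT_comp measurable_cos_dot_prod (measurable_pair2 y)).
  - exact: measurable_ft_cos.
  - exact: (measurableT_comp measurable_sin_dot_prod (measurable_pair2 y)).
  - exact: measurable_ft_sin.
move=> x; rewrite normrM (ger0_norm (laplace_ge0 _ _)) mulrC ler_wpM2r ?laplace_ge0//.
rewrite (le_trans (ler_normD _ _))// mulr_natl mulr2n lerD//.
- by apply: ler_normM2; [exact: norm_cos_le1|exact: norm_ft_cos_le].
- by apply: ler_normM2; [exact: norm_sin_le1|exact: norm_ft_sin_le].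
Qed.

Let A_kernel e y : 0 < e -> A e y = \int[mu n]_z (f z * poisson e k (tsub y z)).
Proof.
move=> e0.
pose H2 (p : n.-tuple mR * n.-tuple mR) := laplace e p.1 * (f p.2 *
  (cos (k * dot p.1 y) * cos (k * dot p.1 p.2) + sin (k * dot p.1 y) * sin (k * dot p.1 p.2))).
have mH2 : measurable_fun [set: n.-tuple mR * n.-tuple mR] H2.
  apply: measurable_funM; first exact: (measurableT_comp (@measurable_laplace R e n) measurable_fst).
  apply: measurable_funM; first exact: (measurableT_comp mf measurable_snd).
  apply: measurable_funD; apply: measurable_funM.
  - exact: (measurableT_comp (measurableT_comp measurable_cos_dot_prod (measurable_pair2 y)) measurable_fst).
  - exact: measurable_cos_dot_prod.
  - exact: (measurableT_comp (measurableT_comp measurable_sin_dot_prod (measurable_pair2 y)) measurable_fst).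
  - exact: measurable_sin_dot_prod.
have E x z : H2 (x, z) = f z * (laplace e x * cos (k * dot x (tsub y z))).
  by rewrite /H2 /= dot_tsub mulrBr cosB; ring.
have H2_le x z : `|H2 (x, z)| <= laplace e x * `|f z|.
  rewrite E normrM mulrC ler_wpM2r// normrM (ger0_norm (laplace_ge0 _ _)).
  by rewrite ler_piMr ?laplace_ge0// norm_cos_le1.
have H := Rintegral_fubini mH2 (integrable_laplace n e0) fin H2_le.
transitivity (\int[mu n]_x \int[mu n]_z H2 (x, z)).
  apply: eq_Rintegral => x _; rewrite /H2 /=.
  transitivity (\int[mu n]_z (laplace e x * cos (k * dot x y) * (f z * cos (k * dot x z)) +
     laplace e x * sin (k * dot x y) * (f z * sin (k * dot x z)))); last first.
    by apply: eq_Rintegral => z _; ring.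
  rewrite Rintegral_add.
  - rewrite !Rintegral_scale; [|exact: integrable_ft_sin|exact: integrable_ft_cos].
    rewrite -/(ft_cos k f x) -/(ft_sin k f x); ring.
  - by apply: integrable_EFinZ; exact: integrable_ft_cos.
  - by apply: integrable_EFinZ; exact: integrable_ft_sin.
rewrite H; apply: eq_Rintegral => z _.
under eq_Rintegral do rewrite E.
rewrite Rintegral_scale; first by have [-> _] := laplace_kernel k (tsub y z) e0.
apply: (@integrable_laplaceM R e n (fun t => cos (k * dot t (tsub y z))) e0).
  exact: (measurableT_comp measurable_cos_dot_prod (measurable_pair2 (tsub y z))).
by move=> t; exact: (norm_cos_le1 (k * dot t (tsub y z))).
Qed.

Let D : R := (2 * pi / k) ^+ n.

Let D0 : 0 <= D.
Proof. by rewrite exprn_ge0// divr_ge0 ?mulr_ge0 ?pi_ge0// ltW. Qed.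

Let fA_le e y : 0 < e -> (`|f y * A e y|%:E <=
  \int[mu n]_z ((2^-1 * f y ^+ 2 * poisson e k (tsub y z))%:E +
     (2^-1 * f z ^+ 2 * poisson e k (tsub y z))%:E))%E.
Proof.
move=> e0; rewrite A_kernel//.
have mP : measurable_fun [set: n.-tuple mR] (fun z => poisson e k (tsub y z)).
  exact: (measurableT_comp (@measurable_poisson_prod e k n e0) (measurable_pair1 y)).
rewrite normrM EFinM; apply: (@le_trans _ _ (`|f y|%:E * \int[mu n]_z (`|f z| * poisson e k (tsub y z))%:E)%E).
  apply: lee_wpmul2l => //.
  have [i|ni] := pselect ((mu n).-integrable setT (fun z => (f z * poisson e k (tsub y z))%:E)).
    rewrite -abse_EFin EFin_Rintegral//; apply: (le_trans (le_abse_integral _ measurableT _)).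
      by case/integrableP : i.
    apply: ge0_le_integral => //.
    - by apply: measurableT_comp => //; case/integrableP : i.
    - apply/measurable_EFinP; apply: measurable_funM => //; exact: measurableT_comp.
    - by move=> z _; rewrite lee_fin normrM (ger0_norm (poisson_ge0 _ _ e0)).
  have [->|] := eqVneq (\int[mu n]_z (f z * poisson e k (tsub y z))) 0.
    by rewrite normr0 integral_ge0// => z _; rewrite lee_fin mulr_ge0 ?poisson_ge0.
  move=> _; rewrite (_ : (\int[mu n]_z _)%E = +oo%E) ?leey//.
  apply/eqP; rewrite -leye_eq leNgt; apply: contra_notN ni => fin'.
  apply/integrableP; split; first by apply/measurable_EFinP; apply: measurable_funM.
  apply: le_lt_trans fin'; apply: ge0_le_integral => //.
  - by apply: measurableT_comp => //; apply/measurable_EFinP; apply: measurable_funM.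
  - apply/measurable_EFinP; apply: measurable_funM => //; exact: measurableT_comp.
  - by move=> z _ /=; rewrite lee_fin normrM (ger0_norm (poisson_ge0 _ _ e0)).
rewrite -ge0_integralZl//; last 2 first.
- by apply/measurable_EFinP; apply: measurable_funM => //; exact: measurableT_comp.
- by move=> z _; rewrite lee_fin mulr_ge0 ?poisson_ge0.
apply: ge0_le_integral => //.
- by move=> z _; rewrite -EFinM lee_fin !mulr_ge0 ?poisson_ge0.
- apply/measurable_EFinP; apply: measurable_funM => //; apply: measurable_funM => //.
  exact: measurableT_comp.
- under eq_fun do rewrite -EFinD; apply/measurable_EFinP.
  by apply: measurable_funD; do 2 apply: measurable_funM => //; apply: measurable_funX.
- move=> z _; rewrite -EFinM -EFinD lee_fin -mulrDl mulrA ler_wpM2r ?poisson_ge0//.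
  rewrite -(real_normK (num_real (f y))) -(real_normK (num_real (f z))).
  have := sqr_ge0 (`|f y| - `|f z|); nra.
Qed.

Let Q_le e : 0 < e ->
  (\int[mu n]_x (laplace e x * (ft_cos k f x ^+ 2 + ft_sin k f x ^+ 2))%:E <=
   D%:E * \int[mu n]_y (f y ^+ 2)%:E)%E.
Proof.
move=> e0.
have iQ : (mu n).-integrable setT (fun x =>
   (laplace e x * (ft_cos k f x ^+ 2 + ft_sin k f x ^+ 2))%:E).
  have := integrable_Rintegral1 (mH1 e) (iL2 e0) fin (H1_le e).
  by under eq_fun do rewrite H1_int1.
have iA : (mu n).-integrable setT (fun y => (f y * A e y)%:E).
  have := integrable_Rintegral2 (mH1 e) (iL2 e0) fin (H1_le e).
  by under eq_fun do rewrite H1_int2//.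
have mf2 : measurable_fun [set: n.-tuple mR] (fun y => 2^-1 * f y ^+ 2).
  by apply: measurable_funM => //; apply: measurable_funX.
have mPp := @measurable_poisson_prod e k n e0.
have mP y : measurable_fun [set: n.-tuple mR] (fun z => poisson e k (tsub y z)).
  exact: (measurableT_comp mPp (measurable_pair1 y)).
have mf21 : measurable_fun [set: n.-tuple mR * n.-tuple mR]
   (fun p => (2^-1 * f p.1 ^+ 2 * poisson e k (tsub p.1 p.2))%:E).
  apply/measurable_EFinP; apply: measurable_funM => //.
  exact: (measurableT_comp mf2 measurable_fst).
have mf22 : measurable_fun [set: n.-tuple mR * n.-tuple mR]
   (fun p => (2^-1 * f p.2 ^+ 2 * poisson e k (tsub p.1 p.2))%:E).
  apply/measurable_EFinP; apply: measurable_funM => //.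
  exact: (measurableT_comp mf2 measurable_snd).
have f2P0 (a : R) y z : (0 <= (2^-1 * a ^+ 2 * poisson e k (tsub y z))%:E)%E.
  by rewrite lee_fin mulr_ge0 ?poisson_ge0// mulr_ge0 ?sqr_ge0.
rewrite -EFin_Rintegral//.
have -> : \int[mu n]_x (laplace e x * (ft_cos k f x ^+ 2 + ft_sin k f x ^+ 2)) =
   \int[mu n]_y (f y * A e y).
  transitivity (\int[mu n]_x \int[mu n]_y H1 e (x, y)).
    by apply: eq_Rintegral => x _; rewrite H1_int1.
  rewrite (Rintegral_fubini (mH1 e) (iL2 e0) fin (H1_le e)).
  by apply: eq_Rintegral => y _; rewrite H1_int2.
apply: (@le_trans _ _ (\int[mu n]_y \int[mu n]_z ((2^-1 * f y ^+ 2 * poisson e k (tsub y z))%:E +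
     (2^-1 * f z ^+ 2 * poisson e k (tsub y z))%:E))%E).
  apply: (@le_trans _ _ (\int[mu n]_y (`|f y * A e y|)%:E)%E).
    rewrite -EFin_Rintegral; last exact: integrable_EFin_norm.
    by rewrite lee_fin (le_trans (ler_norm _))// ler_norm_Rintegral.
  apply: (ge0_le_integral _ measurableT).
  - by move=> y _; rewrite lee_fin.
  - by apply/measurable_EFinP; apply: measurableT_comp => //; exact: integrable_EFin_measurable iA.
  - have mF : measurable_fun [set: n.-tuple mR * n.-tuple mR] (fun p =>
     ((2^-1 * f p.1 ^+ 2 * poisson e k (tsub p.1 p.2))%:E +
     (2^-1 * f p.2 ^+ 2 * poisson e k (tsub p.1 p.2))%:E)%E).
      exact: emeasurable_funD.
    apply: (@measurable_fun_fubini_tonelli_F _ _ _ _ _ (mu n) _ mF) => p; exact: adde_ge0.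
  - by move=> y _; exact: fA_le.
under eq_integral => y _.
  rewrite ge0_integralD//; last 2 first.
  - by apply/measurable_EFinP; apply: measurable_funM.
  - by apply/measurable_EFinP; apply: measurable_funM.
  over.
rewrite (ge0_integralD _ measurableT); last 4 first.
- by move=> y _; apply: integral_ge0.
- apply: (@measurable_fun_fubini_tonelli_F _ _ _ _ _ (mu n) _ mf21) => p; exact: f2P0.
- by move=> y _; apply: integral_ge0.
- apply: (@measurable_fun_fubini_tonelli_F _ _ _ _ _ (mu n) _ mf22) => p; exact: f2P0.
have half : (\int[mu n]_y \int[mu n]_z (2^-1 * f y ^+ 2 * poisson e k (tsub y z))%:E =
   D%:E * \int[mu n]_y (2^-1 * f y ^+ 2)%:E)%E.
  rewrite -ge0_integralZl//; last 2 first.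
  - exact/measurable_EFinP.
  - by move=> y _; rewrite lee_fin mulr_ge0 ?sqr_ge0.
  apply: eq_integral => y _.
  under eq_integral do rewrite EFinM.
  rewrite (ge0_integralZl _ measurableT); last 3 first.
  - exact/measurable_EFinP.
  - by move=> z _; rewrite lee_fin poisson_ge0.
  - by rewrite lee_fin mulr_ge0 ?sqr_ge0.
  by rewrite integral_poisson_tuple// muleC.
rewrite half.
rewrite (@fubini_tonelli _ _ _ _ _ (mu n) (mu n) _ mf22)//=.
under [X in (_ + X)%E]eq_integral do under eq_integral do rewrite poisson_tsubC.
rewrite half -ge0_muleDr ?integral_ge0//; last 2 first.
- by move=> y _; rewrite lee_fin mulr_ge0 ?sqr_ge0.
- by move=> y _; rewrite lee_fin mulr_ge0 ?sqr_ge0.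
rewrite -(ge0_integralD _ measurableT); last 4 first.
- by move=> y _; rewrite lee_fin mulr_ge0 ?sqr_ge0.
- exact/measurable_EFinP.
- by move=> y _; rewrite lee_fin mulr_ge0 ?sqr_ge0.
- exact/measurable_EFinP.
rewrite le_eqVlt; apply/orP; left; apply/eqP; congr (_ * _)%E.
by apply: eq_integral => y _; rewrite -EFinD; congr EFin; field.
Qed.

(** With the Laplace weight inserted on the left, Fubini turns the integral into the
quadratic form of the Poisson kernel in [f], bounded by Schur's test: the kernel is
symmetric with constant mass, and a b <= (a^2 + b^2)/2.  The weights tend to 1
pointwise, and Fatou's lemma removes them. *)
Theorem plancherel_le :
  (\int[mu n]_x (ft_cos k f x ^+ 2 + ft_sin k f x ^+ 2)%:E <=
   ((2 * pi / k) ^+ n)%:E * \int[mu n]_y (f y ^+ 2)%:E)%E.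
Proof.
apply: (@fatou_bound _ _ _ (mu n) (fun m x => laplace m.+1%:R^-1 x *
   (ft_cos k f x ^+ 2 + ft_sin k f x ^+ 2))).
- move=> m; apply: measurable_funM; first exact: measurable_laplace.
  by apply: measurable_funD; apply: measurable_funX; [exact: measurable_ft_cos|exact: measurable_ft_sin].
- by move=> m x; rewrite mulr_ge0 ?laplace_ge0 ?addr_ge0 ?sqr_ge0.
- move=> x; rewrite -[X in _ --> X]mul1r; apply: cvgMl.
  rewrite (_ : (fun m => _) = (fun m => \prod_(i < n) laplace_weight m.+1%:R^-1 (tnth x i)))//.
  rewrite -[X in _ --> X](_ : \prod_(i < n) (1 : R) = 1); last by rewrite big1.
  apply: (@cvg_big _ _ _ _ _ (@mul_continuous R)) => i _.
  rewrite /laplace_weight -[X in _ --> X]expR0.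
  apply: continuous_cvg; first exact: continuous_expR.
  rewrite -[X in _ --> X]oppr0; apply: cvgN; rewrite -[X in _ --> X](mul0r `|tnth x i|).
  by apply: cvgMl; exact: cvg_harmonic.
- by move=> m; exact: Q_le.
Qed.

End fixed_function.
End plancherel.

(** * Real interpolation *)

Section layer_cake.
Context d (T : measurableType d) (R : realType) (m1 : {sigma_finite_measure set T -> \bar R}).
Local Notation mR := (measurableTypeR R).
Local Notation leb := (@lebesgue_measure R).

Definition subgraph (F : T -> R) : set (T * mR) := [set p | 0 <= p.2 < F p.1].

Lemma measurable_subgraph (F : T -> R) : measurable_fun setT F -> measurable (subgraph F).
Proof.
move=> mF.
have m1' : measurable_fun [set: T * mR] (fun p => (0 : R) <= (p.2 : R)).
  by apply: measurable_fun_ler => //; exact: measurable_snd.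
have m2' : measurable_fun [set: T * mR] (fun p => (p.2 : R) < F p.1).
  apply: measurable_fun_ltr; first exact: measurable_snd.
  exact: (measurableT_comp mF measurable_fst).
have -> : subgraph F = (fun p => ((0 : R) <= (p.2 : R)) && ((p.2 : R) < F p.1)) @^-1` [set true].
  by apply/seteqP; split => p /=.
rewrite -[X in measurable X]setTI.
by apply: (measurable_and m1' m2').
Qed.

(** [F x] is the length of the section of the subgraph of [F] above [x]. *)
Lemma ge0_layer_cake (g F : T -> R) : measurable_fun setT g -> measurable_fun setT F ->
  (forall x, 0 <= g x) -> (forall x, 0 <= F x) ->
  (\int[m1]_x (g x * F x)%:E = \int[leb]_s \int[m1]_x (g x * \1_(subgraph F) (x, s))%:E)%E.
Proof.
move=> mg mF g0 F0.
have mgF : measurable_fun [set: T * mR] (fun p => (g p.1 * \1_(subgraph F) p)%:E).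
  apply/measurable_EFinP; apply: measurable_funM.
    exact: (measurableT_comp mg measurable_fst).
  by apply: measurable_indic; exact: measurable_subgraph.
have gF0 p : (0 <= (g p.1 * \1_(subgraph F) p)%:E)%E by rewrite lee_fin mulr_ge0.
rewrite -(@fubini_tonelli _ _ _ _ _ m1 leb _ mgF gF0).
apply: eq_integral => x _ /=.
have -> : (\int[leb]_s (g x * \1_(subgraph F) (x, s))%:E =
   \int[leb]_s ((g x)%:E * (\1_(`[0%R, F x[) s)%:E))%E.
  apply: eq_integral => s _; rewrite -EFinM; congr (_ * _)%:E.
rewrite ge0_integralZl//; last 2 first.
- by apply/measurable_EFinP; apply: measurable_indic.
- by rewrite lee_fin.
rewrite integral_indic// setIT EFinM; congr (_ * _)%E; apply/esym.
transitivity (if ((0%R : R)%:E < (F x)%:E)%E then ((F x)%:E - 0)%E else 0%E).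
  exact: (@lebesgue_measure_itv R (Interval (BLeft 0) (BLeft (F x)))).
rewrite lte_fin; case: ifPn => [_|]; first by rewrite sube0.
by rewrite -leNgt => Fx0; have /eqP -> : F x == 0 by [rewrite eq_le Fx0 F0].
Qed.

End layer_cake.

Lemma powR_le2 {R : realType} (s a b : R) : 0 < s -> 0 <= a -> 0 <= b ->
  (a `^ s <= b `^ s) = (a <= b).
Proof.
move=> s0 a0 b0; apply/idP/idP => [|ab].
  by apply: contraTT; rewrite -!ltNge => ba; apply: gt0_ltr_powR; rewrite ?nnegrE.
by apply: ge0_ler_powR; rewrite ?nnegrE// ltW.
Qed.

Section marcinkiewicz.
Context d1 d2 (T1 : measurableType d1) (T2 : measurableType d2) (R : realType).
Variables (m1 : {sigma_finite_measure set T1 -> \bar R})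
          (m2 : {sigma_finite_measure set T2 -> \bar R}).
Variables (c : T1 * T2 -> R) (D : R).
Hypothesis mc : measurable_fun setT c.
Hypothesis c1 : forall p, `|c p| <= 1.
Let L (f : T2 -> R) x := \int[m2]_y (f y * c (x, y)).
Hypothesis mL : forall f, m2.-integrable setT (fun y => (f y)%:E) -> measurable_fun setT (L f).
Hypothesis D0 : 0 <= D.
Hypothesis L2 : forall f, m2.-integrable setT (fun y => (f y)%:E) ->
  (\int[m1]_x (L f x ^+ 2)%:E <= D%:E * \int[m2]_y (f y ^+ 2)%:E)%E.
Local Notation leb := (@lebesgue_measure R).
Local Notation mR := (measurableTypeR R).

Let iL f x : m2.-integrable setT (fun y => (f y)%:E) ->
  m2.-integrable setT (fun y => (f y * c (x, y))%:E).
Proof.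
move=> fi; apply: (integrable_EFin_le (g := fun y => `|f y|)) => //.
- apply: measurable_funM; first exact: integrable_EFin_measurable fi.
  exact: (measurableT_comp mc (measurable_pair1 x)).
- by move=> y; rewrite normrM ler_piMr.
- exact: integrable_EFin_norm.
Qed.

Let L_le f x : m2.-integrable setT (fun y => (f y)%:E) -> `|L f x| <= \int[m2]_y `|f y|.
Proof.
move=> fi; apply: (le_trans (ler_norm_Rintegral (iL x fi))); apply: ler_Rintegral.
- exact/integrable_EFin_norm/iL.
- exact: integrable_EFin_norm.
- by move=> y; rewrite normrM ler_piMr.
Qed.

(** An operator bounded from L^1 to L^oo and from L^2 to L^2 maps L^q to L^r, r being
conjugate to q.  Integrate |L h|^r over the levels la of |L h|.  The part of [h] where
|h|^(q-1) >= 2N/la has L^1 norm at most la/2, so it contributes at most half of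
|L h| where |L h| > la; the L^2 bound on the remaining part is integrated over
all levels. *)
Lemma marcinkiewicz (h : T2 -> R) (q r N : R) : 1 < q < 2 -> (q - 1) * r = q ->
  m2.-integrable setT (fun y => (h y)%:E) -> 0 < N ->
  (\int[m2]_y (`|h y| `^ q)%:E <= N%:E)%E ->
  (\int[m1]_x (`|L h x| `^ r)%:E <= (4 * D * (2 * N) `^ (r - 2) * N)%:E)%E.
Proof.
move=> /andP[q1 q2] rE hi N0 hN.
have q10 : 0 < q - 1 by rewrite subr_gt0.
have r2 : 2 < r by nra.
pose s := r - 2.
have s0 : 0 < s by rewrite subr_gt0.
have mh := integrable_EFin_measurable hi.
have mnh : measurable_fun setT (fun y => `|h y|) by exact: measurableT_comp.
have mLh := mL hi.
have mnLh : measurable_fun setT (fun y => `|L h y|) by exact: measurableT_comp.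
pose F1 x := `|L h x| `^ s.
pose F2 y := (2 * N * `|h y| `^ (1 - q)) `^ s.
have mF1 : measurable_fun setT F1 by exact: (measurableT_comp (measurable_powR s) mnLh).
have mF2 : measurable_fun setT F2.
  apply: (measurableT_comp (measurable_powR s)); apply: measurable_funM => //.
  exact: (measurableT_comp (measurable_powR (1 - q)) mnh).
have -> : (\int[m1]_x (`|L h x| `^ r)%:E = \int[m1]_x (L h x ^+ 2 * F1 x)%:E)%E.
  apply: eq_integral => x _; congr EFin.
  rewrite -(real_normK (num_real (L h x))) /F1 -powR_mulrn// -powRD.
    by rewrite /s addrC subrK.
  by rewrite addrC subrK gt_eqF ?implybT// (lt_trans _ r2).
rewrite (@ge0_layer_cake _ _ _ m1); [|exact: measurable_funX|exact: mF1|by move=> x; exact: sqr_ge0|by move=> x; exact: powR_ge0].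
apply: (@le_trans _ _ (\int[m2]_y (4 * D * h y ^+ 2 * F2 y)%:E)%E); last first.
  apply: (@le_trans _ _ (\int[m2]_y ((4 * D * (2 * N) `^ s)%:E * (`|h y| `^ q)%:E))%E); last first.
    rewrite ge0_integralZl//; last 2 first.
    - by apply/measurable_EFinP; exact: (measurableT_comp (measurable_powR q) mnh).
    - by rewrite lee_fin !mulr_ge0 ?powR_ge0.
    by rewrite [leRHS]EFinM; apply: lee_wpmul2l => //; rewrite lee_fin !mulr_ge0 ?powR_ge0.
  rewrite le_eqVlt; apply/orP; left; apply/eqP.
  apply: eq_integral => y _; rewrite -EFinM; congr EFin.
  rewrite -!(mulrA (4 * D)); congr (_ * _); rewrite /F2; apply/esym.
  have [h0|hn0] := eqVneq (h y) 0.
    by rewrite h0 normr0 expr0n /= mul0r powR0 ?mulr0// gt_eqF// (lt_trans _ q1).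
  have hp : 0 < `|h y| by rewrite normr_gt0.
  rewrite (_ : (2 * N * `|h y| `^ (1 - q)) `^ s = (2 * N) `^ s * (`|h y| `^ (1 - q)) `^ s); last first.
    by rewrite powRM ?powR_ge0// mulr_ge0// ltW.
  rewrite mulrCA.
  congr (_ * _).
  rewrite -(real_normK (num_real (h y))) -powR_mulrn// -powRrM -powRD; last first.
    by rewrite (gt_eqF hp) implybT.
  by congr (_ `^ _); rewrite /s; nra.
rewrite (@ge0_layer_cake _ _ _ m2); last 4 first.
- by apply: measurable_funM => //; apply: measurable_funX.
- exact: mF2.
- by move=> x; rewrite mulr_ge0 ?sqr_ge0// mulr_ge0.
- by move=> x; exact: powR_ge0.
have mind : measurable_fun [set: T1 * mR] (fun p => (L h p.1 ^+ 2 * \1_(subgraph F1) p)%:E).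
  apply/measurable_EFinP; apply: measurable_funM.
    by apply: measurable_funX; exact: (measurableT_comp mLh measurable_fst).
  by apply: measurable_indic; exact: measurable_subgraph.
have mind2 : measurable_fun [set: T2 * mR] (fun p => (4 * D * h p.1 ^+ 2 * \1_(subgraph F2) p)%:E).
  apply/measurable_EFinP; apply: measurable_funM.
    apply: measurable_funM => //.
    by apply: measurable_funX; exact: (measurableT_comp mh measurable_fst).
  by apply: measurable_indic; exact: measurable_subgraph.
apply: (ge0_le_integral _ measurableT).
- by move=> t _; apply: integral_ge0 => x _; rewrite lee_fin mulr_ge0 ?sqr_ge0.
- apply: (@measurable_fun_fubini_tonelli_G _ _ _ _ _ m1 _ mind) => p.
  by rewrite lee_fin mulr_ge0 ?sqr_ge0.
- apply: (@measurable_fun_fubini_tonelli_G _ _ _ _ _ m2 _ mind2) => p.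
  by rewrite lee_fin mulr_ge0 ?sqr_ge0// mulr_ge0 ?sqr_ge0// mulr_ge0.
move=> t _.
pose S := [set y | subgraph F2 (y, t)].
have mS : measurable S.
  have := measurable_subgraph mF2 => /(measurable_ysection t).
  by rewrite /ysection => mm; rewrite (_ : S = [set x | (x, t) \in subgraph F2])//; apply/seteqP; split => x; rewrite /= inE.
(* On S one has |h|^(q-1) < 2N/la. *)
pose h2 y := h y * \1_S y.
have h2i : m2.-integrable setT (fun y => (h2 y)%:E).
  apply: (integrable_EFin_le (g := fun y => `|h y|)); last exact: integrable_EFin_norm.
  - by apply: measurable_funM => //; exact: measurable_indic.
  - by move=> y; rewrite /h2 indicE normrM ler_piMr// normr_nat lern1 leq_b1.
pose h1 y := h y - h2 y.
have h1i : m2.-integrable setT (fun y => (h1 y)%:E) by exact: integrable_EFinB.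
have LE x : L h x = L h1 x + L h2 x.
  rewrite /L -Rintegral_add; [|exact: iL|exact: iL].
  by apply: eq_Rintegral => y _; rewrite /h1; ring.
have key x : subgraph F1 (x, t) -> `|L h x| <= 2 * `|L h2 x|.
  rewrite /subgraph /= => /andP[t0 tF].
  pose la := t `^ s^-1.
  have laL : la < `|L h x|.
    rewrite -[ltRHS](powRr1 (normr_ge0 _)) -(mulfV (lt0r_neq0 s0)) powRrM.
    by apply: gt0_ltr_powR; rewrite ?invr_gt0// nnegrE ?powR_ge0.
  have la0 : 0 <= la by exact: powR_ge0.
  have laE : t = la `^ s by rewrite /la -powRrM mulVf ?gt_eqF// powRr1.
  have pt y : `|h1 y| <= la / (2 * N) * `|h y| `^ q.
    rewrite /h1 /h2 indicE; case: (boolP (_ \in _)) => [_|].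
      by rewrite mulr1 subrr normr0 mulr_ge0 ?powR_ge0// divr_ge0// mulr_ge0// ltW.
    rewrite notin_setE /S /subgraph /= t0 /= => /negP; rewrite -leNgt /F2 laE => ht.
    rewrite mulr0 subr0.
    have [h0|hn0] := eqVneq (h y) 0.
      by rewrite h0 normr0 mulr_ge0 ?powR_ge0// divr_ge0// mulr_ge0// ltW.
    have hp : 0 < `|h y| by rewrite normr_gt0.
    have : 2 * N * `|h y| `^ (1 - q) <= la.
      by rewrite -(powR_le2 s0)// ?mulr_ge0 ?powR_ge0// ltW.
    rewrite -ler_pdivlMl// ; last by rewrite mulr_gt0.
    move=> hh.
    rewrite [leLHS](_ : _ = `|h y| `^ (1 - q) * `|h y| `^ q); last first.
      by rewrite -powRD ?subrK ?powRr1// (gt_eqF hp) implybT.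
    by rewrite ler_wpM2r ?powR_ge0// mulrC.
  have h1la : \int[m2]_y `|h1 y| <= la / 2.
    have iq : m2.-integrable setT (fun y => (`|h y| `^ q)%:E).
      apply/integrableP; split.
        by apply/measurable_EFinP; exact: (measurableT_comp (measurable_powR q) mnh).
      under eq_integral do rewrite gee0_abs ?lee_fin ?powR_ge0//.
      exact: le_lt_trans hN (ltry _).
    apply: (@le_trans _ _ (\int[m2]_y (la / (2 * N) * `|h y| `^ q))).
      by apply: ler_Rintegral => //; [exact: integrable_EFin_norm|exact: integrable_EFinZ].
    rewrite Rintegral_scale// -[leRHS](_ : la / (2 * N) * N = _); last by field; rewrite gt_eqF.
    rewrite ler_wpM2l ?divr_ge0 ?mulr_ge0 ?(ltW N0)//.
    by rewrite -lee_fin EFin_Rintegral.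
  have : `|L h1 x| <= `|L h x| / 2.
    apply: (le_trans (L_le x h1i)); apply: (le_trans h1la).
    by rewrite ler_pM2r// ltW.
  have := ler_normD (L h1 x) (L h2 x); rewrite -LE => hD hh; clear -hD hh; lra.
apply: (@le_trans _ _ (\int[m1]_x (4 * (L h2 x ^+ 2))%:E)%E).
  apply: ge0_le_integral => //.
  - by move=> x _; rewrite lee_fin mulr_ge0 ?sqr_ge0.
  - exact: (measurableT_comp mind (measurable_pair2 t)).
  - apply/measurable_EFinP; apply: measurable_funM => //; apply: measurable_funX.
    exact: mL.
  - move=> x _; rewrite lee_fin indicE; case: (boolP (_ \in _)) => [|_].
      rewrite inE => /key; rewrite mulr1 -(real_normK (num_real (L h x))) -(real_normK (num_real (L h2 x))).
      by have := normr_ge0 (L h x); have := normr_ge0 (L h2 x); nra.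
    by rewrite mulr0 mulr_ge0 ?sqr_ge0.
under eq_integral do rewrite EFinM.
rewrite ge0_integralZl//; last 2 first.
- by apply/measurable_EFinP; apply: measurable_funX; exact: mL.
- by move=> x _; rewrite lee_fin sqr_ge0.
apply: (@le_trans _ _ (4%:E * (D%:E * \int[m2]_y (h2 y ^+ 2)%:E))%E).
  by apply: lee_wpmul2l => //; exact: L2.
rewrite muleA -EFinM -(ge0_integralZl _ measurableT); last 3 first.
- apply/measurable_EFinP; apply: measurable_funX; exact: integrable_EFin_measurable h2i.
- by move=> x _; rewrite lee_fin sqr_ge0.
- by rewrite lee_fin mulr_ge0.
rewrite le_eqVlt; apply/orP; left; apply/eqP; apply: eq_integral => y _.
rewrite -EFinM -(mulrA (4 * D)) /h2 exprMn; congr (_ * (_ * _))%:E.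
have [Hy|Hy] := pselect (subgraph F2 (y, t)).
  by rewrite !indicE (mem_set (Hy : S y)) (mem_set Hy) expr1n.
by rewrite !indicE (memNset (Hy : ~ S y)) (memNset Hy) expr0n.
Qed.

End marcinkiewicz.

(** * Norms and interpolation *)

Section recip.
Context {R : realType}.
Implicit Types (p : \bar R).

Lemma recip_EFin (r : R) : 0 < r -> recip r%:E = r^-1.
Proof. by move=> r0; rewrite /recip inver gt_eqF. Qed.

Lemma recipy : recip (+oo%E : \bar R) = 0.
Proof. by rewrite /recip invey. Qed.

Lemma lt0e_cases p : (0 < p)%E -> (exists2 r, 0 < r & p = r%:E) \/ p = +oo%E.
Proof.
case: p => [r| |]; [|by right|by rewrite ltNge leNye].
by rewrite lte_fin => r0; left; exists r.
Qed.

Lemma recip_ge0 p : (0 < p)%E -> 0 <= recip p.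
Proof.
move=> /lt0e_cases[[r r0 ->]|->]; last by rewrite recipy.
by rewrite recip_EFin// invr_ge0 ltW.
Qed.

Lemma recip_lt (r : R) p : 0 < r -> (r%:E < p)%E -> r * recip p < 1.
Proof.
move=> r0 rp; have : (0 < p)%E by apply: lt_trans rp; rewrite lte_fin.
move=> /lt0e_cases[[s s0 pE]|->]; last by rewrite recipy mulr0.
by move: rp; rewrite pE lte_fin => rs; rewrite recip_EFin// ltr_pdivrMr// mul1r.
Qed.

Lemma recip_inj p1 p2 : (0 < p1)%E -> (0 < p2)%E -> recip p1 = recip p2 -> p1 = p2.
Proof.
move=> /lt0e_cases[[r r0 ->]|->] /lt0e_cases[[s s0 ->]|->] //.
- by rewrite !recip_EFin// => /invr_inj ->.
- by rewrite recipy recip_EFin// => /eqP; rewrite invr_eq0 gt_eqF.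
- by rewrite recipy recip_EFin// => /esym/eqP; rewrite invr_eq0 gt_eqF.
Qed.

End recip.

Section norms.
Context d (T : measurableType d) (R : realType) (mu : {measure set T -> \bar R}).
Hypothesis muT : (0 < mu setT)%E.
Implicit Types (g : T -> R) (p : \bar R).

(** The norm as a real number, so that its logarithm can be taken. *)
Definition fLnorm p g : R := fine (Lnorm mu p (fun t => (g t)%:E)).

(** Membership in every L^p space, p > 0 (bounded means p = +oo), with the positivity that
the moduli considered here have. *)
Definition in_all_Lp g := [/\ measurable_fun setT g, forall t, 0 <= g t,
  exists B, forall t, g t <= B &
  forall q, 0 < q -> (\int[mu]_t (g t `^ q)%:E < +oo)%E].

Lemma fLnorm_ge0 p g : 0 <= fLnorm p g.
Proof. by rewrite fine_ge0// Lnorm_ge0. Qed.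

Lemma Lnorm_finE (r : R) g : (forall t, 0 <= g t) -> 0 < r ->
  Lnorm mu r%:E (fun t => (g t)%:E) = ((\int[mu]_t (g t `^ r)%:E) `^ r^-1)%E.
Proof.
move=> g0 r0; rewrite unlock /Lnorm.
have -> : (\int[mu]_x `|(g x)%:E| `^ r)%E = (\int[mu]_t (g t `^ r)%:E)%E; last reflexivity.
by apply: eq_integral => t _; rewrite gee0_abs ?lee_fin// poweR_EFin.
Qed.

Lemma all_Lp_Lnorm p g : in_all_Lp g -> (0 < p)%E -> Lnorm mu p (fun t => (g t)%:E) = (fLnorm p g)%:E.
Proof.
move=> [mg g0 [B gB] gi] p0; rewrite /fLnorm fineK// ge0_fin_numE ?Lnorm_ge0//.
move: p0 => /lt0e_cases[[r r0 ->]|->].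
  rewrite Lnorm_finE//.
  by apply: poweR_lty; exact: gi.
rewrite unlock /Lnorm muT.
apply: (@le_lt_trans _ _ B%:E); last exact: ltry.
apply/ess_supP; apply: nearW => t /=.
by rewrite ger0_norm// lee_fin.
Qed.

Lemma all_Lp_integral (r : R) g : in_all_Lp g -> 0 < r ->
  (\int[mu]_t (g t `^ r)%:E = (fLnorm r%:E g `^ r)%:E)%E.
Proof.
move=> gg r0; have [mg g0 _ gi] := gg.
rewrite -poweR_EFin -(all_Lp_Lnorm gg (r0 : (0 < r%:E)%E)) (poweR_Lnorm mu _ (lt0r_neq0 r0)).
by apply: eq_integral => t _; rewrite gee0_abs ?lee_fin// poweR_EFin.
Qed.

Lemma all_Lp_ae_le g : in_all_Lp g -> \forall t \ae mu, g t <= fLnorm +oo%E g.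
Proof.
move=> gg; have [mg g0 _ gi] := gg.
have := all_Lp_Lnorm gg (ltry 0).
rewrite unlock /Lnorm muT => E.
have := @ess_sup_ge _ _ _ mu (abse \o (fun t => (g t)%:E)); rewrite E.
by apply: filterS => t /=; rewrite ger0_norm// lee_fin.
Qed.

Lemma all_Lp_fLnorm_gt0 p g : in_all_Lp g -> ~ ((fun t => (g t)%:E) = \0 %[ae mu]) ->
  (0 < p)%E -> 0 < fLnorm p g.
Proof.
move=> gg ng p0; rewrite lt_neqAle fLnorm_ge0 andbT eq_sym; apply/eqP => N0; apply: ng.
have [mg _ _ _] := gg.
apply: (@Lnorm_eq0_eq0 _ _ _ mu _ p) => //; first exact/measurable_EFinP.
by rewrite all_Lp_Lnorm// N0.
Qed.

(** Hoelder's inequality for the exponents p/q and its conjugate; for infinite p it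
degenerates to pulling out the essential supremum. *)
Lemma hoelder_weight p (q : R) g (w : T -> R) (V : R) : in_all_Lp g -> (0 < p)%E -> 0 < q ->
  q * recip p < 1 -> measurable_fun setT w -> (forall t, 0 <= w t) -> 0 <= V ->
  (\int[mu]_t (w t `^ (1 - q * recip p)^-1)%:E <= V%:E)%E ->
  (\int[mu]_t (g t `^ q * w t)%:E <= (fLnorm p g `^ q * V `^ (1 - q * recip p))%:E)%E.
Proof.
move=> gg p0 q0 qp mw w0 V0 wV; have [mg g0 _ gi] := gg.
have mgq : measurable_fun setT (fun t => g t `^ q) by exact: (measurableT_comp (measurable_powR q)).
move: p0 qp wV => /lt0e_cases[[r r0 ->]|->].
  rewrite recip_EFin// => qr wV.
  pose s := (1 - q / r).
  have s0 : 0 < s by rewrite subr_gt0.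
  have sV : 0 < s^-1 by rewrite invr_gt0.
  have rq : 0 < r / q by rewrite divr_gt0.
  have := hoelder mu mgq mw rq sV.
  rewrite Lnorm1 invf_div invrK /s [q / r + _]addrC subrK => /(_ erefl).
  rewrite !Lnorm_finE//; last by move=> t; exact: powR_ge0.
  under eq_integral do rewrite gee0_abs ?lee_fin ?mulr_ge0 ?powR_ge0//.
  move=> /le_trans; apply.
  under eq_integral do rewrite -powRrM mulrC divfK ?gt_eqF//.
  rewrite (all_Lp_integral gg r0) poweR_EFin -powRrM invf_div (mulrC r) divfK ?(gt_eqF r0)//.
  rewrite EFinM; apply: lee_wpmul2l; first by rewrite lee_fin powR_ge0.
  rewrite invrK -poweR_EFin; apply: gt0_ler_poweR => //.
  - exact: ltW.
  - by rewrite in_itv/= leey andbT integral_ge0// => t _; rewrite lee_fin powR_ge0.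
  - by rewrite in_itv/= leey andbT lee_fin.
rewrite recipy mulr0 subr0 invr1 => _ wV.
rewrite powRr1//; have NN := fLnorm_ge0 +oo%E g.
apply: (@le_trans _ _ (\int[mu]_t ((fLnorm +oo%E g `^ q)%:E * (w t)%:E))%E).
  apply: ae_ge0_le_integral => //.
  - by move=> t _; rewrite lee_fin mulr_ge0 ?powR_ge0.
  - by apply/measurable_EFinP; apply: measurable_funM.
  - by move=> t _; rewrite -EFinM lee_fin mulr_ge0 ?powR_ge0.
  - by under eq_fun do rewrite -EFinM; apply/measurable_EFinP; apply: measurable_funM.
  apply: filterS (all_Lp_ae_le gg) => t gt _.
  rewrite -EFinM lee_fin ler_wpM2r//; apply: ge0_ler_powR; rewrite ?nnegrE ?(ltW q0)//.
rewrite (ge0_integralZl _ measurableT); last 3 first.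
- exact/measurable_EFinP.
- by move=> t _; rewrite lee_fin.
- by rewrite lee_fin powR_ge0.
rewrite EFinM; apply: lee_wpmul2l; first by rewrite lee_fin powR_ge0.
apply: le_trans wV; apply: ge0_le_integral => //.
- by move=> t _; rewrite lee_fin.
- exact/measurable_EFinP.
- by apply/measurable_EFinP; apply: (measurableT_comp (measurable_powR 1)).
- by move=> t _; rewrite powRr1.
Qed.

(** The logarithm of the L^q norm is a convex function of 1/q: apply Hoelder's inequality to
g^q = g^(th q) g^((1-th) q). *)
Lemma ln_interpolation (q0 q : R) s g : in_all_Lp g -> ~ ((fun t => (g t)%:E) = \0 %[ae mu]) ->
  0 < q0 < q -> (0 < s)%E -> recip s < q^-1 ->
  (q0^-1 - recip s) * ln (fLnorm q%:E g) <=
  (q^-1 - recip s) * ln (fLnorm q0%:E g) + (q0^-1 - q^-1) * ln (fLnorm s g).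
Proof.
move=> gg ng /andP[q00 q0q] s0 sq; have [mg g0 _ gi] := gg.
have q_0 := lt_trans q00 q0q.
have u0 : q^-1 < q0^-1 by rewrite ltf_pV2.
set us := recip s in sq *.
have us0 : 0 <= us by exact: recip_ge0.
pose th := (q0^-1 - q^-1) / (q0^-1 - us).
have D0 : 0 < q0^-1 - us by rewrite subr_gt0 (lt_trans sq).
have th0 : 0 < th by apply: divr_gt0 => //; rewrite subr_gt0.
have th1 : th < 1 by rewrite ltr_pdivrMr// mul1r ltrD2l ltrN2.
have thE : q^-1 = (1 - th) * q0^-1 + th * us by rewrite /th; move: (lt0r_neq0 D0); move: (q0^-1) (q^-1) => x y xu; field.
have qth0 : 0 < th * q by rewrite mulr_gt0.
have qus : q * us < 1 by rewrite -ltr_pdivlMl// mulr1.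
have hu : th * q * us < 1.
  by rewrite -mulrA; apply: le_lt_trans qus; rewrite ler_piMl ?mulr_ge0 ?(ltW q_0)// ltW.
have E1 : 1 - th * q * us = q * (1 - th) / q0.
  have : q * q^-1 = 1 by rewrite mulfV// gt_eqF.
  by rewrite thE; move: (q0^-1) => v; lra.
pose w t := g t `^ (q * (1 - th)).
have e0 : 0 < q * (1 - th) / q0 by rewrite divr_gt0// mulr_gt0// subr_gt0.
have mw : measurable_fun setT w by exact: (measurableT_comp (measurable_powR _) mg).
have hV : (\int[mu]_t (w t `^ (1 - th * q * recip s)^-1)%:E <= (fLnorm q0%:E g `^ q0)%:E)%E.
  rewrite -/us E1 -(all_Lp_integral gg q00) le_eqVlt; apply/orP; left; apply/eqP.
  apply: eq_integral => t _.
  rewrite /w -powRrM invf_div mulrA (mulrC _ q0) mulfK//.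
  by rewrite gt_eqF// mulr_gt0// subr_gt0.
have := hoelder_weight gg s0 qth0 hu mw (fun t => powR_ge0 _ _) (powR_ge0 _ q0) hV.
rewrite -/us E1.
have -> : (\int[mu]_t (g t `^ (th * q) * w t)%:E = (fLnorm q%:E g `^ q)%:E)%E.
  rewrite -all_Lp_integral//; apply: eq_integral => t _; congr EFin.
  rewrite /w -powRD; first by congr (_ `^ _); ring.
  rewrite (_ : th * q + q * (1 - th) = q); last by ring.
  by rewrite (gt_eqF q_0).
have P0 := all_Lp_fLnorm_gt0 gg ng.
have N0 : 0 < fLnorm q%:E g by exact: P0.
have N1 : 0 < fLnorm q0%:E g by exact: P0.
have N2 : 0 < fLnorm s g by exact: P0.
rewrite lee_fin => H.
have h : q * ln (fLnorm q%:E g) <= th * q * ln (fLnorm s g) + q * (1 - th) * ln (fLnorm q0%:E g).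
  have : ln (fLnorm q%:E g `^ q) <=
     ln (fLnorm s g `^ (th * q) * (fLnorm q0%:E g `^ q0) `^ (q * (1 - th) / q0)).
    by rewrite ler_ln ?posrE ?mulr_gt0 ?powR_gt0.
  rewrite lnM ?posrE ?powR_gt0// !ln_powR.
  by rewrite (mulrA _ q0) divfK ?gt_eqF.
have h2 : ln (fLnorm q%:E g) <= th * ln (fLnorm s g) + (1 - th) * ln (fLnorm q0%:E g).
  by rewrite -(ler_pM2l q_0) (_ : q * (_ + _) = th * q * ln (fLnorm s g) + q * (1 - th) * ln (fLnorm q0%:E g)) //; ring.
apply: (le_trans (ler_wpM2l (ltW D0) h2)).
rewrite le_eqVlt; apply/orP; left; apply/eqP.
by rewrite /th; move: (lt0r_neq0 D0); move: (q0^-1) (q^-1) => x y xu; field.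
Qed.

End norms.

(** * Localization *)

Section power_weight.
Context {R : realType}.
Local Notation leb := (@lebesgue_measure R).

Lemma is_derive_powR_shift (r a x : R) : 0 < r + x ->
  is_derive x 1 (fun y => (r + y) `^ a) (a * (r + x) `^ (a - 1)).
Proof.
move=> rx.
have d1 : is_derive x 1 (fun y : R => r + y) 1.
  by rewrite -[X in is_derive _ _ _ X]add0r; exact: (@is_deriveD _ _ _ (cst r) id).
have := @is_derive1_comp _ (fun y => y `^ a) _ x _ _ (is_derive1_powR a rx) d1.
by rewrite mulr1.
Qed.

Lemma continuous_powR_norm (r a : R) : 0 < r -> continuous (fun x : R => (r + `|x|) `^ a).
Proof.
move=> r0 x; apply: (@continuous_comp R^o R^o R^o (fun x : R => `|x| : R) (fun y : R => (r + y) `^ a)).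
  exact: norm_continuous.
have rx : 0 < r + `|x| by rewrite ltr_pwDl.
have d := @is_derive_powR_shift r a `|x| rx.
by apply: differentiable_continuous; apply/derivable1_diffP.
Qed.

Lemma cvgy_powRN (r a : R) : 0 < r -> 0 < a -> (r + x) `^ (- a) @[x --> +oo%R] --> (0 : R).
Proof.
move=> r0 a0.
under eq_fun do rewrite powRN.
apply/gtr0_cvgV0.
  near=> x; have x0 : 0 <= x by near: x; apply: nbhs_pinfty_ge; exact: num_real.
  by rewrite /= powR_gt0// ltr_pwDl.
apply/cvgryPge => A; near=> x.
have x1 : `|A| `^ a^-1 <= x by near: x; apply: nbhs_pinfty_ge; exact: num_real.
rewrite (le_trans (ler_norm A))//.
rewrite -[leLHS](powRr1 (normr_ge0 A)) -(mulVf (lt0r_neq0 a0)) powRrM.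
apply: ge0_ler_powR; rewrite ?nnegrE ?powR_ge0 ?(ltW a0)//.
  by rewrite addr_ge0 ?(ltW r0)// (le_trans (powR_ge0 _ _) x1).
by rewrite (le_trans x1)// lerDr ltW.
Unshelve. all: end_near. Qed.

Lemma integral_power_weight0 (r m : R) : 0 < r -> 1 < m ->
  (\int[leb]_x ((r + `|x|) `^ (- m))%:E = (2 * (r `^ (1 - m) / (m - 1)))%:E)%E.
Proof.
move=> r0 m1; have m10 : 0 < m - 1 by rewrite subr_gt0.
have half : (\int[leb]_(x in `[0%R, +oo[) ((r + `|x|) `^ (- m))%:E =
    (r `^ (1 - m) / (m - 1))%:E)%E.
  transitivity ((0%:E - (((r + 0) `^ (1 - m)) / (1 - m))%:E)%E).
    apply: (@ge0_continuous_FTC2y _ _ (fun x => (r + x) `^ (1 - m) / (1 - m))).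
    - by move=> x _; exact: powR_ge0.
    - by apply: continuous_subspaceT; exact: continuous_powR_norm.
    - rewrite -[X in _ --> X](mul0r (1 - m)^-1); apply: cvgMl.
      by rewrite -opprB; exact: cvgy_powRN.
    - move=> x x0; have rx : 0 < r + x by rewrite addr_gt0.
      have := is_derive_powR_shift (1 - m) rx => d.
      by apply: derivableM.
    - have rx : 0 < r + 0 by rewrite addr0.
      have := is_derive_powR_shift (1 - m) rx => d.
      apply: cvg_at_right_filter; apply: cvgMl.
      have cc : {for 0, continuous (fun y => (r + y) `^ (1 - m))}.
        by apply: differentiable_continuous; apply/derivable1_diffP.
      exact: cc.
    - move=> x; rewrite in_itv /= andbT => x0.
      have rx : 0 < r + x by rewrite addr_gt0.
      have := is_derive_powR_shift (1 - m) rx => d.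
      rewrite derive1E.
      have d2 : is_derive x 1 (fun y : R => (r + y) `^ (1 - m) / (1 - m))
         ((1 - m)^-1 * ((1 - m) * (r + x) `^ (1 - m - 1))).
        by apply: is_derive_eq; rewrite /GRing.scale /= mulr0 add0r.
      rewrite derive_val.
      rewrite mulrA mulVf; last by rewrite -opprB oppr_eq0 gt_eqF.
      rewrite mul1r (gtr0_norm x0); congr (_ `^ _); ring.
  rewrite addr0 sub0e -EFinN; congr EFin.
  by rewrite -[(1 - m)^-1]opprK -invrN opprB mulrN opprK.
rewrite ge0_integral_split; last 2 first.
- exact: continuous_powR_norm.
- by move=> x; exact: powR_ge0.
under eq_integral do rewrite normrN.
by rewrite half -EFinD; congr EFin; ring.
Qed.

Lemma integral_power_weight (r m c : R) : 0 < r -> 1 < m ->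
  (\int[leb]_x ((r + `|x - c|) `^ (- m))%:E = (2 * (r `^ (1 - m) / (m - 1)))%:E)%E.
Proof.
move=> r0 m1; rewrite -(integral_power_weight0 r0 m1).
have dF : derive1 (fun x : R => x - c) = cst 1.
  by apply/funext => x; rewrite derive1E deriveB// derive_id derive_cst subr0.
rewrite [RHS](@increasing_ge0_integration_by_substitutionT _ (fun x => x - c)
  (fun x => (r + `|x|) `^ (- m))).
- by apply: eq_integral => x _; rewrite dF; congr EFin; rewrite -[LHS]mulr1.
- by move=> x y; rewrite ltrD2r.
- by rewrite dF => x; exact: cvg_cst.
- by rewrite dF; exact: is_cvg_cst.
- by rewrite dF; exact: is_cvg_cst.
- by move=> x; exact: derivableB.
- apply/cvgrNyPle => A; near=> x; rewrite lerBlDr.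
  by near: x; apply: nbhs_ninfty_le; exact: num_real.
- apply/cvgryPge => A; near=> x; rewrite lerBrDr.
  by near: x; apply: nbhs_pinfty_ge; exact: num_real.
- exact: continuous_powR_norm.
- by move=> x; exact: powR_ge0.
Unshelve. all: end_near. Qed.

End power_weight.

Section localization.
Context {R : realType} (n : nat).
Local Notation mR := (measurableTypeR R).
Local Notation leb := (@lebesgue_measure R).
Local Notation mu := (@lebesgue_tuple R n).

Lemma lebesgue_tuple_setT_gt0 : (0 < mu setT)%E.
Proof.
have := @lebesgue_tuple_box R n (fun=> setT) (fun=> measurableT).
rewrite (_ : [set t | forall i, setT (tnth t i)] = setT); last by apply/seteqP; split.
move=> ->; apply: (big_ind (fun x => (0 < x)%E)) => //.
- by move=> x y; exact: mule_gt0.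
- move=> i _; apply: (@lt_le_trans _ _ (leb `[0%R, 1%R]%classic)).
    by rewrite lebesgue_measure_itv /= lte_fin ltr01 oppr0 adde0 lte_fin.
  by apply: le_measure; rewrite ?inE.
Qed.

Definition dist_to (x0 : 'rV[R]_n) (t : n.-tuple mR) : R := euclidean_norm (row_of t - x0).

Lemma dist_to_ge0 x0 t : 0 <= dist_to x0 t.
Proof. exact: sqrtr_ge0. Qed.

Lemma dist_to_coord (x0 : 'rV[R]_n) (t : n.-tuple mR) i : `|tnth t i - x0 ord0 i| <= dist_to x0 t.
Proof.
rewrite /dist_to /euclidean_norm -sqrtr_sqr; apply: ler_wsqrtr.
rewrite (bigD1 i)//= !mxE lerDl; apply: sumr_ge0 => j _; exact: sqr_ge0.
Qed.

Lemma measurable_sqrt : measurable_fun setT (@Num.sqrt R).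
Proof. by apply: measurable_of_continuous; exact: sqrt_continuous. Qed.

Lemma measurable_dist_to x0 : measurable_fun [set: n.-tuple mR] (dist_to x0).
Proof.
apply: (measurableT_comp measurable_sqrt); apply: measurable_sum => i.
apply: measurable_funX; under eq_fun do rewrite !mxE.
by apply: measurable_funB => //; exact: measurable_tnth.
Qed.

(** A substitute for the powers of the Euclidean distance whose integral is a product of
one-dimensional integrals. *)
Definition power_weight r m (x0 : 'rV[R]_n) (t : n.-tuple mR) : R :=
  \prod_(i < n) (r + `|tnth t i - x0 ord0 i|) `^ (- m).

Lemma integral_power_weight_tuple (r m : R) x0 : 0 < r -> 1 < m ->
  (\int[mu]_t (power_weight r m x0 t)%:E = ((2 * (r `^ (1 - m) / (m - 1))) ^+ n)%:E)%E.
Proof.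
move=> r0 m1.
rewrite (@integral_tuple_prodE R n (fun i x => (r + `|x - x0 ord0 i|) `^ (- m))).
- transitivity ((\prod_(i < n) (2 * (r `^ (1 - m) / (m - 1))))%:E); last by rewrite prodr_const card_ord.
  rewrite (big_morph EFin (@EFinM R) erefl).
  by apply: eq_bigr => i _; exact: integral_power_weight.
- move=> i; apply: (measurableT_comp (measurable_of_continuous (continuous_powR_norm (a := - m) r0))).
  exact: measurable_funB.
- by move=> i x; exact: powR_ge0.
Qed.

Lemma measurable_power_weight (r m : R) x0 : 0 < r ->
  measurable_fun [set: n.-tuple mR] (power_weight r m x0).
Proof.
move=> r0; apply: (@measurable_prod_tnth R n (fun i x => (r + `|x - x0 ord0 i|) `^ (- m))) => i.
apply: (measurableT_comp (measurable_of_continuous (continuous_powR_norm (a := - m) r0))).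
exact: measurable_funB.
Qed.

Lemma prodr_const_ord (c : R) : \prod_(i < n) c = c ^+ n.
Proof. by rewrite prodr_const card_ord. Qed.

(** Inside the ball each coordinate distance is at most [r], so no factor is smaller than
[(2 * r) `^ (- m)]. *)
Lemma near_weight_le (r m : R) (x0 : 'rV[R]_n) (t : n.-tuple mR) : 0 < r -> 0 < m -> dist_to x0 t <= r ->
  1 <= ((2 * r) `^ m) ^+ n * power_weight r m x0 t.
Proof.
move=> r0 m0 dr; rewrite -prodr_const_ord -big_split /=.
rewrite [leLHS](_ : 1 = \prod_(i < n) (1 : R)); last by rewrite big1.
apply: ler_prod => i _; rewrite ler01 /=.
have rt : 0 < r + `|tnth t i - x0 ord0 i| by rewrite ltr_pwDl.
rewrite powRN -ler_pdivrMr ?invr_gt0 ?powR_gt0// invrK mul1r.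
apply: ge0_ler_powR; rewrite ?nnegrE ?(ltW m0) ?(ltW rt) ?mulr_ge0 ?(ltW r0)//.
by rewrite mulr_natl mulr2n lerD2l (le_trans (dist_to_coord _ _ _)).
Qed.

(** Outside the ball each factor [r + |t_i - x_i|] is at most twice the distance. *)
Lemma far_weight_le (r m : R) (x0 : 'rV[R]_n) (t : n.-tuple mR) : 0 < r -> 0 < m -> r < dist_to x0 t ->
  dist_to x0 t `^ (- (m * n%:R)) <= (2 `^ m) ^+ n * power_weight r m x0 t.
Proof.
move=> r0 m0 dr; rewrite -prodr_const_ord -big_split /=.
have d0 : 0 < dist_to x0 t by exact: lt_trans dr.
rewrite -mulNr powRrM powR_mulrn ?powR_ge0// -prodr_const_ord.
apply: ler_prod => i _; rewrite powR_ge0 /=.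
have rt : 0 < r + `|tnth t i - x0 ord0 i| by rewrite ltr_pwDl.
rewrite !powRN -ler_pdivrMr ?invr_gt0 ?powR_gt0// invrK mulrC -ler_pdivlMr ?invr_gt0 ?powR_gt0//.
rewrite invrK -powRM ?(ltW d0)//.
apply: ge0_ler_powR; rewrite ?nnegrE ?(ltW m0) ?(ltW rt) ?mulr_ge0 ?(ltW d0)//.
by rewrite mulr_natl mulr2n lerD ?(ltW dr)// dist_to_coord.
Qed.

(** On the ball of radius [r] Hoelder's inequality is applied with the L^k norm, outside it with
the weighted L^a norm.  The complementary power of the weight is integrable at
infinity exactly when q exceeds the critical exponent. *)
Lemma localization (q b : R) (a k : \bar R) : (0 < n)%N -> 0 < q -> 0 < b ->
  (0 < a)%E -> (0 < k)%E -> q * recip a < 1 -> q * recip k < 1 ->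
  q^-1 < recip a + b / n%:R ->
  exists2 C : R, 0 < C & forall (g : n.-tuple mR -> R) x0, in_all_Lp mu g ->
    in_all_Lp mu (fun t => dist_to x0 t `^ b * g t) -> forall r : R, 0 < r ->
    fLnorm mu q%:E g `^ q <=
      C * (r `^ (n%:R * (1 - q * recip k)) * fLnorm mu k g `^ q +
           r `^ (n%:R * (1 - q * recip a) - b * q) *
             fLnorm mu a (fun t => dist_to x0 t `^ b * g t) `^ q).
Proof.
move=> n0 q0 b0 a0 k0 qa qk crit.
have nR0 : 0 < n%:R :> R by rewrite ltr0n.
pose sa := 1 - q * recip a; pose sk := 1 - q * recip k.
have sa0 : 0 < sa by rewrite subr_gt0.
have sk0 : 0 < sk by rewrite subr_gt0.
(* The exponent for which the product weight decays like the weight left over by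
   Hoelder's inequality; it exceeds 1 since q exceeds the critical exponent. *)
pose m := b * q / (sa * n%:R).
have m1 : 1 < m.
  rewrite ltr_pdivlMr ?mulr_gt0// mul1r /sa.
  have : 1 < q * (recip a + b / n%:R) by rewrite -ltr_pdivrMl// mulr1.
  rewrite mulrDr => h; rewrite -ltr_pdivlMr//; lra.
have m0 : 0 < m by exact: lt_trans m1.
have m10 : 0 < m - 1 by rewrite subr_gt0.
pose cm := 2 `^ m * 2 / (m - 1).
have cm0 : 0 < cm by rewrite divr_gt0// mulr_gt0// powR_gt0.
exists ((cm ^+ n) `^ sk + (cm ^+ n) `^ sa).
  by rewrite addr_gt0// powR_gt0// exprn_gt0.
move=> g x0 gg ggb r r0.
have [mg g0 _ gi] := gg.
have md := measurable_dist_to x0.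
pose w1 t : R := if dist_to x0 t <= r then 1 else 0.
pose w2 t : R := if dist_to x0 t <= r then 0 else dist_to x0 t `^ (- (b * q)).
have mcond : measurable_fun [set: n.-tuple mR] (fun t => dist_to x0 t <= r).
  by apply: measurable_fun_ler.
have mw1 : measurable_fun [set: n.-tuple mR] w1 by apply: measurable_fun_ifT.
have mw2 : measurable_fun [set: n.-tuple mR] w2.
  by apply: measurable_fun_ifT => //; exact: (measurableT_comp (measurable_powR _) md).
have w10 t : 0 <= w1 t by rewrite /w1; case: ifP.
have w20 t : 0 <= w2 t by rewrite /w2; case: ifP => // _; exact: powR_ge0.
have mpw := measurable_power_weight m x0 r0.
have pw0 t : 0 <= power_weight r m x0 t by apply: prodr_ge0 => i _; exact: powR_ge0.
pose V1 := (cm * r) ^+ n.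
pose V2 := (cm * r `^ (1 - m)) ^+ n.
have int_bound (c : R) : 0 <= c -> (\int[mu]_t (c * power_weight r m x0 t)%:E =
   (c * (2 * (r `^ (1 - m) / (m - 1))) ^+ n)%:E)%E.
  move=> c0; under eq_integral do rewrite EFinM.
  rewrite ge0_integralZl//; last 2 first.
  - exact/measurable_EFinP.
  - by move=> t _; rewrite lee_fin.
  by rewrite integral_power_weight_tuple.
have hV1 : (\int[mu]_t (w1 t `^ (1 - q * recip k)^-1)%:E <= V1%:E)%E.
  have -> : V1 = ((2 * r) `^ m) ^+ n * (2 * (r `^ (1 - m) / (m - 1))) ^+ n.
    rewrite -exprMn /V1 /cm powRM ?(ltW r0)//; congr (_ ^+ _).
    have rr : r `^ m * r `^ (1 - m) = r.
      by rewrite -powRD ?(gt_eqF r0) ?implybT// addrC subrK powRr1// ltW.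
    transitivity (2 `^ m * 2 / (m - 1) * (r `^ m * r `^ (1 - m))); first by rewrite rr.
    ring.
  rewrite -int_bound ?exprn_ge0 ?powR_ge0//.
  apply: ge0_le_integral => //.
  - by move=> t _; rewrite lee_fin powR_ge0.
  - by apply/measurable_EFinP; apply: (measurableT_comp (measurable_powR _) mw1).
  - by apply/measurable_EFinP; apply: measurable_funM.
  move=> t _; rewrite lee_fin /w1; case: ifPn => [dr|_].
    by rewrite powR1 near_weight_le.
  by rewrite powR0 ?mulr_ge0 ?exprn_ge0 ?powR_ge0// invr_neq0// gt_eqF.
have hV2 : (\int[mu]_t (w2 t `^ (1 - q * recip a)^-1)%:E <= V2%:E)%E.
  have -> : V2 = (2 `^ m) ^+ n * (2 * (r `^ (1 - m) / (m - 1))) ^+ n.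
    by rewrite -exprMn /V2 /cm; congr (_ ^+ _); ring.
  rewrite -int_bound ?exprn_ge0 ?powR_ge0//.
  apply: ge0_le_integral => //.
  - by move=> t _; rewrite lee_fin powR_ge0.
  - by apply/measurable_EFinP; apply: (measurableT_comp (measurable_powR _) mw2).
  - by apply/measurable_EFinP; apply: measurable_funM.
  move=> t _; rewrite lee_fin /w2; case: ifPn => [dr|].
    by rewrite powR0 ?mulr_ge0 ?exprn_ge0 ?powR_ge0// invr_neq0// gt_eqF.
  rewrite -ltNge => dr; rewrite -powRrM -/sa.
  have -> : - (b * q) / sa = - (m * n%:R).
    by rewrite /m; field; rewrite !gt_eqF.
  exact: far_weight_le.
have [mgb gb0 _ _] := ggb.
have H1 := hoelder_weight lebesgue_tuple_setT_gt0 gg k0 q0 qk mw1 w10 (exprn_ge0 _ (ltW (mulr_gt0 cm0 r0))) hV1.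
have V20 : 0 <= V2 by rewrite exprn_ge0// mulr_ge0 ?powR_ge0// ltW.
have H2 := hoelder_weight lebesgue_tuple_setT_gt0 ggb a0 q0 qa mw2 w20 V20 hV2.
have split : (\int[mu]_t (g t `^ q)%:E <= \int[mu]_t (g t `^ q * w1 t)%:E +
    \int[mu]_t ((dist_to x0 t `^ b * g t) `^ q * w2 t)%:E)%E.
  rewrite -(ge0_integralD _ measurableT); last 4 first.
  - by move=> t _; rewrite lee_fin mulr_ge0 ?powR_ge0.
  - apply/measurable_EFinP; apply: measurable_funM => //; exact: (measurableT_comp (measurable_powR _) mg).
  - by move=> t _; rewrite lee_fin mulr_ge0 ?powR_ge0.
  - apply/measurable_EFinP; apply: measurable_funM => //; exact: (measurableT_comp (measurable_powR _) mgb).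
  rewrite le_eqVlt; apply/orP; left; apply/eqP; apply: eq_integral => t _.
  rewrite -EFinD; congr EFin; rewrite /w1 /w2; case: ifPn => [_|].
    by rewrite mulr1 mulr0 addr0.
  rewrite -ltNge => dr; have d0 : 0 < dist_to x0 t by exact: lt_trans dr.
  rewrite mulr0 add0r powRM ?powR_ge0// -powRrM mulrAC -powRD.
    by rewrite subrr powRr0 mul1r.
  by rewrite (gt_eqF d0) implybT.
have := le_trans split (leeD H1 H2).
rewrite (all_Lp_integral lebesgue_tuple_setT_gt0 gg q0) -EFinD lee_fin => /le_trans; apply.
have E1 : V1 `^ (1 - q * recip k) = (cm ^+ n) `^ sk * r `^ (n%:R * (1 - q * recip k)).
  rewrite /V1 exprMn powRM ?exprn_ge0 ?(ltW cm0) ?(ltW r0)//; congr (_ * _).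
  by rewrite -powR_mulrn ?(ltW r0)// -powRrM.
have E2 : V2 `^ (1 - q * recip a) = (cm ^+ n) `^ sa * r `^ (n%:R * (1 - q * recip a) - b * q).
  rewrite /V2 exprMn powRM ?exprn_ge0 ?(ltW cm0) ?powR_ge0//; congr (_ * _).
  rewrite -powR_mulrn ?powR_ge0// -!powRrM; congr (_ `^ _).
  by rewrite /m -/sa; field; rewrite !gt_eqF.
rewrite E1 E2.
have := powR_ge0 (fLnorm mu k g) q; have := powR_ge0 r (n%:R * (1 - q * recip k)).
have := powR_ge0 (fLnorm mu a (fun t => dist_to x0 t `^ b * g t)) q.
have := powR_ge0 r (n%:R * (1 - q * recip a) - b * q).
have := powR_ge0 (cm ^+ n) sk; have := powR_ge0 (cm ^+ n) sa.
move: (_ `^ sa) (_ `^ sk) (r `^ _) (_ `^ q) (r `^ _) (_ `^ q) => ca ck r2 Y r1 X ca0 ck0 r20 Y0 r10 X0.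
rewrite -subr_ge0 (_ : _ - _ = ck * (r1 * X) + ca * (r2 * Y)); last by ring.
by rewrite addr_ge0// mulr_ge0// mulr_ge0.
Qed.

End localization.

Section ln_localization.
Context {R : realType} (n : nat).
Local Notation mR := (measurableTypeR R).
Local Notation mu := (@lebesgue_tuple R n).
Local Notation moment b x0 g := (fun t => dist_to x0 t `^ b * g t).

(** The radius is chosen to balance the two terms of the localization bound. *)
Lemma localization_gt0 (q b : R) (a k : \bar R) : (0 < n)%N -> 0 < q -> 0 < b ->
  (0 < a)%E -> (0 < k)%E -> q * recip a < 1 -> q * recip k < 1 ->
  q^-1 < recip a + b / n%:R ->
  exists c : R, forall (g : n.-tuple mR -> R) x0, in_all_Lp mu g ->
    in_all_Lp mu (moment b x0 g) -> ~ ((fun t => (g t)%:E) = \0 %[ae mu]) ->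
    0 < fLnorm mu a (moment b x0 g) /\
    (recip a + b / n%:R - recip k) * ln (fLnorm mu q%:E g) <=
      c + (q^-1 - recip k) * ln (fLnorm mu a (moment b x0 g)) +
      (recip a + b / n%:R - q^-1) * ln (fLnorm mu k g).
Proof.
move=> n0 q0 b0 a0 k0 qa qk crit.
have [C C0 HC] := localization n0 q0 b0 a0 k0 qa qk crit.
set ip := recip a + b / n%:R in crit *; set uk := recip k in qk HC *.
set ua := recip a in qa HC ip crit *.
have nR0 : 0 < n%:R :> R by rewrite ltr0n.
have ukq : uk < q^-1 by rewrite -[ltRHS]mulr1 ltr_pdivlMl.
pose de := ip - uk.
have de0 : 0 < de by rewrite subr_gt0 (lt_trans ukq).
pose al := n%:R * (1 - q * uk).
have al0 : 0 < al by rewrite mulr_gt0// subr_gt0.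
exists (de / q * ln (2 * C)) => g x0 gg ggb ng.
have F0 : 0 < fLnorm mu q%:E g by apply: all_Lp_fLnorm_gt0 gg ng _ => //; exact: lebesgue_tuple_setT_gt0.
have K0 : 0 < fLnorm mu k g by apply: all_Lp_fLnorm_gt0 gg ng _ => //; exact: lebesgue_tuple_setT_gt0.
have {}HC := HC g x0 gg ggb.
set F := fLnorm mu q%:E g in F0 HC *; set K := fLnorm mu k g in K0 HC *.
set A := fLnorm mu a _ in HC *.
have Fq0 : 0 < F `^ q by exact: powR_gt0.
have Kq0 : 0 < K `^ q by exact: powR_gt0.
have A0 : 0 < A.
  rewrite lt_neqAle fLnorm_ge0 andbT; apply/eqP => A0.
  (* With a vanishing moment a small radius makes the bound smaller than F^q. *)
  pose y := F `^ q / (2 * C * K `^ q).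
  have y0 : 0 < y by rewrite divr_gt0// !mulr_gt0.
  have := HC (y `^ al^-1) (powR_gt0 _ y0).
  rewrite -A0 powR0 ?gt_eqF// mulr0 addr0 -powRrM mulVf ?gt_eqF// powRr1 ?(ltW y0)//.
  rewrite (_ : C * (y * K `^ q) = F `^ q / 2); last by rewrite /y; field; rewrite !gt_eqF.
  by rewrite -subr_ge0 (_ : _ - _ = - (F `^ q / 2)) ?oppr_ge0 ?leNgt ?divr_gt0//; field.
split=> //.
(* The logarithm of the balancing radius. *)
pose rho := (ln A - ln K) / (n%:R * de).
have := HC (expR rho) (expR_gt0 _).
have E1 : expR rho `^ (n%:R * (1 - q * uk)) * K `^ q = expR (al * rho + q * ln K).
  by rewrite expRD /powR !gt_eqF ?expR_gt0// expRK.
have E2 : expR rho `^ (n%:R * (1 - q * ua) - b * q) * A `^ q = expR (al * rho + q * ln K).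
  rewrite /powR !gt_eqF ?expR_gt0// expRK -expRD; congr expR.
  have bE : b = n%:R * (de + uk - ua) by rewrite /de /ip; field; rewrite gt_eqF.
  rewrite /al /rho bE; move: (ln A) (ln K) => lA lK; clear -de0 nR0.
  by move: de de0 => e e0; field; rewrite !gt_eqF.
rewrite E1 E2 => H.
have : q * ln F <= ln (2 * C) + (al * rho + q * ln K).
  rewrite -ln_powR -[X in _ + X]expRK -lnM ?posrE ?expR_gt0 ?mulr_gt0//.
  rewrite ler_ln ?posrE ?mulr_gt0 ?expR_gt0//; apply: (le_trans H).
  by rewrite le_eqVlt; apply/orP; left; apply/eqP; ring.
move=> H2.
have -> : ip - uk = de by [].
have H3 : de / q * (q * ln F) <= de / q * (ln (2 * C) + (al * rho + q * ln K)).
  by apply: ler_wpM2l H2; rewrite divr_ge0 ?ltW.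
rewrite (_ : de * ln F = de / q * (q * ln F)); last by field; rewrite gt_eqF.
apply: (le_trans H3); rewrite le_eqVlt; apply/orP; left; apply/eqP.
have -> : ip = de + uk by rewrite /de; ring.
rewrite /al /rho; move: (ln A) (ln K) (ln _) => lA lK lC; clear -de0 nR0 q0.
by move: de de0 => e e0; field; rewrite !gt_eqF.
Qed.

(** The two-term bound requires an exponent below a, k and q1, but above the critical one.
Interpolation between that exponent and s then bounds both the L^k norm, since
1/s <= 1/k, and the L^q1 norm. *)
Lemma ln_localization (q1 b : R) (a k s : \bar R) : (0 < n)%N -> 0 < q1 -> 0 < b ->
  (0 < a)%E -> (0 < k)%E -> (0 < s)%E ->
  recip k < recip a + b / n%:R -> q1^-1 < recip a + b / n%:R ->
  recip s <= recip k -> recip s < q1^-1 ->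
  exists c : R, forall (g : n.-tuple mR -> R) x0, in_all_Lp mu g ->
    in_all_Lp mu (moment b x0 g) -> ~ ((fun t => (g t)%:E) = \0 %[ae mu]) ->
    0 < fLnorm mu a (moment b x0 g) /\
    ln (fLnorm mu q1%:E g) <= c + (q1^-1 - recip s) *
      ((ln (fLnorm mu a (moment b x0 g)) - ln (fLnorm mu k g)) / (recip a + b / n%:R - recip k))
      + ln (fLnorm mu s g).
Proof.
move=> n0 q10 b0 a0 k0 s0 kp q1p sk sq1.
have nR0 : 0 < n%:R :> R by rewrite ltr0n.
set ip := recip a + b / n%:R in kp q1p *.
set us := recip s in sk sq1 *; set uk := recip k in kp sk *.
have ap : recip a < ip by rewrite ltrDl divr_gt0.
have us0 : 0 <= us by exact: recip_ge0.
pose M := Num.max (recip a) (Num.max uk q1^-1).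
have Mp : M < ip by rewrite !gt_max ap kp q1p.
(* The reciprocal of the auxiliary exponent. *)
pose u0 := (M + ip) / 2.
have Mu0 : M < u0 by rewrite /u0; lra.
have u0p : u0 < ip by rewrite /u0; lra.
have [au0 ku0 qu0] : [/\ recip a < u0, uk < u0 & q1^-1 < u0].
  by move: Mu0; rewrite !gt_max => /andP[-> /andP[-> ->]].
have u00 : 0 < u0 by apply: lt_trans qu0; rewrite invr_gt0.
pose q := u0^-1.
have q0 : 0 < q by rewrite invr_gt0.
have qV : q^-1 = u0 by rewrite /q invrK.
have qa : q * recip a < 1 by rewrite /q ltr_pdivrMl// mulr1.
have qk : q * recip k < 1 by rewrite /q ltr_pdivrMl// mulr1.
have crit : q^-1 < recip a + b / n%:R by rewrite qV.
have [c Hc] := localization_gt0 n0 q0 b0 a0 k0 qa qk crit.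
set de := ip - uk.
have de0 : 0 < de by rewrite subr_gt0.
exists ((q1^-1 - us) * (c / de / (u0 - uk))) => g x0 gg ggb ng.
have [A0 H1] := Hc g x0 gg ggb ng; split=> //.
have muT := @lebesgue_tuple_setT_gt0 R n.
rewrite -/ip -/uk -/de qV in H1.
set x := (_ - _) / de.
set f0 := ln (fLnorm mu q%:E g) in H1.
set fk := ln (fLnorm mu k g) in H1 x *; set fs := ln (fLnorm mu s g).
set L := ln (fLnorm mu a _) in H1 x *.
have LE : L = de * x + fk by rewrite /x; field; rewrite gt_eqF.
have H2 : f0 <= c / de + (u0 - uk) * x + fk.
  rewrite -(ler_pM2l de0); apply: (le_trans H1); rewrite LE.
  rewrite le_eqVlt; apply/orP; left; apply/eqP.
  have -> : ip = de + uk by rewrite /de; ring.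
  by field; rewrite gt_eqF.
have u0k : 0 < u0 - uk by rewrite subr_gt0.
have u0s : 0 < u0 - us by rewrite subr_gt0 (le_lt_trans sk).
have H3 : (u0 - uk) * f0 <= (u0 - us) * (c / de) + (u0 - us) * (u0 - uk) * x + (u0 - uk) * fs.
  have [ks|] := eqVneq us uk.
    have -> : fs = fk by rewrite /fs /fk; congr (ln (fLnorm _ _ _)); apply: recip_inj.
    have := ler_wpM2l (ltW u0k) H2; rewrite ks => H2'; clear -H2'; lra.
  move=> sk'; have {sk'}sk : us < uk by rewrite lt_neqAle sk'.
  have uk0 : 0 < uk by exact: le_lt_trans sk.
  have kE : k = (uk^-1)%:E.
    apply: recip_inj => //; first by rewrite lte_fin invr_gt0.
    by rewrite recip_EFin ?invr_gt0// invrK.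
  have := ln_interpolation muT gg ng (q0 := q) (q := uk^-1) (s := s).
  rewrite qV invrK -kE -/us -/f0 -/fk -/fs => /(_ _ s0 sk) h.
  have {}h : (u0 - us) * fk <= (uk - us) * f0 + (u0 - uk) * fs.
    by apply: h; rewrite q0 /q ltf_pV2.
  have H2' := ler_wpM2l (ltW u0s) H2.
  by clear -H2' h; lra.
have := ln_interpolation muT gg ng (q0 := q) (q := q1) (s := s).
rewrite qV -/us -/f0 -/fs => /(_ _ s0 sq1) h.
have {}h : (u0 - us) * ln (fLnorm mu q1%:E g) <= (q1^-1 - us) * f0 + (u0 - q1^-1) * fs.
  by apply: h; rewrite q0 /q -[ltRHS]invrK ltf_pV2 ?posrE ?invr_gt0.
rewrite -(ler_pM2l u0s); apply: (le_trans h).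
have H4 : f0 <= (u0 - us) * (c / de / (u0 - uk)) + (u0 - us) * x + fs.
  rewrite -(ler_pM2l u0k); apply: (le_trans H3).
  rewrite le_eqVlt; apply/orP; left; apply/eqP.
  by move: (c / de) => cc; field; rewrite gt_eqF.
have s1 : 0 <= q1^-1 - us by rewrite subr_ge0 ltW.
have := ler_wpM2l s1 H4.
move: (c / de / (u0 - uk)) (q1^-1) => cc v H5; clear -H5; lra.
Qed.

End ln_localization.

(** * Decay and coordinate derivatives of Schwartz functions *)

Section schwartz_decay.
Context {R : realType} {n : nat}.
Local Notation Rn := 'rV[R]_n.
Local Notation mR := (measurableTypeR R).
Local Notation normc := (@ComplexField.Normc.normc R).

Lemma normc_ge0 (z : R[i]) : 0 <= normc z.
Proof. by case: z => a b; exact: sqrtr_ge0. Qed.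

Lemma normc_Re_le (z : R[i]) : `|complex.Re z| <= normc z.
Proof. by case: z => a b /=; rewrite -sqrtr_sqr; apply: ler_wsqrtr; rewrite lerDl sqr_ge0. Qed.

Lemma normc_Im_le (z : R[i]) : `|complex.Im z| <= normc z.
Proof. by case: z => a b /=; rewrite -sqrtr_sqr; apply: ler_wsqrtr; rewrite lerDr sqr_ge0. Qed.

Lemma normc_sqr (z : R[i]) : normc z ^+ 2 = complex.Re z ^+ 2 + complex.Im z ^+ 2.
Proof. by case: z => a b /=; rewrite sqr_sqrtr// addr_ge0// sqr_ge0. Qed.

Lemma normc_real (r : R) : normc r%:C = `|r|.
Proof. by rewrite /= expr0n addr0 sqrtr_sqr. Qed.

Lemma exp1D_le (y : R) m : 0 <= y -> (1 + y) ^+ m <= 2 ^+ m * (1 + y ^+ m).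
Proof.
move=> y0; have [y1|y1] := leP y 1.
  apply: (@le_trans _ _ (2 ^+ m)).
    by apply: lerXn2r; rewrite ?nnegrE ?addr_ge0//; lra.
  by rewrite ler_peMr ?exprn_ge0// lerDl exprn_ge0.
apply: (@le_trans _ _ ((2 * y) ^+ m)).
  by apply: lerXn2r; rewrite ?nnegrE ?addr_ge0 ?mulr_ge0//; lra.
by rewrite exprMn ler_wpM2l ?exprn_ge0// lerDr.
Qed.

(** The m-th power of 1/decay is a product of factors (1 + t_i^2)^m, which is dominated by
the sum of the 2^n monomials with all exponents in {0, 2m}. *)
Lemma schwartz_bounded_decay (F : set (Rn -> R[i])) : schwartz_bounded F ->
  forall m beta, exists C : R, forall f (t : n.-tuple mR), F f ->
    normc (partials beta f (row_of t)) <= C * decay t ^+ m.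
Proof.
move=> [_ bF] m beta.
have /choice[M HM] : forall alpha : 'I_n -> nat, exists M : R, forall f x, F f ->
     normc ((monomial alpha x)%:C * partials beta f x) <= M.
  by move=> alpha; exact: bF.
pose al (J : {set 'I_n}) i := if i \in J then (2 * m)%N else 0%N.
exists (\sum_(J in {set 'I_n}) (2 ^+ m) ^+ n * M (al J)) => f t Ff.
set v := partials beta f (row_of t).
have dt := decay_gt0 t.
have key : (decay t)^-1 ^+ m <= \sum_(J in {set 'I_n}) (2 ^+ m) ^+ n * monomial (al J) (row_of t).
  rewrite -mulr_sumr.
  have -> : (decay t)^-1 ^+ m = \prod_(i < n) (1 + tnth t i ^+ 2) ^+ m.
    rewrite /decay -prodfV -prodrXl; apply: eq_bigr => i _.
    by rewrite /cauchy_weight invrK.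
  apply: (@le_trans _ _ (\prod_(i < n) (2 ^+ m * (tnth t i ^+ (2 * m) + 1)))).
    apply: ler_prod => i _; rewrite exprn_ge0 ?addr_ge0 ?sqr_ge0//=.
    by rewrite [_ + 1]addrC exprM exp1D_le// sqr_ge0.
  rewrite big_split /= prodr_const_ord bigA_distr; apply: ler_wpM2l.
    by rewrite !exprn_ge0.
  apply: ler_sum => J _; rewrite le_eqVlt; apply/orP; left; apply/eqP.
  apply: eq_bigr => i _; rewrite mxE /al; case: (i \in J) => //.
have e : normc v = (decay t)^-1 ^+ m * normc v * decay t ^+ m.
  by rewrite mulrAC -exprMn mulVf ?gt_eqF// expr1n mul1r.
rewrite e; apply: ler_wpM2r; first by rewrite exprn_ge0// ltW.
apply: (le_trans (ler_wpM2r (normc_ge0 v) key)).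
rewrite mulr_suml; apply: ler_sum => J _; rewrite -mulrA; apply: ler_wpM2l.
  by rewrite !exprn_ge0.
have := HM (al J) f (row_of t) Ff.
rewrite ComplexField.Normc.normcM normc_real; apply: le_trans.
by apply: ler_wpM2r; [exact: normc_ge0|exact: ler_norm].
Qed.

End schwartz_decay.

Section coordinate_lines.
Context {R : realType} {n : nat}.
Local Notation Rn := 'rV[R]_n.
Local Notation mR := (measurableTypeR R).

Lemma is_derive_line (h : Rn -> R) (x0 v : Rn) (s : R) : derivable h (x0 + s *: v) v ->
  is_derive s 1 (fun s => h (x0 + s *: v)) ('D_v h (x0 + s *: v)).
Proof.
move=> hd.
have E : (fun r : R => r^-1 *: (((fun s => h (x0 + s *: v)) \o shift s) (r *: 1) - h (x0 + s *: v))) =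
  (fun r : R => r^-1 *: ((h \o shift (x0 + s *: v)) (r *: v) - h (x0 + s *: v))).
  apply/funext => r /=; congr (_ *: (h _ - _)).
  by rewrite /shift /= [r *: 1]mulr1 scalerDl addrCA.
apply: DeriveDef.
  by rewrite /derivable E.
by rewrite /derive E.
Qed.

Lemma row_of_upd (t : n.-tuple mR) j (s : R) :
  row_of (upd t j s) = row_of (upd t j 0) + s *: delta_mx ord0 j.
Proof.
apply/rowP => i; rewrite !mxE !tnth_mktuple eqxx /=.
by case: (i == j); rewrite ?mulr1 ?add0r ?mulr0 ?addr0.
Qed.

Lemma is_derive_coord (h : Rn -> R) (t : n.-tuple mR) j (s : R) :
  (forall x, differentiable h x) ->
  is_derive s 1 (fun s => h (row_of (upd t j s)))
    ('D_(delta_mx ord0 j) h (row_of (upd t j s))).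
Proof.
move=> dh; under eq_fun do rewrite row_of_upd.
rewrite (row_of_upd t j s); apply: (@is_derive_line h (row_of (upd t j 0)) (delta_mx ord0 j) s).
exact: diff_derivable.
Qed.

End coordinate_lines.

(** * Gaussians and domination *)

Section dominated.
Context {R : realType} {n : nat} (X : Type) (A : set X).
Local Notation mR := (measurableTypeR R).
Implicit Types (f g : X -> n.-tuple mR -> R).

(** A bound by the integrable weight [decay], uniform over the parameters in [A]; the
parameter will be the time. *)
Definition dominated f := exists M, forall x t, A x -> `|f x t| <= M * decay t.
Definition bounded f := exists M, forall x t, A x -> `|f x t| <= M.

Lemma dominatedD f g : dominated f -> dominated g -> dominated (fun x t => f x t + g x t).
Proof.
move=> [M HM] [N HN]; exists (M + N) => x t Ax; rewrite mulrDl.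
by rewrite (le_trans (ler_normD _ _))// lerD ?HM ?HN.
Qed.

Lemma dominatedN f : dominated f -> dominated (fun x t => - f x t).
Proof. by move=> [M HM]; exists M => x t Ax; rewrite normrN HM. Qed.

Lemma dominatedB f g : dominated f -> dominated g -> dominated (fun x t => f x t - g x t).
Proof. by move=> df dg; apply: dominatedD => //; exact: dominatedN. Qed.

Lemma dominatedM f g : bounded f -> dominated g -> dominated (fun x t => f x t * g x t).
Proof.
move=> [M HM] [N HN]; exists (`|M| * N) => x t Ax; rewrite normrM -mulrA.
by apply: ler_pM; rewrite ?HN// (le_trans (HM _ t Ax))// ler_norm.
Qed.

Lemma dominatedMr f g : dominated f -> bounded g -> dominated (fun x t => f x t * g x t).
Proof.
move=> df bg; have [M HM] := dominatedM bg df; exists M => x t Ax.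
by rewrite mulrC HM.
Qed.

Lemma dominatedZ (c : R) f : dominated f -> dominated (fun x t => c * f x t).
Proof. by move=> df; apply: dominatedM => //; exists `|c|. Qed.

Lemma dominated_sum (I : finType) (f : I -> X -> n.-tuple mR -> R) :
  (forall i, dominated (f i)) -> dominated (fun x t => \sum_i f i x t).
Proof.
move=> /choice[M HM]; exists (\sum_i M i) => x t Ax.
apply: (le_trans (ler_norm_sum _ _ _)); rewrite mulr_suml.
by apply: ler_sum => i _; exact: HM.
Qed.

End dominated.

Section gaussian.
Context {R : realType} {n : nat}.
Local Notation mR := (measurableTypeR R).
Local Notation T := (n.-tuple mR).
Implicit Types (x y : T) (al be : R).

Definition dist2 x y : R := \sum_(i < n) (tnth y i - tnth x i) ^+ 2.

Lemma dist2_ge0 x y : 0 <= dist2 x y.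
Proof. by apply: sumr_ge0 => i _; exact: sqr_ge0. Qed.

Lemma dist2_upd x y j (s : R) : dist2 x (upd y j s) =
  (s - tnth x j) ^+ 2 + \sum_(i < n | i != j) (tnth y i - tnth x i) ^+ 2.
Proof.
rewrite /dist2 (bigD1 j)//= tnth_mktuple eqxx; congr (_ + _).
by apply: eq_bigr => i /negbTE ij; rewrite tnth_mktuple ij.
Qed.

Lemma is_derive_dist2 x y j (s : R) :
  is_derive s 1 (fun s => dist2 x (upd y j s)) (2 * (s - tnth x j)).
Proof.
under eq_fun do rewrite dist2_upd.
by apply: is_derive_eq; rewrite /GRing.scale /=; ring.
Qed.

(** [gauss_re] and [gauss_im] are the real and imaginary parts of
exp(-(al - i be) |x-y|^2 / 4). *)
Definition gauss_re al be x y : R := expR (- (al * dist2 x y / 4)) * cos (be * dist2 x y / 4).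
Definition gauss_im al be x y : R := expR (- (al * dist2 x y / 4)) * sin (be * dist2 x y / 4).

Lemma gauss_re_le al be x y : 0 <= al -> `|gauss_re al be x y| <= 1.
Proof.
move=> al0; rewrite normrM ger0_norm ?expR_ge0//.
rewrite -[leRHS]mulr1 ler_pM ?expR_ge0 ?norm_cos_le1//.
by rewrite -expR0 ler_expR oppr_le0 divr_ge0// mulr_ge0// dist2_ge0.
Qed.

Lemma gauss_im_le al be x y : 0 <= al -> `|gauss_im al be x y| <= 1.
Proof.
move=> al0; rewrite normrM ger0_norm ?expR_ge0//.
rewrite -[leRHS]mulr1 ler_pM ?expR_ge0 ?norm_sin_le1//.
by rewrite -expR0 ler_expR oppr_le0 divr_ge0// mulr_ge0// dist2_ge0.
Qed.

Lemma is_derive_gauss (rho al be : R -> R) (s rho' al' be' : R) :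
  is_derive s 1 rho rho' -> is_derive s 1 al al' -> is_derive s 1 be be' ->
  is_derive s 1 (fun s => expR (- (al s * rho s / 4)) * cos (be s * rho s / 4))
    (- ((al' * rho s + al s * rho') / 4) * (expR (- (al s * rho s / 4)) * cos (be s * rho s / 4))
     - (be' * rho s + be s * rho') / 4 * (expR (- (al s * rho s / 4)) * sin (be s * rho s / 4))) /\
  is_derive s 1 (fun s => expR (- (al s * rho s / 4)) * sin (be s * rho s / 4))
    (- ((al' * rho s + al s * rho') / 4) * (expR (- (al s * rho s / 4)) * sin (be s * rho s / 4))
     + (be' * rho s + be s * rho') / 4 * (expR (- (al s * rho s / 4)) * cos (be s * rho s / 4))).
Proof.
move=> d1 d2 d3; split.
  by apply: is_derive_eq; rewrite /GRing.scale /=; ring.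
by apply: is_derive_eq; rewrite /GRing.scale /=; ring.
Qed.

Lemma is_derive_gauss_coord al be x y j (s : R) :
  is_derive s 1 (fun s => gauss_re al be x (upd y j s))
    (- (al / 2 * (s - tnth x j)) * gauss_re al be x (upd y j s)
     - be / 2 * (s - tnth x j) * gauss_im al be x (upd y j s)) /\
  is_derive s 1 (fun s => gauss_im al be x (upd y j s))
    (- (al / 2 * (s - tnth x j)) * gauss_im al be x (upd y j s)
     + be / 2 * (s - tnth x j) * gauss_re al be x (upd y j s)).
Proof.
have [] := @is_derive_gauss (fun s => dist2 x (upd y j s)) (cst al) (cst be) s _ _ _
  (is_derive_dist2 x y j s) (is_derive_cst _ _ _) (is_derive_cst _ _ _).
by move=> d1 d2; split; apply: is_derive_eq; rewrite /gauss_re /gauss_im /=; field.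
Qed.

Lemma measurable_dist2 x : measurable_fun [set: T] (dist2 x).
Proof.
apply: measurable_sum => i; apply: measurable_funX; apply: measurable_funB => //.
exact: measurable_tnth.
Qed.

Lemma measurable_expR : measurable_fun setT (@expR R).
Proof. by apply: measurable_of_continuous; exact: continuous_expR. Qed.

Lemma measurable_gauss_re al be x : measurable_fun [set: T] (gauss_re al be x).
Proof.
have md := measurable_dist2 x.
apply: measurable_funM.
  apply: (measurableT_comp measurable_expR); apply: measurableT_comp => //.
  by do 2 apply: measurable_funM => //.
apply: (measurableT_comp (@measurable_cos R)).
by do 2 apply: measurable_funM => //.
Qed.

Lemma measurable_gauss_im al be x : measurable_fun [set: T] (gauss_im al be x).
Proof.
have md := measurable_dist2 x.
apply: measurable_funM.
  apply: (measurableT_comp measurable_expR); apply: measurableT_comp => //.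
  by do 2 apply: measurable_funM => //.
apply: (measurableT_comp (@measurable_sin R)).
by do 2 apply: measurable_funM => //.
Qed.

Lemma cauchy_weight_le1 (a : R) : cauchy_weight a <= 1.
Proof. by rewrite invf_le1 ?cauchy_den_gt0// lerDl sqr_ge0. Qed.

Lemma prod_le1 (P : pred 'I_n) (F : 'I_n -> R) : (forall i, P i -> 0 <= F i <= 1) ->
  \prod_(i | P i) F i <= 1.
Proof.
move=> F01; rewrite [leRHS](_ : 1 = \prod_(i | P i) (1 : R)); last by rewrite big1.
exact: ler_prod.
Qed.

Lemma decay_le1 y : decay y <= 1.
Proof. by apply: prod_le1 => i _; rewrite cauchy_weight_le1 ltW ?cauchy_weight_gt0. Qed.

Lemma decay_le_coord y i : decay y <= cauchy_weight (tnth y i).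
Proof.
rewrite /decay (bigD1 i)//= ler_piMr ?(ltW (cauchy_weight_gt0 _))//.
by apply: prod_le1 => j _; rewrite cauchy_weight_le1 ltW ?cauchy_weight_gt0.
Qed.

(** One factor [decay] absorbs a quadratic factor. *)
Lemma coord2_decay x y i :
  (tnth y i - tnth x i) ^+ 2 * decay y <= 2 * (1 + tnth x i ^+ 2).
Proof.
apply: (@le_trans _ _ ((tnth y i - tnth x i) ^+ 2 * cauchy_weight (tnth y i))).
  by rewrite ler_wpM2l ?sqr_ge0// decay_le_coord.
rewrite /cauchy_weight ler_pdivrMr ?cauchy_den_gt0//.
move: (tnth y i) (tnth x i) => a b; rewrite -subr_ge0.
have : 2 * (1 + b ^+ 2) * (1 + a ^+ 2) - (a - b) ^+ 2 =
  2 + (a + b) ^+ 2 + 2 * (b * a) ^+ 2 by ring.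
move=> ->; have := sqr_ge0 (a + b); have := sqr_ge0 (b * a); lra.
Qed.

Lemma dist2_decay x y : dist2 x y * decay y <= \sum_(i < n) 2 * (1 + tnth x i ^+ 2).
Proof. by rewrite /dist2 mulr_suml; apply: ler_sum => i _; exact: coord2_decay. Qed.

End gaussian.

(** * Integration by parts against a Gaussian *)

Lemma is_derive_cmul {R : realType} (a b P Q : R -> R) (s a' b' p' q' : R) :
  is_derive s 1 a a' -> is_derive s 1 b b' -> is_derive s 1 P p' -> is_derive s 1 Q q' ->
  is_derive s 1 (fun s => a s * P s - b s * Q s) (a' * P s + a s * p' - (b' * Q s + b s * q')) /\
  is_derive s 1 (fun s => a s * Q s + b s * P s) (a' * Q s + a s * q' + (b' * P s + b s * p')).
Proof. by move=> da db dP dQ; split; apply: is_derive_eq; rewrite /GRing.scale /=; ring. Qed.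

Section one_variable.
Context {R : realType}.

(** With u = a + i b, E = P + i Q and z = al - i be, this is the derivative of one
component of E grad u - u grad E = (grad u + (z/2) (y-x) u) E, in real and
imaginary parts. *)
Lemma is_derive_gauss_field (a b a1 b1 P Q : R -> R) (a2 b2 x al be r : R) :
  is_derive r 1 a (a1 r) -> is_derive r 1 b (b1 r) ->
  is_derive r 1 a1 a2 -> is_derive r 1 b1 b2 ->
  is_derive r 1 P (- (al / 2 * (r - x)) * P r - be / 2 * (r - x) * Q r) ->
  is_derive r 1 Q (- (al / 2 * (r - x)) * Q r + be / 2 * (r - x) * P r) ->
  is_derive r 1 (fun r => (a1 r + (r - x) / 2 * (al * a r + be * b r)) * P r
     - (b1 r + (r - x) / 2 * (al * b r - be * a r)) * Q r)
   ((a2 + (al * a r + be * b r) / 2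
       - (r - x) ^+ 2 / 4 * ((al ^+ 2 - be ^+ 2) * a r + 2 * al * be * b r)) * P r
    - (b2 + (al * b r - be * a r) / 2
       - (r - x) ^+ 2 / 4 * ((al ^+ 2 - be ^+ 2) * b r - 2 * al * be * a r)) * Q r) /\
  is_derive r 1 (fun r => (a1 r + (r - x) / 2 * (al * a r + be * b r)) * Q r
     + (b1 r + (r - x) / 2 * (al * b r - be * a r)) * P r)
   ((a2 + (al * a r + be * b r) / 2
       - (r - x) ^+ 2 / 4 * ((al ^+ 2 - be ^+ 2) * a r + 2 * al * be * b r)) * Q r
    + (b2 + (al * b r - be * a r) / 2
       - (r - x) ^+ 2 / 4 * ((al ^+ 2 - be ^+ 2) * b r - 2 * al * be * a r)) * P r).
Proof.
move=> da db da1 db1 dP dQ.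
have dU : is_derive r 1 (fun r => a1 r + (r - x) / 2 * (al * a r + be * b r))
    (a2 + (al * a r + be * b r) / 2 + (r - x) / 2 * (al * a1 r + be * b1 r)).
  by apply: is_derive_eq; rewrite /GRing.scale /=; ring.
have dV : is_derive r 1 (fun r => b1 r + (r - x) / 2 * (al * b r - be * a r))
    (b2 + (al * b r - be * a r) / 2 + (r - x) / 2 * (al * b1 r - be * a1 r)).
  by apply: is_derive_eq; rewrite /GRing.scale /=; ring.
have [F1 F2] := is_derive_cmul dU dV dP dQ.
split; [apply: (@is_derive_eq _ _ _ _ _ _ _ _ F1)|apply: (@is_derive_eq _ _ _ _ _ _ _ _ F2)].
  by move: (a r) (b r) (a1 r) (b1 r) (P r) (Q r) => A B A1 B1 p q; field.
by move: (a r) (b r) (a1 r) (b1 r) (P r) (Q r) => A B A1 B1 p q; field.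
Qed.

Lemma continuous_gauss_field (a b a2 b2 P Q : R -> R) (x al be : R) :
  continuous a -> continuous b -> continuous a2 -> continuous b2 ->
  continuous P -> continuous Q ->
  continuous (fun r => (a2 r + (al * a r + be * b r) / 2
       - (r - x) ^+ 2 / 4 * ((al ^+ 2 - be ^+ 2) * a r + 2 * al * be * b r)) * P r
    - (b2 r + (al * b r - be * a r) / 2
       - (r - x) ^+ 2 / 4 * ((al ^+ 2 - be ^+ 2) * b r - 2 * al * be * a r)) * Q r) /\
  continuous (fun r => (a2 r + (al * a r + be * b r) / 2
       - (r - x) ^+ 2 / 4 * ((al ^+ 2 - be ^+ 2) * a r + 2 * al * be * b r)) * Q r
    + (b2 r + (al * b r - be * a r) / 2
       - (r - x) ^+ 2 / 4 * ((al ^+ 2 - be ^+ 2) * b r - 2 * al * be * a r)) * P r).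
Proof.
move=> ca cb ca2 cb2 cP cQ.
have cd : continuous (fun r : R => (r - x) ^+ 2).
  under eq_fun do rewrite expr2.
  by move=> r; apply: cvgM; apply: cvgB; [exact: cvg_id|exact: cvg_cst|exact: cvg_id|exact: cvg_cst].
have cM (c : R) (f : R -> R) : continuous f -> continuous (fun r => c * f r).
  by move=> cf r; apply: cvgM; [exact: cvg_cst|exact: cf].
have cMr (c : R) (f : R -> R) : continuous f -> continuous (fun r => f r * c).
  by move=> cf r; apply: cvgM; [exact: cf|exact: cvg_cst].
have cN (f : R -> R) : continuous f -> continuous (fun r => - f r).
  by move=> cf r; apply: cvgN; exact: cf.
have cD (f g : R -> R) : continuous f -> continuous g -> continuous (fun r => f r + g r).
  by move=> cf cg r; apply: cvgD; [exact: cf|exact: cg].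
have cMM (f g : R -> R) : continuous f -> continuous g -> continuous (fun r => f r * g r).
  by move=> cf cg r; apply: cvgM; [exact: cf|exact: cg].
have cU : continuous (fun r => a2 r + (al * a r + be * b r) / 2
       - (r - x) ^+ 2 / 4 * ((al ^+ 2 - be ^+ 2) * a r + 2 * al * be * b r)).
  apply: (cD); [apply: (cD) => //; apply: (cMr); apply: (cD); exact: cM|].
  apply: (cN); apply: (cMM); first exact: cMr.
  by apply: (cD); exact: cM.
have cV : continuous (fun r => b2 r + (al * b r - be * a r) / 2
       - (r - x) ^+ 2 / 4 * ((al ^+ 2 - be ^+ 2) * b r - 2 * al * be * a r)).
  apply: (cD); [apply: (cD) => //; apply: (cMr); apply: (cD); [exact: cM|apply: (cN); exact: cM]|].
  apply: (cN); apply: (cMM); first exact: cMr.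
  by apply: (cD); [exact: cM|apply: (cN); exact: cM].
split; apply: (cD).
- exact: cMM.
- by apply: (cN); exact: cMM.
- exact: cMM.
- exact: cMM.
Qed.

End one_variable.

Section dominated_coord.
Context {R : realType} {n : nat} (X : Type) (A : set X).
Local Notation mR := (measurableTypeR R).
Variables (x : n.-tuple mR) (f : X -> n.-tuple mR -> R).

(** The second power of [decay] leaves room for the quadratic factors that appear when
Gaussians are differentiated. *)
Definition strongly_dominated := exists M, forall s y, A s -> `|f s y| <= M * decay y ^+ 2.

Lemma strongly_dominatedW : strongly_dominated -> dominated A f.
Proof.
move=> [M HM]; exists `|M| => s y As; apply: (le_trans (HM _ _ As)).
have d0 := ltW (decay_gt0 y).
apply: (@le_trans _ _ (`|M| * decay y ^+ 2)).
  by rewrite ler_wpM2r ?exprn_ge0// ler_norm.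
by rewrite ler_wpM2l// expr2 ler_piMl// decay_le1.
Qed.

Lemma dominated_coord2 j : strongly_dominated ->
  dominated A (fun s y => (tnth y j - tnth x j) ^+ 2 * f s y).
Proof.
move=> [M HM]; exists (2 * (1 + tnth x j ^+ 2) * `|M|) => s y As.
have d0 := ltW (decay_gt0 y).
rewrite normrM ger0_norm ?sqr_ge0//.
apply: (@le_trans _ _ ((tnth y j - tnth x j) ^+ 2 * decay y * (`|M| * decay y))).
  rewrite -mulrA ler_wpM2l ?sqr_ge0//; apply: (le_trans (HM _ _ As)).
  rewrite [leRHS](_ : _ = `|M| * decay y ^+ 2); last by ring.
  by rewrite ler_wpM2r ?exprn_ge0// ler_norm.
by rewrite -[leRHS]mulrA ler_wpM2r ?mulr_ge0// coord2_decay.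
Qed.

Lemma dominated_coord1 j : strongly_dominated ->
  dominated A (fun s y => (tnth y j - tnth x j) * f s y).
Proof.
move=> sd; have [M HM] := strongly_dominatedW sd; have [N HN] := dominated_coord2 j sd.
exists (M + N) => s y As; rewrite normrM [leRHS]mulrDl.
set d := tnth y j - tnth x j; have d2 : `|d| <= 1 + d ^+ 2.
  by rewrite -real_normK ?num_real//; have := sqr_ge0 (`|d| - 2^-1); have := normr_ge0 d; nra.
apply: (le_trans (ler_wpM2r (normr_ge0 _) d2)); rewrite mulrDl mul1r lerD//; first exact: HM.
by have := HN s y As; rewrite normrM ger0_norm ?sqr_ge0.
Qed.

End dominated_coord.

Section flow.
Context {R : realType} {n : nat}.
Local Notation Rn := 'rV[R]_n.
Local Notation mR := (measurableTypeR R).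
Local Notation T := (n.-tuple mR).
Local Notation mu := (@lebesgue_tuple R n).
Variables (u0 : Rn -> R[i]) (u : R -> Rn -> R[i]).
Hypothesis hu : free_schrodinger u0 u.

(** The derivatives of the solution, split into real and imaginary parts and read on tuples. *)
Definition RE beta s (y : T) : R := re_part (partials beta (u s)) (row_of y).
Definition IM beta s (y : T) : R := im_part (partials beta (u s)) (row_of y).
Definition lapRE s y := \sum_(j < n) RE [:: j; j] s y.
Definition lapIM s y := \sum_(j < n) IM [:: j; j] s y.

Lemma flow_smooth s : smooth (u s).
Proof.
have [_ /(_ `|s|) [sm _] _ _] := hu; apply: sm; exists s => //=.
by rewrite in_itv /= -ler_norml.
Qed.

Lemma flow_decay (K : R) m beta : exists C, forall s y, `|s| <= K ->
  `|RE beta s y| <= C * decay y ^+ m /\ `|IM beta s y| <= C * decay y ^+ m.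
Proof.
have [_ /(_ K) bd _ _] := hu.
have [C HC] := schwartz_bounded_decay bd m beta; exists C => s y sK.
have h := HC (u s) y _; split; apply: le_trans (h _).
- exact: normc_Re_le.
- by exists s => //=; rewrite in_itv /= -ler_norml.
- exact: normc_Im_le.
- by exists s => //=; rewrite in_itv /= -ler_norml.
Qed.

Lemma differentiable_re beta s x : differentiable (re_part (partials beta (u s))) x.
Proof. by have [] := flow_smooth s beta x. Qed.

Lemma differentiable_im beta s x : differentiable (im_part (partials beta (u s))) x.
Proof. by have [] := flow_smooth s beta x. Qed.

Lemma measurable_RE beta s : measurable_fun [set: T] (RE beta s).
Proof.
apply: measurable_row_comp => x; apply: differentiable_continuous.
exact: differentiable_re.
Qed.

Lemma measurable_IM beta s : measurable_fun [set: T] (IM beta s).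
Proof.
apply: measurable_row_comp => x; apply: differentiable_continuous.
exact: differentiable_im.
Qed.

Lemma is_derive_RE beta s y j (r : R) :
  is_derive r 1 (fun r => RE beta s (upd y j r)) (RE (j :: beta) s (upd y j r)).
Proof. exact: (is_derive_coord y j r (differentiable_re beta s)). Qed.

Lemma is_derive_IM beta s y j (r : R) :
  is_derive r 1 (fun r => IM beta s (upd y j r)) (IM (j :: beta) s (upd y j r)).
Proof. exact: (is_derive_coord y j r (differentiable_im beta s)). Qed.

Lemma Re_sum (I : finType) (F : I -> R[i]) :
  complex.Re (\sum_i F i) = \sum_i complex.Re (F i).
Proof. by apply: (big_morph (@complex.Re R)) => // -[a b] [c d]. Qed.

Lemma Im_sum (I : finType) (F : I -> R[i]) :
  complex.Im (\sum_i F i) = \sum_i complex.Im (F i).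
Proof. by apply: (big_morph (@complex.Im R)) => // -[a b] [c d]. Qed.

Lemma is_derive_time (s : R) y :
  is_derive s 1 (fun s => RE [::] s y) (- lapIM s y) /\
  is_derive s 1 (fun s => IM [::] s y) (lapRE s y).
Proof.
have [_ _ /(_ s (row_of y)) [dr di] /(_ s (row_of y))] := hu.
rewrite /laplacian; set L := \sum_(j < n) _ => E.
have reL : complex.Re L = lapRE s y by exact: Re_sum.
have imL : complex.Im L = lapIM s y by exact: Im_sum.
move: E; rewrite /cderive => /eqP; rewrite eq_complex => /andP[].
rewrite (_ : L = complex.Re L +i* complex.Im L); last by case: (L).
rewrite /= reL imL !mul0r !mul1r sub0r add0r => /eqP E1 /eqP E2.
split.
- by apply: (DeriveDef dr); apply/eqP; rewrite -addr_eq0; apply/eqP; exact: E2.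
- apply: (DeriveDef di).
  by apply/eqP; rewrite -subr_eq0 -oppr_eq0 opprB addrC; apply/eqP; exact: E1.
Qed.

Variable x : T.

Section one_coordinate.
Variables (al be s : R) (j : 'I_n).
Hypothesis al0 : 0 <= al.
Local Notation d y := (tnth y j - tnth x j).
Local Notation P y := (gauss_re al be x y).
Local Notation Q y := (gauss_im al be x y).
Local Notation a := (RE [::] s).
Local Notation b := (IM [::] s).
Local Notation a1 := (RE [:: j] s).
Local Notation b1 := (IM [:: j] s).
Local Notation a2 := (RE [:: j; j] s).
Local Notation b2 := (IM [:: j; j] s).

(** [field_re] and [field_im] are the parts of the j-th component of
E grad u - u grad E, the flux being this component divided by E. Summed over j,
[dfield] is the divergence E Lap u - u Lap E. *)
Definition flux_re y := a1 y + d y / 2 * (al * a y + be * b y).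
Definition flux_im y := b1 y + d y / 2 * (al * b y - be * a y).
Definition dflux_re y := a2 y + (al * a y + be * b y) / 2
   - d y ^+ 2 / 4 * ((al ^+ 2 - be ^+ 2) * a y + 2 * al * be * b y).
Definition dflux_im y := b2 y + (al * b y - be * a y) / 2
   - d y ^+ 2 / 4 * ((al ^+ 2 - be ^+ 2) * b y - 2 * al * be * a y).

Lemma tnth_upd (y : T) (r : R) : tnth (upd y j r) j = r.
Proof. by rewrite tnth_mktuple eqxx. Qed.

Definition field_re y := flux_re y * P y - flux_im y * Q y.
Definition field_im y := flux_re y * Q y + flux_im y * P y.
Definition dfield_re y := dflux_re y * P y - dflux_im y * Q y.
Definition dfield_im y := dflux_re y * Q y + dflux_im y * P y.

Lemma is_derive_field y (r : R) :
  is_derive r 1 (fun r => field_re (upd y j r)) (dfield_re (upd y j r)) /\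
  is_derive r 1 (fun r => field_im (upd y j r)) (dfield_im (upd y j r)).
Proof.
have da := is_derive_RE [::] s y j r; have db := is_derive_IM [::] s y j r.
have da1 := is_derive_RE [:: j] s y j r; have db1 := is_derive_IM [:: j] s y j r.
have [dP dQ] := is_derive_gauss_coord al be x y j r.
have [F1 F2] := is_derive_gauss_field da db da1 db1 dP dQ.
rewrite /field_re /field_im /dfield_re /dfield_im /flux_re /flux_im /dflux_re /dflux_im.
split.
  under eq_fun do rewrite tnth_upd.
  by rewrite tnth_upd; exact: F1.
under eq_fun do rewrite tnth_upd.
by rewrite tnth_upd; exact: F2.
Qed.

Lemma continuous_dfield y :
  continuous (fun r => dfield_re (upd y j r)) /\ continuous (fun r => dfield_im (upd y j r)).
Proof.
have cRE beta : continuous (fun r => RE beta s (upd y j r)).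
  exact: continuous_of_is_derive (is_derive_RE beta s y j).
have cIM beta : continuous (fun r => IM beta s (upd y j r)).
  exact: continuous_of_is_derive (is_derive_IM beta s y j).
have cP : continuous (fun r => P (upd y j r)).
  exact: (continuous_of_is_derive (fun r => (is_derive_gauss_coord al be x y j r).1)).
have cQ : continuous (fun r => Q (upd y j r)).
  exact: (continuous_of_is_derive (fun r => (is_derive_gauss_coord al be x y j r).2)).
have [F1 F2] := continuous_gauss_field (tnth x j) al be
  (cRE [::]) (cIM [::]) (cRE [:: j; j]) (cIM [:: j; j]) cP cQ.
rewrite /dfield_re /dfield_im /dflux_re /dflux_im; split.
  by under eq_fun do rewrite tnth_upd; exact: F1.
by under eq_fun do rewrite tnth_upd; exact: F2.
Qed.

Lemma measurable_dfield :
  measurable_fun [set: T] dfield_re /\ measurable_fun [set: T] dfield_im.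
Proof.
have mRE := measurable_RE; have mIM := measurable_IM.
have mP := measurable_gauss_re al be x; have mQ := measurable_gauss_im al be x.
have md : measurable_fun [set: T] (fun y : T => (tnth y j - tnth x j) ^+ 2 / 4).
  apply: measurable_funM => //; apply: measurable_funX; apply: measurable_funB => //.
  exact: measurable_tnth.
have mU : measurable_fun [set: T] dflux_re.
  apply: measurable_funB; last first.
    by apply: measurable_funM => //; apply: measurable_funD; apply: measurable_funM => //; exact: mRE.
  apply: measurable_funD; first exact: mRE.
  by apply: measurable_funM => //; apply: measurable_funD; apply: measurable_funM => //.
have mV : measurable_fun [set: T] dflux_im.
  apply: measurable_funB; last first.
    by apply: measurable_funM => //; apply: measurable_funB; apply: measurable_funM => //; exact: mRE.
  apply: measurable_funD; first exact: mIM.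
  by apply: measurable_funM => //; apply: measurable_funB; apply: measurable_funM => //.
split; [apply: measurable_funB|apply: measurable_funD]; exact: measurable_funM.
Qed.

End one_coordinate.

Lemma strongly_dominated_RE (K : R) beta : strongly_dominated [set s | `|s| <= K] (RE beta).
Proof. by have [C HC] := flow_decay K 2 beta; exists C => s y sK; have [] := HC s y sK. Qed.

Lemma strongly_dominated_IM (K : R) beta : strongly_dominated [set s | `|s| <= K] (IM beta).
Proof. by have [C HC] := flow_decay K 2 beta; exists C => s y sK; have [] := HC s y sK. Qed.

Lemma dominated_field (al be : R -> R) j (K C : R) :
  (forall s, 0 <= al s) -> (forall s, al s <= C) -> (forall s, `|be s| <= C) ->
  let dom := dominated [set s : R | `|s| <= K] in
  [/\ dom (fun s => field_re (al s) (be s) s j), dom (fun s => field_im (al s) (be s) s j),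
      dom (fun s => dfield_re (al s) (be s) s j) & dom (fun s => dfield_im (al s) (be s) s j)].
Proof.
move=> al0 alC beC dom.
have C0 : 0 <= C by rewrite (le_trans (al0 0)).
have nal s : `|al s| <= C by rewrite ger0_norm.
have bal : bounded [set s : R | `|s| <= K] (fun s (y : T) => al s / 2).
  exists (C / 2) => s y _; rewrite normrM ger0_norm// [ `|_^-1|]ger0_norm//.
  by rewrite ler_wpM2r.
have bbe : bounded [set s : R | `|s| <= K] (fun s (y : T) => be s / 2).
  exists (C / 2) => s y _; rewrite normrM [ `|_^-1|]ger0_norm//.
  by rewrite ler_wpM2r.
have bab : bounded [set s : R | `|s| <= K] (fun s (y : T) => al s * be s / 2).
  exists (C * C / 2) => s y _; rewrite !normrM [ `|_^-1|]ger0_norm//.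
  by rewrite ler_wpM2r// ler_pM.
have bsq : bounded [set s : R | `|s| <= K] (fun s (y : T) => (al s ^+ 2 - be s ^+ 2) / 4).
  exists ((C ^+ 2 + C ^+ 2) / 4) => s y _; rewrite normrM [ `|_^-1|]ger0_norm//.
  rewrite ler_wpM2r//; apply: (le_trans (ler_normB _ _)); rewrite !normrX.
  by apply: lerD; apply: lerXn2r; rewrite ?nnegrE.
have bP : bounded [set s : R | `|s| <= K] (fun s => gauss_re (al s) (be s) x).
  by exists 1 => s y _; exact: gauss_re_le.
have bQ : bounded [set s : R | `|s| <= K] (fun s => gauss_im (al s) (be s) x).
  by exists 1 => s y _; exact: gauss_im_le.
have sR := strongly_dominated_RE K; have sI := strongly_dominated_IM K.
have dR beta := strongly_dominatedW (sR beta).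
have dI beta := strongly_dominatedW (sI beta).
have dU : dom (fun s => flux_re (al s) (be s) s j).
  rewrite /flux_re; apply: dominatedD => //.
  have -> : (fun s (y : T) => (tnth y j - tnth x j) / 2 * (al s * RE [::] s y + be s * IM [::] s y)) =
    (fun s y => al s / 2 * ((tnth y j - tnth x j) * RE [::] s y) +
       be s / 2 * ((tnth y j - tnth x j) * IM [::] s y)).
    by apply/funext => s; apply/funext => y; ring.
  by apply: dominatedD; apply: dominatedM => //; exact: dominated_coord1.
have dV : dom (fun s => flux_im (al s) (be s) s j).
  rewrite /flux_im; apply: dominatedD => //.
  have -> : (fun s (y : T) => (tnth y j - tnth x j) / 2 * (al s * IM [::] s y - be s * RE [::] s y)) =
    (fun s y => al s / 2 * ((tnth y j - tnth x j) * IM [::] s y) -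
       be s / 2 * ((tnth y j - tnth x j) * RE [::] s y)).
    by apply/funext => s; apply/funext => y; ring.
  by apply: dominatedB; apply: dominatedM => //; exact: dominated_coord1.
have ddU : dom (fun s => dflux_re (al s) (be s) s j).
  rewrite /dflux_re.
  have -> : (fun s (y : T) => RE [:: j; j] s y + (al s * RE [::] s y + be s * IM [::] s y) / 2
     - (tnth y j - tnth x j) ^+ 2 / 4 * ((al s ^+ 2 - be s ^+ 2) * RE [::] s y + 2 * al s * be s * IM [::] s y)) =
    (fun s y => RE [:: j; j] s y + (al s / 2 * RE [::] s y + be s / 2 * IM [::] s y)
      - ((al s ^+ 2 - be s ^+ 2) / 4 * ((tnth y j - tnth x j) ^+ 2 * RE [::] s y)
         + al s * be s / 2 * ((tnth y j - tnth x j) ^+ 2 * IM [::] s y))).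
    by apply/funext => s; apply/funext => y; field.
  apply: dominatedB.
    by apply: dominatedD => //; apply: dominatedD; exact: dominatedM.
  by apply: dominatedD; apply: dominatedM => //; exact: dominated_coord2.
have ddV : dom (fun s => dflux_im (al s) (be s) s j).
  rewrite /dflux_im.
  have -> : (fun s (y : T) => IM [:: j; j] s y + (al s * IM [::] s y - be s * RE [::] s y) / 2
     - (tnth y j - tnth x j) ^+ 2 / 4 * ((al s ^+ 2 - be s ^+ 2) * IM [::] s y - 2 * al s * be s * RE [::] s y)) =
    (fun s y => IM [:: j; j] s y + (al s / 2 * IM [::] s y - be s / 2 * RE [::] s y)
      - ((al s ^+ 2 - be s ^+ 2) / 4 * ((tnth y j - tnth x j) ^+ 2 * IM [::] s y)
         - al s * be s / 2 * ((tnth y j - tnth x j) ^+ 2 * RE [::] s y))).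
    by apply/funext => s; apply/funext => y; field.
  apply: dominatedB.
    by apply: dominatedD => //; apply: dominatedB; exact: dominatedM.
  by apply: dominatedB; apply: dominatedM => //; exact: dominated_coord2.
split.
- by apply: dominatedB; exact: dominatedMr.
- by apply: dominatedD; exact: dominatedMr.
- by apply: dominatedB; exact: dominatedMr.
- by apply: dominatedD; exact: dominatedMr.
Qed.

(** A derivative in the j-th variable integrates to 0; summed over j this is Green's
formula for u and the Gaussian. *)
Lemma integral_dfield (al be s : R) j : 0 <= al ->
  (\int[mu]_y (dfield_re al be s j y)%:E = 0)%E /\
  (\int[mu]_y (dfield_im al be s j y)%:E = 0)%E.
Proof.
move=> al0; have [m1 m2] := measurable_dfield al be s j.
have alC : al <= Order.max al `|be| by rewrite le_max lexx.
have beC : `|be| <= Order.max al `|be| by rewrite le_max lexx orbT.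
have [[M1 F1] [M2 F2] [N1 G1] [N2 G2]] := 
  @dominated_field (fun=> al) (fun=> be) j `|s| (Order.max al `|be|) (fun=> al0) (fun=> alC) (fun=> beC).
have up (M N : R) (y : T) : M * decay y <= Order.max M N * decay y.
  by rewrite ler_wpM2r ?(ltW (decay_gt0 y))// le_max lexx.
have up' (M N : R) (y : T) : N * decay y <= Order.max M N * decay y.
  by rewrite ler_wpM2r ?(ltW (decay_gt0 y))// le_max lexx orbT.
split.
  apply: (@integral_partial0 R n j (field_re al be s j) _ (Order.max M1 N1)) => //.
  - by move=> y r; have [] := is_derive_field al be s j y r.
  - by move=> y; have [] := continuous_dfield al be s j y.
  - by move=> y; apply: (le_trans _ (up _ _ y)); apply: F1 => /=.
  - by move=> y; apply: (le_trans _ (up' _ _ y)); apply: G1 => /=.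
apply: (@integral_partial0 R n j (field_im al be s j) _ (Order.max M2 N2)) => //.
- by move=> y r; have [] := is_derive_field al be s j y r.
- by move=> y; have [] := continuous_dfield al be s j y.
- by move=> y; apply: (le_trans _ (up _ _ y)); apply: F2 => /=.
- by move=> y; apply: (le_trans _ (up' _ _ y)); apply: G2 => /=.
Qed.

End flow.

(** * Conservation of Gaussian means *)

Section derivative_of_integral.
Context {R : realType} {n : nat}.
Local Notation mR := (measurableTypeR R).
Local Notation T := (n.-tuple mR).
Local Notation mu := (@lebesgue_tuple R n).

(** Differentiation under the integral sign, with a domination that is uniform on bounded
time intervals. *)
Lemma is_derive_Rintegral (f f' : R -> T -> R) (s : R) :
  (forall s, measurable_fun [set: T] (f s)) ->
  (forall (s : R) y, is_derive s 1 (fun s : R => f s y) (f' s y)) ->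
  (forall K : R, dominated [set s : R | `|s| <= K] f) ->
  (forall K : R, dominated [set s : R | `|s| <= K] f') ->
  is_derive s 1 (fun s : R => \int[mu]_y f s y) (\int[mu]_y f' s y).
Proof.
move=> mf df /(_ (`|s| + 1))[M HM] /(_ (`|s| + 1))[N HN].
have pE r y : partial1of2 f r y = f' r y.
  by rewrite partial1of2E; have [_ ->] := df r y.
have I r : `](s - 1), (s + 1)[%classic r -> `|r| <= `|s| + 1.
  rewrite /= in_itv /= => /andP[h1 h2]; rewrite ler_norml; apply/andP; split.
    by have := lerNnormlW (lexx `|s|); lra.
  by have := ler_norm s; lra.
have Is : `](s - 1), (s + 1)[%classic s by rewrite /= in_itv /=; apply/andP; split; lra.
have h1 r : `](s - 1), (s + 1)[%classic r -> mu.-integrable setT (EFin \o f r).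
  by move=> /I Ir; apply: (integrable_le_decay (M := M)) => // y; exact: HM.
have h2 r y : `](s - 1), (s + 1)[%classic r -> [set: T] y -> derivable (f^~ y) r 1.
  by move=> _ _; have [] := df r y.
have h3 (y : T) : 0 <= `|N| * decay y by rewrite mulr_ge0// ltW// decay_gt0.
have h4 : mu.-integrable setT (EFin \o (fun y => `|N| * decay y)).
  by apply: integrable_EFinZ; exact: integrable_decay.
have h5 r y : `](s - 1), (s + 1)[%classic r -> [set: T] y -> `|partial1of2 f r y| <= `|N| * decay y.
  move=> /I Ir _; rewrite pE; apply: (le_trans (HN _ _ Ir)).
  by rewrite ler_wpM2r ?(ltW (decay_gt0 y))// ler_norm.
apply: DeriveDef.
  exact: (derivable_under_integral measurableT Is h1 h2 h3 h4 h5).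
rewrite -derive1E (differentiation_under_integral measurableT Is h1 h2 h3 h4 h5).
by apply: eq_Rintegral => y _; rewrite pE.
Qed.

End derivative_of_integral.

Section gaussian_parameters.
Context {R : realType}.
Variables (eps t : R).
Hypothesis eps0 : 0 < eps.

(** [par_al - i par_be] = 1/(eps + i (t - s)).  With this choice the Gaussian solves the
adjoint Schroedinger equation up to a factor depending on time only. *)
Definition par_al (s : R) : R := eps / (eps ^+ 2 + (t - s) ^+ 2).
Definition par_be (s : R) : R := (t - s) / (eps ^+ 2 + (t - s) ^+ 2).

Lemma par_den_gt0 (s : R) : 0 < eps ^+ 2 + (t - s) ^+ 2.
Proof. by rewrite ltr_wpDr ?sqr_ge0// exprn_gt0. Qed.

Lemma par_al_gt0 s : 0 < par_al s.
Proof. by rewrite divr_gt0// par_den_gt0. Qed.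

Lemma par_al_le s : par_al s <= eps^-1.
Proof.
rewrite /par_al ler_pdivrMr ?par_den_gt0// ler_pdivlMl//.
by rewrite -expr2 lerDl sqr_ge0.
Qed.

Lemma par_be_le s : `|par_be s| <= eps^-1.
Proof.
rewrite /par_be normrM normfV (ger0_norm (ltW (par_den_gt0 s))).
rewrite ler_pdivrMr ?par_den_gt0// ler_pdivlMl//.
rewrite -(@real_normK _ (t - s)) ?num_real//.
by have := normr_ge0 (t - s); have := sqr_ge0 (eps - `|t - s|); nra.
Qed.

Lemma is_derive_par_al (s : R) : is_derive s 1 par_al (2 * par_al s * par_be s).
Proof.
have d0 := lt0r_neq0 (par_den_gt0 s).
have dd : is_derive s 1 (fun s => eps ^+ 2 + (t - s) ^+ 2) (- (2 * (t - s))).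
  by apply: is_derive_eq; rewrite /GRing.scale /=; ring.
have dV : is_derive s 1 (fun s => (eps ^+ 2 + (t - s) ^+ 2)^-1)
    (2 * (t - s) * (eps ^+ 2 + (t - s) ^+ 2) ^- 2).
  by apply: is_derive_eq; rewrite /GRing.scale /= mulrNN mulrC.
by apply: is_derive_eq; rewrite /GRing.scale /= /par_al /par_be; field.
Qed.

Lemma is_derive_par_be (s : R) : is_derive s 1 par_be (par_be s ^+ 2 - par_al s ^+ 2).
Proof.
have d0 := lt0r_neq0 (par_den_gt0 s).
have dd : is_derive s 1 (fun s => eps ^+ 2 + (t - s) ^+ 2) (- (2 * (t - s))).
  by apply: is_derive_eq; rewrite /GRing.scale /=; ring.
have dV : is_derive s 1 (fun s => (eps ^+ 2 + (t - s) ^+ 2)^-1)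
    (2 * (t - s) * (eps ^+ 2 + (t - s) ^+ 2) ^- 2).
  by apply: is_derive_eq; rewrite /GRing.scale /= mulrNN mulrC.
by apply: is_derive_eq; rewrite /GRing.scale /= /par_al /par_be; field.
Qed.

End gaussian_parameters.

Section conservation.
Context {R : realType} {n : nat}.
Local Notation Rn := 'rV[R]_n.
Local Notation mR := (measurableTypeR R).
Local Notation T := (n.-tuple mR).
Local Notation mu := (@lebesgue_tuple R n).
Variables (u0 : Rn -> R[i]) (u : R -> Rn -> R[i]).
Hypothesis hu : free_schrodinger u0 u.
Variables (eps t : R) (x : T).
Hypothesis eps0 : 0 < eps.
Local Notation al := (par_al eps t).
Local Notation be := (par_be eps t).
Local Notation P s y := (gauss_re (al s) (be s) x y).
Local Notation Q s y := (gauss_im (al s) (be s) x y).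
Local Notation a := (RE u [::]).
Local Notation b := (IM u [::]).

(** The parts of u E, where E is the Gaussian centred at [x] with the parameters of time
[s]. *)
Definition test_re s y := a s y * P s y - b s y * Q s y.
Definition test_im s y := a s y * Q s y + b s y * P s y.

Let dtest_re s y := - (n%:R / 2) * (be s * test_re s y - al s * test_im s y)
  - \sum_(j < n) dfield_im u x (al s) (be s) s j y.
Let dtest_im s y := - (n%:R / 2) * (be s * test_im s y + al s * test_re s y)
  + \sum_(j < n) dfield_re u x (al s) (be s) s j y.

Let sum_flux_re s y : \sum_(j < n) dflux_re u x (al s) (be s) s j y =
  lapRE u s y + n%:R / 2 * (al s * a s y + be s * b s y)
  - dist2 x y / 4 * ((al s ^+ 2 - be s ^+ 2) * a s y + 2 * al s * be s * b s y).
Proof.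
rewrite /dflux_re sumrB big_split /= sumr_const card_ord; congr (_ + _ - _).
  by rewrite -mulr_natl mulrC mulrAC; ring.
by rewrite -mulr_suml -mulr_suml.
Qed.

Let sum_flux_im s y : \sum_(j < n) dflux_im u x (al s) (be s) s j y =
  lapIM u s y + n%:R / 2 * (al s * b s y - be s * a s y)
  - dist2 x y / 4 * ((al s ^+ 2 - be s ^+ 2) * b s y - 2 * al s * be s * a s y).
Proof.
rewrite /dflux_im sumrB big_split /= sumr_const card_ord; congr (_ + _ - _).
  by rewrite -mulr_natl mulrC mulrAC; ring.
by rewrite -mulr_suml -mulr_suml.
Qed.

Let is_derive_test (s : R) y :
  is_derive s 1 (fun s => test_re s y) (dtest_re s y) /\
  is_derive s 1 (fun s => test_im s y) (dtest_im s y).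
Proof.
have [da db] := is_derive_time hu s y.
have [dP dQ] := is_derive_gauss (is_derive_cst (dist2 x y) s 1)
  (is_derive_par_al t eps0 s) (is_derive_par_be t eps0 s).
have E1 : \sum_(j < n) dfield_im u x (al s) (be s) s j y =
  (\sum_(j < n) dflux_re u x (al s) (be s) s j y) * Q s y +
  (\sum_(j < n) dflux_im u x (al s) (be s) s j y) * P s y.
  by rewrite !mulr_suml -big_split.
have E2 : \sum_(j < n) dfield_re u x (al s) (be s) s j y =
  (\sum_(j < n) dflux_re u x (al s) (be s) s j y) * P s y -
  (\sum_(j < n) dflux_im u x (al s) (be s) s j y) * Q s y.
  by rewrite !mulr_suml -sumrB.
rewrite /dtest_re /dtest_im E1 E2 sum_flux_re sum_flux_im.
have [F1 F2] := is_derive_cmul da db dP dQ; split.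
  apply: (@is_derive_eq _ _ _ _ _ _ _ _ F1).
  rewrite /test_re /test_im /gauss_re /gauss_im /=.
  set p := expR _ * cos _; set q := expR _ * sin _.
  by move: (a s y) (b s y) (lapRE u s y) (lapIM u s y) p q (dist2 x y) (al s) (be s);
    move=> *; field.
apply: (@is_derive_eq _ _ _ _ _ _ _ _ F2).
rewrite /test_re /test_im /gauss_re /gauss_im /=.
set p := expR _ * cos _; set q := expR _ * sin _.
by move: (a s y) (b s y) (lapRE u s y) (lapIM u s y) p q (dist2 x y) (al s) (be s);
  move=> *; field.
Qed.

Let al0 s : 0 <= al s. Proof. exact/ltW/par_al_gt0. Qed.

Let bP (K : R) : bounded [set s : R | `|s| <= K] (fun s y => P s y).
Proof. by exists 1 => s y _; exact: gauss_re_le. Qed.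

Let bQ (K : R) : bounded [set s : R | `|s| <= K] (fun s y => Q s y).
Proof. by exists 1 => s y _; exact: gauss_im_le. Qed.

Lemma dominated_test (K : R) : dominated [set s : R | `|s| <= K] test_re /\
  dominated [set s : R | `|s| <= K] test_im.
Proof.
have da := strongly_dominatedW (strongly_dominated_RE hu K [::]).
have db := strongly_dominatedW (strongly_dominated_IM hu K [::]).
split; [apply: dominatedB|apply: dominatedD]; exact: dominatedMr.
Qed.

Let dominated_dtest (K : R) : dominated [set s : R | `|s| <= K] dtest_re /\
  dominated [set s : R | `|s| <= K] dtest_im.
Proof.
have [d1 d2] := dominated_test K.
have bal : bounded [set s : R | `|s| <= K] (fun s (y : T) => al s).
  by exists eps^-1 => s y _; rewrite ger0_norm// par_al_le.
have bbe : bounded [set s : R | `|s| <= K] (fun s (y : T) => be s).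
  by exists eps^-1 => s y _; rewrite par_be_le.
have F j := dominated_field hu x j K al0 (par_al_le t eps0) (par_be_le t eps0).
split; rewrite /dtest_re /dtest_im.
  apply: dominatedB; last by apply: dominated_sum => j; have [] := F j.
  by apply: dominatedZ; apply: dominatedB; exact: dominatedM.
apply: dominatedD; last by apply: dominated_sum => j; have [] := F j.
by apply: dominatedZ; apply: dominatedD; exact: dominatedM.
Qed.

Lemma measurable_test s : measurable_fun [set: T] (test_re s) /\
  measurable_fun [set: T] (test_im s).
Proof.
have mRE := measurable_RE hu [::] s; have mIM := measurable_IM hu [::] s.
have mP := measurable_gauss_re (al s) (be s) x; have mQ := measurable_gauss_im (al s) (be s) x.
split; [apply: measurable_funB|apply: measurable_funD]; exact: measurable_funM.
Qed.

Lemma integrable_test s : mu.-integrable setT (fun y => (test_re s y)%:E) /\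
  mu.-integrable setT (fun y => (test_im s y)%:E).
Proof.
have [m1 m2] := measurable_test s; have [[M HM] [N HN]] := dominated_test `|s|.
split; [apply: (integrable_le_decay (M := M))|apply: (integrable_le_decay (M := N))] => // y.
  by apply: HM => /=.
by apply: HN => /=.
Qed.

Definition mean_re s := \int[mu]_y test_re s y.
Definition mean_im s := \int[mu]_y test_im s y.

Let integrable_dfield s j : mu.-integrable setT (fun y => (dfield_re u x (al s) (be s) s j y)%:E) /\
  mu.-integrable setT (fun y => (dfield_im u x (al s) (be s) s j y)%:E).
Proof.
have [m1 m2] := measurable_dfield hu x (al s) (be s) s j.
have [_ _ [M HM] [N HN]] := dominated_field hu x j `|s| al0 (par_al_le t eps0) (par_be_le t eps0).
split; [apply: (integrable_le_decay (M := M))|apply: (integrable_le_decay (M := N))] => // y.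
  by apply: HM => /=.
by apply: HN => /=.
Qed.

Let Rintegral_sum_dfield s :
  \int[mu]_y (\sum_(j < n) dfield_re u x (al s) (be s) s j y) = 0 /\
  \int[mu]_y (\sum_(j < n) dfield_im u x (al s) (be s) s j y) = 0.
Proof.
have key (F : 'I_n -> T -> R) : (forall j, mu.-integrable setT (fun y => (F j y)%:E)) ->
    (forall j, (\int[mu]_y (F j y)%:E = 0)%E) -> \int[mu]_y (\sum_(j < n) F j y) = 0.
  move=> iF F0; rewrite /Rintegral; under eq_integral do rewrite -sumEFin.
  rewrite (integral_sum measurableT (f := fun j y => (F j y)%:E))//.
  by rewrite big1// => j _; exact: F0.
split; apply: key => j; first [exact: (integrable_dfield s j).1 | exact: (integrable_dfield s j).2
  | exact: (integral_dfield hu x (be s) s j (al0 s)).1 | exact: (integral_dfield hu x (be s) s j (al0 s)).2].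
Qed.

Let integrable_sum_dfield s :
  mu.-integrable setT (fun y => (\sum_(j < n) dfield_re u x (al s) (be s) s j y)%:E) /\
  mu.-integrable setT (fun y => (\sum_(j < n) dfield_im u x (al s) (be s) s j y)%:E).
Proof.
have key (F : 'I_n -> T -> R) : (forall j, mu.-integrable setT (fun y => (F j y)%:E)) ->
    mu.-integrable setT (fun y => (\sum_(j < n) F j y)%:E).
  move=> iF; under eq_fun do rewrite -sumEFin.
  by apply: (integrable_sum measurableT) => j _; exact: iF.
split; apply: key => j; [exact: (integrable_dfield s j).1 | exact: (integrable_dfield s j).2].
Qed.

(** The time derivative of u E is i (div (E grad u - u grad E) - (n z / 2) u E), and the
divergence integrates to 0.  Hence the mean I of u E satisfies I' = -(i n z / 2) I. *)
Lemma is_derive_mean (s : R) :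
  is_derive s 1 mean_re (- (n%:R / 2) * (be s * mean_re s - al s * mean_im s)) /\
  is_derive s 1 mean_im (- (n%:R / 2) * (be s * mean_im s + al s * mean_re s)).
Proof.
have [iA iB] := integrable_test s.
have [i1 i2] := integrable_sum_dfield s; have [z1 z2] := Rintegral_sum_dfield s.
have lin (c d : R) (f g : T -> R) : mu.-integrable setT (fun y => (f y)%:E) ->
    mu.-integrable setT (fun y => (g y)%:E) ->
    mu.-integrable setT (fun y => (c * f y + d * g y)%:E) /\
    \int[mu]_y (c * f y + d * g y) = c * \int[mu]_y f y + d * \int[mu]_y g y.
  move=> fi gi; split; first by apply: integrable_EFinD; exact: integrable_EFinZ.
  by rewrite Rintegral_add ?Rintegral_scale//; exact: integrable_EFinZ.
have E1 : \int[mu]_y dtest_re s y = - (n%:R / 2) * (be s * mean_re s - al s * mean_im s).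
  have [j1 e1] := lin (be s) (- al s) _ _ iA iB.
  have [_ e2] := lin (- (n%:R / 2)) (-1) _ _ j1 i2.
  rewrite -[RHS]addr0 -[X in _ = _ + X](mulr0 (-1)) -[X in _ + _ * X]z2.
  have -> : be s * mean_re s - al s * mean_im s =
    \int[mu]_y (be s * test_re s y + - al s * test_im s y) by rewrite e1 mulNr.
  rewrite -e2.
  by apply: eq_Rintegral => y _; rewrite /dtest_re mulN1r [- al s * _]mulNr.
have E2 : \int[mu]_y dtest_im s y = - (n%:R / 2) * (be s * mean_im s + al s * mean_re s).
  have [j1 e1] := lin (be s) (al s) _ _ iB iA.
  have [_ e2] := lin (- (n%:R / 2)) 1 _ _ j1 i1.
  rewrite -[RHS]addr0 -[X in _ = _ + X](mulr0 1) -[X in _ + 1 * X]z1.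
  have -> : be s * mean_im s + al s * mean_re s =
    \int[mu]_y (be s * test_im s y + al s * test_re s y) by rewrite e1.
  rewrite -e2.
  by apply: eq_Rintegral => y _; rewrite /dtest_im mul1r.
split; [rewrite -E1|rewrite -E2]; apply: is_derive_Rintegral.
- by move=> r; have [] := measurable_test r.
- by move=> r y; have [] := is_derive_test r y.
- by move=> K; have [] := dominated_test K.
- by move=> K; have [] := dominated_dtest K.
- by move=> r; have [] := measurable_test r.
- by move=> r y; have [] := is_derive_test r y.
- by move=> K; have [] := dominated_test K.
- by move=> K; have [] := dominated_dtest K.
Qed.

(** The modulus satisfies (|I|^2)' = - n be |I|^2, while al' = 2 al be. *)
Lemma mean_conserved (s r : R) :
  (mean_re s ^+ 2 + mean_im s ^+ 2) ^+ 2 * al s ^+ n =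
  (mean_re r ^+ 2 + mean_im r ^+ 2) ^+ 2 * al r ^+ n.
Proof.
apply: (@is_derive_0_is_cst _ (fun s => (mean_re s ^+ 2 + mean_im s ^+ 2) ^+ 2 * al s ^+ n)) => {s r} s.
have [d1 d2] := is_derive_mean s.
have da := is_derive_par_al t eps0 s.
have dp : is_derive s 1 (fun s => al s ^+ n) (n%:R * be s * 2 * al s ^+ n).
  have -> : (fun s => al s ^+ n) = al ^+ n by apply/funext => r; rewrite fctE.
  apply: is_derive_eq; rewrite /GRing.scale /=.
  case: (n) => [|m]; first by rewrite !mul0r.
  by rewrite /= exprSr -[_ *+ _]mulr_natl; ring.
by apply: is_derive_eq; rewrite /GRing.scale /=; field.
Qed.

End conservation.

(** * The propagator *)

Section heat_kernel.
Context {R : realType}.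
Local Notation mR := (measurableTypeR R).
Local Notation leb := (@lebesgue_measure R).

Lemma integral_gauss1 (e m : R) : 0 < e ->
  leb.-integrable setT (fun y : mR => (expR (- ((y - m) ^+ 2 / (4 * e))))%:E) /\
  \int[leb]_(y in [set: mR]) expR (- ((y - m) ^+ 2 / (4 * e))) = Num.sqrt (4 * pi * e).
Proof.
move=> e0; pose s := Num.sqrt (2 * e).
have s2 : s ^+ 2 = 2 * e by rewrite sqr_sqrtr// mulr_ge0// ltW.
have s0 : s != 0 by rewrite sqrtr_eq0 -ltNge mulr_gt0.
pose phi : mR -> R := normal_pdf m s.
have i : leb.-integrable setT (fun y => (phi y)%:E) by exact: integrable_normal_pdf.
have E (y : mR) : expR (- ((y - m) ^+ 2 / (4 * e))) = (normal_peak s)^-1 * phi y.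
  rewrite /phi normal_pdfE// mulKf; last by rewrite gt_eqF// normal_peak_gt0.
  by rewrite /normal_fun s2 mulNr; congr (expR (- (_ / _))); ring.
under eq_fun do rewrite E; under eq_Rintegral do rewrite E.
split; first exact: integrable_EFinZ.
rewrite Rintegral_scale//.
rewrite /Rintegral integral_normal_pdf /= mulr1 /normal_peak invrK s2.
by congr Num.sqrt; ring.
Qed.

Context {n : nat}.
Local Notation T := (n.-tuple mR).
Local Notation mu := (@lebesgue_tuple R n).

Lemma gauss_re_prod (e : R) (x y : T) : gauss_re e^-1 0 x y =
  \prod_(i < n) expR (- ((tnth y i - tnth x i) ^+ 2 / (4 * e))).
Proof.
rewrite /gauss_re !mul0r cos0 mulr1 -expR_sum; congr expR.
rewrite sumrN /dist2 mulr_sumr mulr_suml; congr (- _); apply: eq_bigr => i _.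
by rewrite invfM [X in _ = _ * X]mulrC; ring.
Qed.

Lemma integral_heat (e : R) (x : T) : 0 < e ->
  mu.-integrable setT (fun y => (gauss_re e^-1 0 x y)%:E) /\
  \int[mu]_y gauss_re e^-1 0 x y = Num.sqrt (4 * pi * e) ^+ n.
Proof.
move=> e0; under eq_fun do rewrite gauss_re_prod; under eq_Rintegral do rewrite gauss_re_prod.
have [] := @integrable_prodE R n (fun i y => expR (- ((y - tnth x i) ^+ 2 / (4 * e)))).
- by move=> i y; exact: expR_ge0.
- by move=> i; exact: (integral_gauss1 _ e0).1.
move=> i ->; split => //.
under eq_bigr do rewrite (integral_gauss1 _ e0).2.
by rewrite prodr_const card_ord.
Qed.

(** z exp(-z) <= 1 with z = |x-y|^2 / (8e): half of the Gaussian absorbs the factor. *)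
Lemma heat_moment (e : R) (x y : T) : 0 < e ->
  dist2 x y * gauss_re e^-1 0 x y <= 8 * e * gauss_re (2 * e)^-1 0 x y.
Proof.
move=> e0; rewrite /gauss_re !mul0r cos0 !mulr1.
set r := dist2 x y; pose z := r / (8 * e).
have z0 : 0 <= z by rewrite divr_ge0 ?dist2_ge0// mulr_ge0// ltW.
have -> : e^-1 * r / 4 = z + z by rewrite /z; field; rewrite gt_eqF.
have -> : (2 * e)^-1 * r / 4 = z by rewrite /z; field; rewrite gt_eqF.
have -> : r = 8 * e * z by rewrite /z; field; rewrite gt_eqF.
move: z z0 => {}z z0.
rewrite opprD expRD -mulrA ler_wpM2l ?mulr_ge0 ?(ltW e0)// mulrA.
rewrite ler_piMl ?expR_ge0// expRN ler_pdivrMr ?expR_gt0// mul1r.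
by apply: le_trans (expR_ge1Dx z); rewrite lerDr.
Qed.

Lemma heat_mean_bound (f : T -> R) (c M d C e : R) (x : T) : 0 < e -> 0 <= C ->
  measurable_fun [set: T] f -> (forall y, `|f y| <= M) ->
  (forall y, `|f y - c| <= d + C * dist2 x y) ->
  `|c - (\int[mu]_y (f y * gauss_re e^-1 0 x y)) / Num.sqrt (4 * pi * e) ^+ n| <=
  d + C * (8 * e * Num.sqrt 2 ^+ n).
Proof.
move=> e0 C0 mf fM fc.
have e20 : 0 < 2 * e by rewrite mulr_gt0.
have [i1 I1] := integral_heat x e0; have [i2 I2] := integral_heat x e20.
set N := Num.sqrt (4 * pi * e) ^+ n in I1 *.
have N0 : 0 < N by rewrite exprn_gt0// sqrtr_gt0 !mulr_gt0// pi_gt0.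
set h1 := gauss_re e^-1 0 x in i1 I1 *; set h2 := gauss_re (2 * e)^-1 0 x in i2 I2.
have h10 y : 0 <= h1 y by rewrite /h1 gauss_re_prod prodr_ge0// => i _; exact: expR_ge0.
have mh : measurable_fun [set: T] h1 by exact: measurable_gauss_re.
have ifh : mu.-integrable setT (fun y => (f y * h1 y)%:E).
  apply: (integrable_EFin_le (g := fun y => M * h1 y)).
  - exact: measurable_funM.
  - by move=> y; rewrite normrM (ger0_norm (h10 y)) ler_wpM2r.
  - exact: integrable_EFinZ.
have E : c - (\int[mu]_y (f y * h1 y)) / N = - (\int[mu]_y (f y * h1 y - c * h1 y) / N).
  rewrite Rintegral_sub//; last exact: integrable_EFinZ.
  by rewrite Rintegral_scale// I1; field; rewrite gt_eqF.
rewrite E normrN normrM normfV (gtr0_norm N0) ler_pdivrMr//.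
have i3 : mu.-integrable setT (fun y => (f y * h1 y - c * h1 y)%:E).
  by apply: integrable_EFinB => //; exact: integrable_EFinZ.
have N2 : Num.sqrt (4 * pi * (2 * e)) ^+ n = Num.sqrt 2 ^+ n * N.
  rewrite /N -exprMn -sqrtrM//; congr (Num.sqrt _ ^+ _); ring.
rewrite mulrDl.
rewrite (_ : C * (8 * e * Num.sqrt 2 ^+ n) * N = C * (8 * e) * (Num.sqrt 2 ^+ n * N)); last by ring.
rewrite -N2 -I2 -[X in d * X]I1 -!Rintegral_scale// -Rintegral_add; try exact: integrable_EFinZ.
apply: (le_trans (ler_norm_Rintegral i3)); apply: ler_Rintegral.
- exact: integrable_EFin_norm.
- by apply: integrable_EFinD; exact: integrable_EFinZ.
move=> y; rewrite -mulrBl normrM (ger0_norm (h10 y)).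
apply: (le_trans (ler_wpM2r (h10 y) (fc y))); rewrite mulrDl lerD2l -!mulrA ler_wpM2l//.
by rewrite mulrA heat_moment.
Qed.

(** The first term of the error bound can be chosen small, and the second moment of the
heat kernel tends to 0. *)
Lemma heat_mean_cvg (f : T -> R) (c M : R) (x : T) :
  measurable_fun [set: T] f -> (forall y, `|f y| <= M) ->
  (forall d, 0 < d -> exists2 C, 0 <= C & forall y, `|f y - c| <= d + C * dist2 x y) ->
  (\int[mu]_y (f y * gauss_re (harmonic m)^-1 0 x y)) /
    Num.sqrt (4 * pi * harmonic m) ^+ n @[m --> \oo] --> c.
Proof.
move=> mf fM fc; apply/cvgrPdist_le => d d0.
have [C C0 HC] := fc (d / 2) ltac:(lra).
have K : C * (8 * harmonic m * Num.sqrt 2 ^+ n) @[m --> \oo] --> (0 : R).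
  rewrite [X in _ --> X](_ : 0 = C * (8 * 0 * Num.sqrt 2 ^+ n)); last by rewrite !(mulr0, mul0r).
  apply: cvgM; first exact: cvg_cst.
  apply: cvgM; last exact: cvg_cst.
  by apply: cvgM; [exact: cvg_cst|exact: cvg_harmonic].
have d2 : 0 < d / 2 by lra.
move/cvgrPdist_le : K => /(_ _ d2); apply: filterS => m.
rewrite sub0r normrN => Km.
apply: (le_trans (heat_mean_bound _ C0 mf fM HC)); first by rewrite invr_gt0.
by rewrite [leRHS](splitr d) lerD2l (le_trans _ Km)// ler_norm.
Qed.

End heat_kernel.

Section continuity_modulus.
Context {R : realType} {n : nat}.
Local Notation mR := (measurableTypeR R).
Local Notation T := (n.-tuple mR).

Lemma rV_norm_sqr_le (x y : T) : `|row_of x - row_of y| ^+ 2 <= dist2 x y.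
Proof.
rewrite -[leRHS]sqr_sqrtr ?dist2_ge0//; apply: lerXn2r; rewrite ?nnegrE ?sqrtr_ge0//.
apply: rV_norm_le; rewrite ?sqrtr_ge0// => i; rewrite !mxE.
rewrite -sqrtr_sqr ler_sqrt ?dist2_ge0// /dist2 (bigD1 i)//= -[X in X <= _]sqrrN opprB.
by rewrite lerDl sumr_ge0// => j _; exact: sqr_ge0.
Qed.

(** Near [x] this is continuity; at a distance from [x] the quadratic term exceeds the
oscillation of a bounded function. *)
Lemma continuity_modulus (h : 'rV[R]_n -> R) (M : R) (x : T) :
  {for row_of x, continuous h} -> (forall y : T, `|h (row_of y)| <= M) ->
  forall d : R, 0 < d -> exists2 C, 0 <= C &
    forall y : T, `|h (row_of y) - h (row_of x)| <= d + C * dist2 x y.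
Proof.
move=> ch hM d d0; have M0 : 0 <= M := le_trans (normr_ge0 _) (hM x).
move/cvgrPdist_le : (ch) => /(_ _ d0)/nbhs_normP[e /= e0 He].
exists (2 * M / e ^+ 2); first by rewrite divr_ge0 ?sqr_ge0 ?mulr_ge0.
move=> y; have [xy|xy] := ltP `|row_of x - row_of y| e.
  rewrite distrC; apply: (le_trans (He (row_of y) xy)); rewrite lerDl mulr_ge0 ?dist2_ge0//.
  by rewrite divr_ge0 ?sqr_ge0 ?mulr_ge0.
apply: (@le_trans _ _ (2 * M)).
  by apply: (le_trans (ler_normB _ _)); rewrite mulr_natl mulr2n lerD.
rewrite -[leLHS]add0r lerD ?(ltW d0)// mulrAC ler_pdivlMr ?exprn_gt0//.
rewrite ler_wpM2l ?mulr_ge0//; apply: le_trans (rV_norm_sqr_le x y).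
by apply: lerXn2r; rewrite ?nnegrE// ltW.
Qed.

End continuity_modulus.

Section parameters_diagonal.
Context {R : realType}.
Implicit Types e t : R.

Lemma par_al_diag e t : 0 < e -> par_al e t t = e^-1.
Proof.
move=> e0; rewrite /par_al subrr (expr2 0) mulr0 addr0 expr2 invfM mulrA divff ?mul1r//.
by rewrite gt_eqF.
Qed.

Lemma par_be_diag e t : par_be e t t = 0.
Proof. by rewrite /par_be subrr mul0r. Qed.

End parameters_diagonal.

Lemma gaussian_balance {R : realFieldType} n (A B A' B' N e d : R) (p : R) :
  e != 0 -> d != 0 -> N != 0 -> N ^+ 2 = (p * e) ^+ n ->
  (A ^+ 2 + B ^+ 2) ^+ 2 * (e / d) ^+ n = (A' ^+ 2 + B' ^+ 2) ^+ 2 * e^-1 ^+ n ->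
  (A ^+ 2 + B ^+ 2) ^+ 2 = ((A' / N) ^+ 2 + (B' / N) ^+ 2) ^+ 2 * (p ^+ 2 * d) ^+ n.
Proof.
move=> e0 d0 N0 N2 H.
have -> : ((A' / N) ^+ 2 + (B' / N) ^+ 2) ^+ 2 = (A' ^+ 2 + B' ^+ 2) ^+ 2 / (N ^+ 2) ^+ 2.
  by field.
have en0 : e ^+ n != 0 by rewrite expf_neq0.
have dn0 : d ^+ n != 0 by rewrite expf_neq0.
have Nn0 : (p * e) ^+ n != 0 by rewrite -N2 expf_neq0.
have -> : (A' ^+ 2 + B' ^+ 2) ^+ 2 = (A ^+ 2 + B ^+ 2) ^+ 2 * (e ^+ n) ^+ 2 / d ^+ n.
  apply: (@mulIf _ (e^-1 ^+ n)); first by rewrite expf_neq0// invr_eq0.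
  by rewrite -H exprMn !exprVn; field; apply/andP.
have -> : (p ^+ 2 * d) ^+ n = (p ^+ n) ^+ 2 * d ^+ n by rewrite exprMn exprAC.
move: Nn0; rewrite N2 exprMn mulf_eq0 negb_or => /andP[pn0 _].
by field; apply/and3P.
Qed.

Section propagator.
Context {R : realType} {n : nat}.
Local Notation Rn := 'rV[R]_n.
Local Notation mR := (measurableTypeR R).
Local Notation T := (n.-tuple mR).
Local Notation mu := (@lebesgue_tuple R n).
Variables (u0 : Rn -> R[i]) (u : R -> Rn -> R[i]).
Hypothesis hu : free_schrodinger u0 u.
Variables (t s : R) (x : T).
Hypothesis ts : t != s.
Local Notation e_ m := (@harmonic R m).
Local Notation a := (RE u [::]).
Local Notation b := (IM u [::]).

(** The parts of u(s,y) exp(i |x-y|^2 / (4 (t-s))). *)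
Definition osc_re y := a s y * cos ((t - s)^-1 * dist2 x y / 4)
  - b s y * sin ((t - s)^-1 * dist2 x y / 4).
Definition osc_im y := a s y * sin ((t - s)^-1 * dist2 x y / 4)
  + b s y * cos ((t - s)^-1 * dist2 x y / 4).

Let e0 m : 0 < e_ m. Proof. by rewrite /harmonic invr_gt0. Qed.

Let cvg_par : par_al (e_ m) t s @[m --> \oo] --> (0 : R) /\
  par_be (e_ m) t s @[m --> \oo] --> (t - s)^-1.
Proof.
have ts0 : t - s != 0 by rewrite subr_eq0.
have cden : (e_ m ^+ 2 + (t - s) ^+ 2)^-1 @[m --> \oo] --> ((t - s) ^+ 2)^-1.
  apply: cvgV; first by rewrite sqrf_eq0.
  rewrite -[X in _ --> X]add0r; apply: cvgD; last exact: cvg_cst.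
  rewrite -[X in _ --> X](mulr0 (0 : R)); under eq_fun do rewrite expr2.
  by apply: cvgM; exact: cvg_harmonic.
split; rewrite /par_al /par_be.
  rewrite -[X in _ --> X](mul0r ((t - s) ^+ 2)^-1).
  by apply: cvgM; [exact: cvg_harmonic|exact: cden].
rewrite (_ : (t - s)^-1 = (t - s) * ((t - s) ^+ 2)^-1); last by field.
by apply: cvgM; [exact: cvg_cst|exact: cden].
Qed.

Let cvg_gauss y :
  gauss_re (par_al (e_ m) t s) (par_be (e_ m) t s) x y @[m --> \oo] -->
    cos ((t - s)^-1 * dist2 x y / 4) /\
  gauss_im (par_al (e_ m) t s) (par_be (e_ m) t s) x y @[m --> \oo] -->
    sin ((t - s)^-1 * dist2 x y / 4).
Proof.
have [c1 c2] := cvg_par.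
have cE : expR (- (par_al (e_ m) t s * dist2 x y / 4)) @[m --> \oo] --> (1 : R).
  rewrite -[X in _ --> X](@expR0 R); apply: continuous_cvg; first exact: continuous_expR.
  rewrite -[X in _ --> X]oppr0; apply: cvgN.
  rewrite [X in _ --> X](_ : 0 = 0 * dist2 x y / 4); last by rewrite !mul0r.
  by apply: cvgM; [apply: cvgM; [exact: c1|exact: cvg_cst]|exact: cvg_cst].
have cB : par_be (e_ m) t s * dist2 x y / 4 @[m --> \oo] --> (t - s)^-1 * dist2 x y / 4.
  by apply: cvgM; [apply: cvgM; [exact: c2|exact: cvg_cst]|exact: cvg_cst].
split; rewrite -[X in _ --> X]mul1r; apply: cvgM => //.
  by apply: continuous_cvg => //; exact: continuous_cos.
by apply: continuous_cvg => //; exact: continuous_sin.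
Qed.

Let dominated_limit (f_ : nat -> T -> R) (f : T -> R) (M : R) :
  (forall m, measurable_fun [set: T] (f_ m)) -> (forall m y, `|f_ m y| <= M * decay y) ->
  (forall y, f_ m y @[m --> \oo] --> f y) ->
  \int[mu]_y f_ m y @[m --> \oo] --> \int[mu]_y f y.
Proof.
move=> mf fM cf.
have mfin : measurable_fun [set: T] f.
  by apply: (measurable_fun_cvg (h := f_)) => // y _; exact: cf.
have fM' y : `|f y| <= M * decay y.
  apply: (ler_cvg_to (cvg_norm (cf y)) (cvg_cst (M * decay y))).
  by apply: nearW => m; exact: fM.
have ic (g : T -> R) : measurable_fun [set: T] g -> (forall y, `|g y| <= M * decay y) ->
    mu.-integrable setT (fun y => (g y)%:E) by exact: integrable_le_decay.
apply: fine_cvg; rewrite EFin_Rintegral; last exact: ic.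
apply: (@dominated_cvg _ _ _ mu setT _ (fun m y => (f_ m y)%:E) (fun y => (f y)%:E)
  (fun y => (M * decay y)%:E)) => //.
- by move=> m; apply/measurable_EFinP.
- by move=> y _; apply: cvg_EFin; [exact: nearW|exact: cf].
- by apply: integrable_EFinZ; exact: integrable_decay.
- by move=> m y _; rewrite lee_fin.
Qed.

Let flow_bound r : exists C, forall y, `|a r y| <= C * decay y /\ `|b r y| <= C * decay y.
Proof.
have [C HC] := flow_decay hu `|r| 1 [::]; exists C => y.
by have := HC r y (lexx _); rewrite expr1.
Qed.

Let cvg_mean : mean_re u (e_ m) t x s @[m --> \oo] --> \int[mu]_y osc_re y /\
  mean_im u (e_ m) t x s @[m --> \oo] --> \int[mu]_y osc_im y.
Proof.
have [C HC] := flow_bound s.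
have P1 m y : `|gauss_re (par_al (e_ m) t s) (par_be (e_ m) t s) x y| <= 1.
  by apply: gauss_re_le; exact/ltW/par_al_gt0.
have Q1 m y : `|gauss_im (par_al (e_ m) t s) (par_be (e_ m) t s) x y| <= 1.
  by apply: gauss_im_le; exact/ltW/par_al_gt0.
have mulb (v w K : R) : `|v| <= K -> `|w| <= 1 -> `|v * w| <= K.
  by move=> vK w1; rewrite normrM -[leRHS]mulr1 ler_pM.
split; apply: (@dominated_limit _ _ (C + C)).
- by move=> m; have [] := measurable_test hu (e_ m) t x s.
- move=> m y; have [ha hb] := HC y; rewrite mulrDl; apply: (le_trans (ler_normB _ _)).
  by apply: lerD; exact: mulb.
- move=> y; have [c1 c2] := cvg_gauss y.
  by apply: cvgB; apply: cvgM => //; exact: cvg_cst.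
- by move=> m; have [] := measurable_test hu (e_ m) t x s.
- move=> m y; have [ha hb] := HC y; rewrite mulrDl; apply: (le_trans (ler_normD _ _)).
  by apply: lerD; exact: mulb.
- move=> y; have [c1 c2] := cvg_gauss y.
  by apply: cvgD; apply: cvgM => //; exact: cvg_cst.
Qed.

Local Notation N m := (Num.sqrt (4 * pi * e_ m) ^+ n).

Let cvg_mean_t : mean_re u (e_ m) t x t / N m @[m --> \oo] --> a t x /\
  mean_im u (e_ m) t x t / N m @[m --> \oo] --> b t x.
Proof.
have [C HC] := flow_bound t.
have Cd (y : T) : C * decay y <= `|C|.
  apply: (le_trans (ler_norm _)); rewrite normrM (gtr0_norm (decay_gt0 y)).
  by rewrite ler_piMr// decay_le1.
have E m y : gauss_re (par_al (e_ m) t t) (par_be (e_ m) t t) x y = gauss_re (e_ m)^-1 0 x y.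
  by rewrite par_al_diag// par_be_diag.
have F m y : gauss_im (par_al (e_ m) t t) (par_be (e_ m) t t) x y = 0.
  by rewrite par_be_diag /gauss_im !mul0r sin0 mulr0.
have mre m : mean_re u (e_ m) t x t = \int[mu]_y (a t y * gauss_re (e_ m)^-1 0 x y).
  by apply: eq_Rintegral => y _; rewrite /test_re E F mulr0 subr0.
have mim m : mean_im u (e_ m) t x t = \int[mu]_y (b t y * gauss_re (e_ m)^-1 0 x y).
  by apply: eq_Rintegral => y _; rewrite /test_im E F mulr0 add0r.
split.
  under eq_fun do rewrite mre; apply: (@heat_mean_cvg _ _ _ _ `|C|).
  - exact: (measurable_RE hu).
  - by move=> y; have [h _] := HC y; exact: (le_trans h (Cd y)).
  - apply: (@continuity_modulus _ _ _ `|C|).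
      exact/differentiable_continuous/(differentiable_re hu).
    by move=> y; have [h _] := HC y; exact: (le_trans h (Cd y)).
under eq_fun do rewrite mim; apply: (@heat_mean_cvg _ _ _ _ `|C|).
- exact: (measurable_IM hu).
- by move=> y; have [_ h] := HC y; exact: (le_trans h (Cd y)).
- apply: (@continuity_modulus _ _ _ `|C|).
    exact/differentiable_continuous/(differentiable_im hu).
  by move=> y; have [_ h] := HC y; exact: (le_trans h (Cd y)).
Qed.

(** The conserved quantity is compared at the times [s] and [t] when eps tends to 0.  At
time [t] the mean is that of u(t) against a heat kernel of mass
(4 pi eps)^(n/2), and the powers of eps cancel. *)
Lemma propagator_formula : (4 * pi * `|t - s|) ^+ n * (a t x ^+ 2 + b t x ^+ 2) =
  (\int[mu]_y osc_re y) ^+ 2 + (\int[mu]_y osc_im y) ^+ 2.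
Proof.
have [c1 c2] := cvg_mean; have [d1 d2] := cvg_mean_t.
have sq (f : nat -> R) (l : R) : f m @[m --> \oo] --> l -> f m ^+ 2 @[m --> \oo] --> l ^+ 2.
  by move=> fl; rewrite expr2; under eq_fun do rewrite expr2; exact: cvgM.
have pw (f : nat -> R) (l : R) k : f m @[m --> \oo] --> l -> f m ^+ k @[m --> \oo] --> l ^+ k.
  move=> fl; elim: k => [|k IH].
    by under eq_fun do rewrite expr0; rewrite expr0; exact: cvg_cst.
  by rewrite exprS; under eq_fun do rewrite exprS; exact: cvgM.
have L1 : (mean_re u (e_ m) t x s ^+ 2 + mean_im u (e_ m) t x s ^+ 2) ^+ 2 @[m --> \oo] -->
    ((\int[mu]_y osc_re y) ^+ 2 + (\int[mu]_y osc_im y) ^+ 2) ^+ 2.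
  by apply: (sq); apply: cvgD; exact: sq.
have L2 : ((mean_re u (e_ m) t x t / N m) ^+ 2 + (mean_im u (e_ m) t x t / N m) ^+ 2) ^+ 2
    * ((4 * pi) ^+ 2 * (e_ m ^+ 2 + (t - s) ^+ 2)) ^+ n @[m --> \oo] -->
    (a t x ^+ 2 + b t x ^+ 2) ^+ 2 * ((4 * pi) ^+ 2 * (0 ^+ 2 + (t - s) ^+ 2)) ^+ n.
  apply: cvgM; first by apply: (sq); apply: cvgD; exact: sq.
  apply: (pw); apply: cvgM; first exact: cvg_cst.
  by apply: cvgD; [apply: (sq); exact: cvg_harmonic|exact: cvg_cst].
have E m : (mean_re u (e_ m) t x s ^+ 2 + mean_im u (e_ m) t x s ^+ 2) ^+ 2 =
    ((mean_re u (e_ m) t x t / N m) ^+ 2 + (mean_im u (e_ m) t x t / N m) ^+ 2) ^+ 2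
    * ((4 * pi) ^+ 2 * (e_ m ^+ 2 + (t - s) ^+ 2)) ^+ n.
  have := mean_conserved hu t x (e0 m) s t.
  move: (mean_re u _ _ _ s) (mean_im u _ _ _ s) (mean_re u _ _ _ t) (mean_im u _ _ _ t).
  move=> A B A' B'; have := e0 m; move: (e_ m) => e e_gt0.
  rewrite par_al_diag// /par_al.
  have dn0 := par_den_gt0 t e_gt0 s.
  have N2 : (Num.sqrt (4 * pi * e) ^+ n) ^+ 2 = (4 * pi * e) ^+ n.
    by rewrite exprAC sqr_sqrtr// !mulr_ge0 ?pi_ge0// ltW.
  have N0 : Num.sqrt (4 * pi * e) ^+ n != 0.
    by rewrite gt_eqF// exprn_gt0// sqrtr_gt0 !mulr_gt0// pi_gt0.
  exact: (gaussian_balance (lt0r_neq0 e_gt0) (lt0r_neq0 dn0) N0 N2).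
have L3 : (a t x ^+ 2 + b t x ^+ 2) ^+ 2 * ((4 * pi) ^+ 2 * (0 ^+ 2 + (t - s) ^+ 2)) ^+ n =
    ((\int[mu]_y osc_re y) ^+ 2 + (\int[mu]_y osc_im y) ^+ 2) ^+ 2.
  move: L1; under eq_fun do rewrite E; move=> L1.
  exact: (norm_cvg_unique L2 L1).
apply/eqP; rewrite -(@eqrXn2 _ 2)//; last 2 first.
- by rewrite mulr_ge0 ?exprn_ge0 ?addr_ge0 ?sqr_ge0// !mulr_ge0// pi_ge0.
- by rewrite addr_ge0 ?sqr_ge0.
rewrite -L3 (expr2 0) mulr0 add0r -[(t - s) ^+ 2]real_normK ?num_real//.
by rewrite -[(4 * pi) ^+ 2 * _]exprMn [X in X == _]exprMn exprAC mulrC.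
Qed.

End propagator.

(** * The propagator as a Fourier transform *)

Section rapid_decay.
Context {R : realType} {n : nat}.
Local Notation mR := (measurableTypeR R).
Local Notation T := (n.-tuple mR).
Local Notation mu := (@lebesgue_tuple R n).

(** Faster decay than any power of the weight, in the form suited to nonnegative
functions. *)
Definition rapid (f : T -> R) := forall m, exists C, forall y, f y <= C * decay y ^+ m.

(** The q-th power of decay^m is at most decay once m q >= 1. *)
Lemma rapid_all_Lp (f : T -> R) : measurable_fun [set: T] f -> (forall y, 0 <= f y) ->
  rapid f -> in_all_Lp mu f.
Proof.
move=> mf f0 rf; split => //.
  by have [C HC] := rf 0%N; exists C => y; rewrite (le_trans (HC y))// expr0 mulr1.
move=> q q0; pose m := (Num.bound q^-1).
have mq : 1 <= m%:R * q.
  by rewrite -ler_pdivrMr// div1r ltW// archi_boundP// invr_ge0 ltW.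
have [C HC] := rf m.
have C0 : 0 <= C.
  have y : T := [tuple 0 | i < n].
  have := le_trans (f0 y) (HC y); rewrite pmulr_lge0// exprn_gt0// decay_gt0//.
have key y : f y `^ q <= C `^ q * decay y.
  have d0 := decay_gt0 y.
  apply: (@le_trans _ _ ((C * decay y ^+ m) `^ q)).
    by apply: ge0_ler_powR; rewrite ?nnegrE ?(ltW q0)// mulr_ge0// exprn_ge0// ltW.
  rewrite powRM ?exprn_ge0 ?(ltW d0)//; apply: ler_wpM2l; first exact: powR_ge0.
  rewrite -powR_mulrn ?(ltW d0)// -powRrM -[leRHS]powRr1 ?(ltW d0)//.
  by apply: ger_powR => //; rewrite d0 decay_le1.
have i : mu.-integrable setT (fun y => (C `^ q * decay y)%:E).
  by apply: integrable_EFinZ; exact: integrable_decay.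
have mq' : measurable_fun [set: T] (fun y => f y `^ q).
  exact: (measurableT_comp (measurable_powR q) mf).
apply: (@le_lt_trans _ _ (\int[mu]_y (C `^ q * decay y)%:E)%E).
  apply: ge0_le_integral => //.
  - by move=> y _; rewrite lee_fin powR_ge0.
  - exact/measurable_EFinP.
  - by have /integrableP[] := i.
  - by move=> y _; rewrite lee_fin.
by rewrite -EFin_Rintegral// ltry.
Qed.

Lemma dist_to_sqr (x0 : 'rV[R]_n) (y : T) : dist_to x0 y ^+ 2 = dist2 [tuple x0 ord0 i | i < n] y.
Proof.
rewrite /dist_to /euclidean_norm sqr_sqrtr; last by apply: sumr_ge0 => i _; exact: sqr_ge0.
by apply: eq_bigr => i _; rewrite !mxE tnth_mktuple.
Qed.

Lemma rapid_moment (f : T -> R) (b : R) x0 : 0 < b -> (forall y, 0 <= f y) -> rapid f ->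
  rapid (fun y => dist_to x0 y `^ b * f y).
Proof.
move=> b0 f0 rf m; pose p := Num.bound (b / 2).
have bp : b / 2 <= p%:R by rewrite ltW// archi_boundP// divr_ge0// ltW.
pose K := \sum_(i < n) 2 * (1 + x0 ord0 i ^+ 2).
have [C HC] := rf (m + p)%N.
exists (K `^ (b / 2) * C) => y; have d0 := decay_gt0 y.
have h1 : dist_to x0 y `^ b * decay y ^+ p <= K `^ (b / 2).
  have -> : dist_to x0 y `^ b = (dist_to x0 y ^+ 2) `^ (b / 2).
    by rewrite -powR_mulrn ?dist_to_ge0// -powRrM; congr (_ `^ _); field.
  apply: (@le_trans _ _ ((dist_to x0 y ^+ 2) `^ (b / 2) * decay y `^ (b / 2))).
    rewrite ler_wpM2l ?powR_ge0// -powR_mulrn ?(ltW d0)//.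
    by apply: ger_powR => //; rewrite d0 decay_le1.
  rewrite -powRM ?sqr_ge0 ?(ltW d0)//; apply: ge0_ler_powR.
  - by rewrite divr_ge0// ltW.
  - by rewrite nnegrE mulr_ge0 ?sqr_ge0// ltW.
  - by rewrite nnegrE sumr_ge0// => i _; rewrite mulr_ge0// addr_ge0 ?sqr_ge0.
  rewrite dist_to_sqr; apply: (le_trans (dist2_decay _ _)).
  by apply: ler_sum => i _; rewrite tnth_mktuple.
apply: (@le_trans _ _ (dist_to x0 y `^ b * (C * decay y ^+ (m + p)))).
  by rewrite ler_wpM2l ?powR_ge0.
have C0 : 0 <= C * decay y ^+ m.
  have := le_trans (f0 y) (HC y); rewrite exprD mulrA pmulr_lge0// exprn_gt0//.
rewrite exprD [leLHS](_ : _ = (dist_to x0 y `^ b * decay y ^+ p) * (C * decay y ^+ m)); last by ring.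
by rewrite -[leRHS]mulrA; apply: ler_wpM2r.
Qed.

End rapid_decay.

Section phase_expansion.
Context {R : realType} {n : nat}.
Local Notation Rn := 'rV[R]_n.
Local Notation mR := (measurableTypeR R).
Local Notation T := (n.-tuple mR).
Local Notation mu := (@lebesgue_tuple R n).

Lemma dist2_dot (x y : T) : dist2 x y = dot y y - 2 * dot x y + dot x x.
Proof.
rewrite /dist2 /dot mulr_sumr -sumrB -big_split /=.
by apply: eq_bigr => i _; ring.
Qed.

Lemma ft_cos_norm (k : R) (f : T -> R) (x : T) : ft_cos `|k| f x = ft_cos k f x.
Proof.
apply: eq_Rintegral => y _; congr (_ * _).
by case: (ger0P k) => // _; rewrite mulNr cosN.
Qed.

Lemma ft_sin_norm (k : R) (f : T -> R) (x : T) : mu.-integrable setT (fun y => (f y)%:E) ->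
  ft_sin `|k| f x ^+ 2 = ft_sin k f x ^+ 2.
Proof.
move=> fi; case: (ger0P k) => // _; rewrite -[RHS]sqrrN; congr (_ ^+ 2).
rewrite -mulN1r -Rintegral_scale; last exact: integrable_ft_sin.
by apply: eq_Rintegral => y _; rewrite mulNr sinN; ring.
Qed.

Variables (u0 : Rn -> R[i]) (u : R -> Rn -> R[i]).
Hypothesis hu : free_schrodinger u0 u.

Definition amp s (y : T) : R := ComplexField.Normc.normc (u s (row_of y)).

Lemma amp_ge0 s y : 0 <= amp s y.
Proof. exact: normc_ge0. Qed.

Lemma amp_sqr s y : amp s y ^+ 2 = RE u [::] s y ^+ 2 + IM u [::] s y ^+ 2.
Proof. exact: normc_sqr. Qed.

Lemma rapid_amp s : rapid (amp s).
Proof.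
move=> m; have [_ /(_ `|s|) bd _ _] := hu.
have [C HC] := schwartz_bounded_decay bd m [::]; exists C => y.
by apply: (HC (u s) y); exists s => //=; rewrite in_itv /= -ler_norml.
Qed.

Lemma measurable_amp s : measurable_fun [set: T] (amp s).
Proof.
have -> : amp s = fun y => Num.sqrt (RE u [::] s y ^+ 2 + IM u [::] s y ^+ 2).
  by apply/funext => y; rewrite -amp_sqr sqrtr_sqr ger0_norm// amp_ge0.
apply: (measurableT_comp (@measurable_sqrt R)); apply: measurable_funD; apply: measurable_funX.
  exact: (measurable_RE hu).
exact: (measurable_IM hu).
Qed.

Lemma all_Lp_amp s : in_all_Lp mu (amp s).
Proof. by apply: rapid_all_Lp; [exact: measurable_amp|exact: amp_ge0|exact: rapid_amp]. Qed.

Lemma all_Lp_moment (b : R) x0 s : 0 < b -> in_all_Lp mu (fun y => dist_to x0 y `^ b * amp s y).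
Proof.
move=> b0; apply: rapid_all_Lp.
- apply: measurable_funM; last exact: measurable_amp.
  exact: (measurableT_comp (measurable_powR b) (measurable_dist_to x0)).
- by move=> y; rewrite mulr_ge0 ?powR_ge0 ?amp_ge0.
- by apply: rapid_moment => //; [exact: amp_ge0|exact: rapid_amp].
Qed.

Variables (t s : R).
Hypothesis ts : t != s.
Local Notation th y := ((t - s)^-1 * dot y y / 4).
Local Notation k := (2 * `|t - s|)^-1.

(** The parts of u(s,y) exp(i |y|^2 / (4 (t-s))). *)
Definition twist_re y := RE u [::] s y * cos (th y) - IM u [::] s y * sin (th y).
Definition twist_im y := RE u [::] s y * sin (th y) + IM u [::] s y * cos (th y).

Lemma twist_sqr y : twist_re y ^+ 2 + twist_im y ^+ 2 = amp s y ^+ 2.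
Proof.
rewrite amp_sqr /twist_re /twist_im; have := cos2Dsin2 (th y).
move: (cos _) (sin _) (RE _ _ _ _) (IM _ _ _ _) => c d a b cd.
rewrite [LHS](_ : _ = (a ^+ 2 + b ^+ 2) * (c ^+ 2 + d ^+ 2)); last by ring.
by rewrite cd mulr1.
Qed.

Lemma twist_le y : `|twist_re y| <= amp s y /\ `|twist_im y| <= amp s y.
Proof.
have a0 := amp_ge0 s y; have E := twist_sqr y.
split; rewrite -(@ler_pXn2r _ 2)// ?nnegrE// real_normK ?num_real// -E.
  by rewrite lerDl sqr_ge0.
by rewrite lerDr sqr_ge0.
Qed.

Lemma measurable_twist : measurable_fun [set: T] twist_re /\ measurable_fun [set: T] twist_im.
Proof.
have mth : measurable_fun [set: T] (fun y : T => th y).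
  apply: measurable_funM => //; apply: measurable_funM => //.
  apply: measurable_sum => i; apply: measurable_funM; exact: measurable_tnth.
have mc := measurableT_comp (@measurable_cos R) mth.
have ms := measurableT_comp (@measurable_sin R) mth.
have mr := measurable_RE hu [::] s; have mi := measurable_IM hu [::] s.
by split; [apply: measurable_funB|apply: measurable_funD]; exact: measurable_funM.
Qed.

Lemma integrable_twist : mu.-integrable setT (fun y => (twist_re y)%:E) /\
  mu.-integrable setT (fun y => (twist_im y)%:E).
Proof.
have [m1 m2] := measurable_twist; have [C HC] := rapid_amp s 1.
split; apply: (integrable_le_decay (M := C)) => // y;
  by apply: le_trans (HC y); have [] := twist_le y.
Qed.

(** Expand |x-y|^2 = |y|^2 - 2 x.y + |x|^2 in the phase.  The first term is the twist, the
middle one the Fourier kernel, and the last one a unimodular factor independent of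
y.  The factor 2 comes from separating the transforms of the two parts. *)
Lemma amp_le_ft x : (4 * pi * `|t - s|) ^+ n * amp t x ^+ 2 <=
  2 * (ft_cos k twist_re x ^+ 2 + ft_sin k twist_re x ^+ 2 +
       (ft_cos k twist_im x ^+ 2 + ft_sin k twist_im x ^+ 2)).
Proof.
have [i1 i2] := integrable_twist.
have -> : (2 * `|t - s|)^-1 = `|(2 * (t - s))^-1| by rewrite normfV normrM (@ger0_norm _ 2).
rewrite (ft_sin_norm _ _ i1) (ft_sin_norm _ _ i2) !ft_cos_norm amp_sqr (propagator_formula hu x ts).
set c := (2 * (t - s))^-1; pose f := (t - s)^-1 * dot x x / 4.
have phase y : (t - s)^-1 * dist2 x y / 4 = th y + f - c * dot x y.
  by rewrite dist2_dot /c /f; field; rewrite subr_eq0.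
have lin (p q : R) (g h : T -> R) : mu.-integrable setT (fun y => (g y)%:E) ->
    mu.-integrable setT (fun y => (h y)%:E) ->
    mu.-integrable setT (fun y => (p * g y + q * h y)%:E) /\
    \int[mu]_y (p * g y + q * h y) = p * \int[mu]_y g y + q * \int[mu]_y h y.
  move=> gi hi; split; first by apply: integrable_EFinD; exact: integrable_EFinZ.
  by rewrite Rintegral_add ?Rintegral_scale//; exact: integrable_EFinZ.
have ic1 := integrable_ft_cos c i1 x; have ic2 := integrable_ft_cos c i2 x.
have is1 := integrable_ft_sin c i1 x; have is2 := integrable_ft_sin c i2 x.
have [jA EA] := lin 1 1 _ _ ic1 is2; have [jB EB] := lin 1 (-1) _ _ ic2 is1.
have [_ E1] := lin (cos f) (- sin f) _ _ jA jB; have [_ E2] := lin (sin f) (cos f) _ _ jA jB.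
have oscA : \int[mu]_y osc_re u t s x y = cos f * (ft_cos c twist_re x + ft_sin c twist_im x) -
    sin f * (ft_cos c twist_im x - ft_sin c twist_re x).
  rewrite -[ft_cos c twist_re x]mul1r -[ft_sin c twist_im x]mul1r -[ft_cos c twist_im x]mul1r.
  rewrite -[X in _ - _ * (_ + X)]mulN1r -EA -EB -mulNr -E1; apply: eq_Rintegral => y _.
  rewrite /osc_re phase cosB sinB !cosD !sinD /twist_re /twist_im.
  by ring.
have oscB : \int[mu]_y osc_im u t s x y = sin f * (ft_cos c twist_re x + ft_sin c twist_im x) +
    cos f * (ft_cos c twist_im x - ft_sin c twist_re x).
  rewrite -[ft_cos c twist_re x]mul1r -[ft_sin c twist_im x]mul1r -[ft_cos c twist_im x]mul1r.
  rewrite -[X in _ + _ * (_ + X)]mulN1r -EA -EB -E2; apply: eq_Rintegral => y _.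
  rewrite /osc_im phase cosB sinB !cosD !sinD /twist_re /twist_im.
  by ring.
rewrite oscA oscB; have := cos2Dsin2 f.
move: (cos f) (sin f) (ft_cos c _ x) (ft_sin c _ x) (ft_cos c _ x) (ft_sin c _ x).
move=> p q C D A B pq.
rewrite [leLHS](_ : _ = (p ^+ 2 + q ^+ 2) * ((A + B) ^+ 2 + (C - D) ^+ 2)); last by ring.
rewrite pq mul1r -subr_ge0 [leRHS](_ : _ = (A - B) ^+ 2 + (C + D) ^+ 2); last by ring.
by rewrite addr_ge0 ?sqr_ge0.
Qed.

End phase_expansion.

(** * Dispersive estimates *)

Section hausdorff_young.
Context {R : realType} {n : nat}.
Local Notation mR := (measurableTypeR R).
Local Notation T := (n.-tuple mR).
Local Notation mu := (@lebesgue_tuple R n).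

Lemma powRD_le (p a b : R) : 0 <= p -> 0 <= a -> 0 <= b ->
  (a + b) `^ p <= 2 `^ p * (a `^ p + b `^ p).
Proof.
move=> p0; have main (x y : R) : 0 <= x -> x <= y -> (x + y) `^ p <= 2 `^ p * (x `^ p + y `^ p).
  move=> x0 xy; have y0 := le_trans x0 xy.
  apply: (@le_trans _ _ ((2 * y) `^ p)).
    by apply: ge0_ler_powR; rewrite ?nnegrE ?addr_ge0 ?mulr_ge0//; lra.
  by rewrite powRM// ler_wpM2l ?powR_ge0// lerDr powR_ge0.
move=> a0 b0; have [ab|/ltW ba] := leP a b; first exact: main.
by rewrite addrC [X in _ * X]addrC; exact: main.
Qed.

Variables (kk : R) (f : T -> R).
Hypothesis k0 : 0 < kk.
Hypothesis fi : mu.-integrable setT (fun y => (f y)%:E).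
Local Notation D := ((2 * pi / kk) ^+ n).

Lemma ft_sqr_le : (\int[mu]_x (ft_cos kk f x ^+ 2)%:E <= D%:E * \int[mu]_y (f y ^+ 2)%:E)%E /\
  (\int[mu]_x (ft_sin kk f x ^+ 2)%:E <= D%:E * \int[mu]_y (f y ^+ 2)%:E)%E.
Proof.
have mc := measurable_ft_cos kk fi; have ms := measurable_ft_sin kk fi.
split; apply: le_trans (plancherel_le k0 fi); apply: ge0_le_integral => //.
- by move=> x _; rewrite lee_fin sqr_ge0.
- by apply/measurable_EFinP; exact: measurable_funX.
- by apply/measurable_EFinP; apply: measurable_funD; exact: measurable_funX.
- by move=> x _; rewrite lee_fin lerDl sqr_ge0.
- by move=> x _; rewrite lee_fin sqr_ge0.
- by apply/measurable_EFinP; exact: measurable_funX.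
- by apply/measurable_EFinP; apply: measurable_funD; exact: measurable_funX.
- by move=> x _; rewrite lee_fin lerDr sqr_ge0.
Qed.

End hausdorff_young.

Section hausdorff_young_power.
Context {R : realType} {n : nat}.
Local Notation mR := (measurableTypeR R).
Local Notation T := (n.-tuple mR).
Local Notation mu := (@lebesgue_tuple R n).
Variables (kk : R) (f : T -> R) (q r N : R).
Hypothesis k0 : 0 < kk.
Hypothesis fi : mu.-integrable setT (fun y => (f y)%:E).
Hypothesis q12 : 1 < q < 2.
Hypothesis qr : (q - 1) * r = q.
Hypothesis N0 : 0 < N.
Hypothesis fN : (\int[mu]_y (`|f y| `^ q)%:E <= N%:E)%E.
Local Notation D := ((2 * pi / kk) ^+ n).

Lemma hausdorff_young :
  (\int[mu]_x (`|ft_cos kk f x| `^ r)%:E <= (4 * D * (2 * N) `^ (r - 2) * N)%:E)%E /\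
  (\int[mu]_x (`|ft_sin kk f x| `^ r)%:E <= (4 * D * (2 * N) `^ (r - 2) * N)%:E)%E.
Proof.
have D0 : 0 <= D by rewrite exprn_ge0// divr_ge0 ?mulr_ge0 ?pi_ge0// ltW.
split.
  apply: (@marcinkiewicz _ _ _ _ _ mu mu (fun p => cos (kk * dot p.1 p.2)) D
    _ _ _ D0 _ f q r N _ qr fi N0 fN).
  - exact: measurable_cos_dot_prod.
  - by move=> p; exact: norm_cos_le1.
  - by move=> g gi; exact: (measurable_ft_cos kk gi).
  - by move=> g gi; exact: (ft_sqr_le k0 gi).1.
  - exact: q12.
apply: (@marcinkiewicz _ _ _ _ _ mu mu (fun p => sin (kk * dot p.1 p.2)) D
  _ _ _ D0 _ f q r N _ qr fi N0 fN).
- exact: measurable_sin_dot_prod.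
- by move=> p; exact: norm_sin_le1.
- by move=> g gi; exact: (measurable_ft_sin kk gi).
- by move=> g gi; exact: (ft_sqr_le k0 gi).2.
- exact: q12.
Qed.

End hausdorff_young_power.

Section nonvanishing.
Context {R : realType} {n : nat}.
Local Notation Rn := 'rV[R]_n.
Local Notation mR := (measurableTypeR R).
Local Notation T := (n.-tuple mR).
Local Notation mu := (@lebesgue_tuple R n).

Lemma row_of_tuple (x : Rn) : row_of [tuple x ord0 i | i < n] = x.
Proof. by apply/rowP => i; rewrite mxE tnth_mktuple. Qed.

(** A continuous function that is not 0 at a point is not 0 on a box, which has positive
measure. *)
Lemma ae0_continuous (h : Rn -> R) : continuous h ->
  (\forall y \ae mu, h (row_of y) = 0) -> forall x, h x = 0.
Proof.
move=> ch [N [mN N0 sN]] x; apply/eqP; apply: contraT => hx0.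
have hx : 0 < `|h x| by rewrite normr_gt0.
move/cvgrPdist_lt : (ch x) => /(_ _ hx)/nbhs_normP[e /= e0 He].
pose A i : set mR := [set` `[x ord0 i - e / 2, x ord0 i + e / 2]].
have mA i : measurable (A i) by exact: measurable_itv.
have box : [set t : T | forall i, A i (tnth t i)] `<=` N.
  move=> t tA; apply: sN => /= ht0.
  have : `|x - row_of t| < e.
    apply: (@le_lt_trans _ _ (e / 2)); last by lra.
    apply: rV_norm_le => [|i]; first by lra.
    rewrite !mxE; have := tA i; rewrite /A /= in_itv /= => /andP[h1 h2].
    by rewrite ler_norml; apply/andP; split; lra.
  by move=> /He; rewrite /= ht0 subr0 ltxx.
have mbox : measurable [set t : T | forall i, A i (tnth t i)].
  rewrite (_ : mkset _ = \bigcap_(i in [set: 'I_n]) ((fun t : T => tnth t i) @^-1` A i)).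
    apply: fin_bigcap_measurable => // i _; rewrite -[X in measurable X]setTI.
    exact: measurable_tnth.
  by apply/seteqP; split => t /= tA i; [move=> _|]; apply: tA.
have : (mu [set t : T | forall i, A i (tnth t i)] <= mu N)%E by apply: le_measure; rewrite ?inE.
rewrite N0 lebesgue_tuple_box//; apply: contraTT => _; rewrite -ltNge.
have -> : (\prod_(i < n) lebesgue_measure (A i))%E = (\prod_(i < n) e)%:E.
  rewrite (big_morph EFin (@EFinM R) erefl); apply: eq_bigr => i _.
  rewrite /A lebesgue_measure_itv /= lte_fin ifT; last by lra.
  by rewrite -EFinB; congr EFin; lra.
by rewrite lte_fin prodr_gt0.
Qed.

Variables (u0 : Rn -> R[i]) (u : R -> Rn -> R[i]).
Hypothesis hu : free_schrodinger u0 u.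
Hypothesis u0_neq0 : u0 <> (fun=> 0).

(** If u(s) vanished, then so would the propagator integral that represents |u(0,x)|. *)
Lemma amp_neq0 s : ~ ((fun y => (amp u s y)%:E) = \0 %[ae mu]).
Proof.
move=> ae0; apply: u0_neq0.
have re0 x : re_part (u s) x = 0.
  apply: ae0_continuous x => [x|].
    exact/differentiable_continuous/(differentiable_re hu [::] s x).
  apply: filterS ae0 => y /(_ I) aE; have a0 : amp u s y = 0 by case: aE.
  apply/eqP.
  by rewrite -normr_le0 -a0; exact: normc_Re_le.
have im0 x : im_part (u s) x = 0.
  apply: ae0_continuous x => [x|].
    exact/differentiable_continuous/(differentiable_im hu [::] s x).
  apply: filterS ae0 => y /(_ I) aE; have a0 : amp u s y = 0 by case: aE.
  apply/eqP.
  by rewrite -normr_le0 -a0; exact: normc_Im_le.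
have zero : forall x, complex.Re (u0 x) = 0 /\ complex.Im (u0 x) = 0.
  have [E _ _ _] := hu.
  move=> x; have [s0|s0] := eqVneq s 0.
    by rewrite s0 in re0 im0; rewrite -E; split; [exact: re0|exact: im0].
  have h0s : 0 != s by rewrite eq_sym.
  have RE0 y : RE u [::] s y = 0 by exact: re0.
  have IM0 y : IM u [::] s y = 0 by exact: im0.
  have := propagator_formula hu [tuple x ord0 i | i < n] h0s.
  have -> : \int[mu]_y osc_re u 0 s [tuple x ord0 i | i < n] y = 0.
    rewrite /Rintegral integral0_eq// => y _.
    by rewrite /osc_re RE0 IM0 !mul0r subr0.
  have -> : \int[mu]_y osc_im u 0 s [tuple x ord0 i | i < n] y = 0.
    rewrite /Rintegral integral0_eq// => y _.
    by rewrite /osc_im RE0 IM0 !mul0r addr0.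
  rewrite (expr2 0) mulr0 addr0 => /eqP; rewrite mulf_eq0 expf_eq0 => /orP[/andP[_]|].
    by rewrite !mulf_eq0 (gt_eqF (pi_gt0 R)) normr_eq0 subr_eq0 (negbTE h0s) orbF pnatr_eq0.
  rewrite paddr_eq0 ?sqr_ge0// !sqrf_eq0 /RE /IM /= E row_of_tuple /re_part /im_part.
  by move=> /andP[/eqP r0 /eqP i0].
apply/funext => x; have [r0 i0] := zero x.
by apply/eqP; rewrite eq_complex r0 i0 /= !eqxx.
Qed.

End nonvanishing.

Section dispersive_powers.
Context {R : realType} {n : nat}.
Local Notation Rn := 'rV[R]_n.
Local Notation mR := (measurableTypeR R).
Local Notation T := (n.-tuple mR).
Local Notation mu := (@lebesgue_tuple R n).
Let muT := @lebesgue_tuple_setT_gt0 R n.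

Lemma all_Lp_sup_le (g : T -> R) B : in_all_Lp mu g -> (forall t, g t <= B) -> fLnorm mu +oo%E g <= B.
Proof.
move=> gg gB; have [mg g0 _ _] := gg.
rewrite -lee_fin -(all_Lp_Lnorm muT gg)// unlock /Lnorm muT; apply/ess_supP; apply: nearW => t /=.
by rewrite ger0_norm// lee_fin.
Qed.

Variables (u0 : Rn -> R[i]) (u : R -> Rn -> R[i]).
Hypothesis hu : free_schrodinger u0 u.
Variables (t s : R).
Hypothesis ts : t != s.
Local Notation F q := (fLnorm mu q (amp u s)).
Local Notation G r := (fLnorm mu r (amp u t)).
Local Notation D := ((4 * pi * `|t - s|) ^+ n).
Local Notation kk := ((2 * `|t - s|)^-1).
Local Notation f1 := (twist_re u t s).
Local Notation f2 := (twist_im u t s).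

Let nts : 0 < `|t - s|. Proof. by rewrite normr_gt0 subr_eq0. Qed.

Let k0 : 0 < kk. Proof. by rewrite invr_gt0 mulr_gt0. Qed.

Let DE : (2 * pi / kk) ^+ n = D.
Proof. by congr (_ ^+ n); rewrite invrK; ring. Qed.

Let D0 : 0 < D. Proof. by rewrite exprn_gt0// !mulr_gt0// pi_gt0. Qed.

Let gs := all_Lp_amp hu s.
Let gt := all_Lp_amp hu t.
Let i1 := (integrable_twist hu t s).1.
Let i2 := (integrable_twist hu t s).2.

(** A Fourier transform is bounded by the L^1 norm. *)
Lemma dispersive_1 : D * G +oo%E ^+ 2 <= 8 * F 1%:E ^+ 2.
Proof.
have F0 : 0 <= F 1%:E := fLnorm_ge0 _ _ _.
have ia : mu.-integrable setT (fun y => (amp u s y)%:E).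
  have [C HC] := rapid_amp hu s 1; apply: (integrable_le_decay (M := C)).
    exact: measurable_amp hu s.
  by move=> y; rewrite ger0_norm ?amp_ge0.
have FE : \int[mu]_y amp u s y = F 1%:E.
  have := all_Lp_integral muT gs ltr01; rewrite powRr1//.
  by under eq_integral do rewrite powRr1 ?amp_ge0//; rewrite /Rintegral => ->.
have N1 (f : T -> R) : mu.-integrable setT (fun y => (f y)%:E) -> (forall y, `|f y| <= amp u s y) ->
    \int[mu]_y `|f y| <= F 1%:E.
  move=> fi fa; rewrite -FE; apply: ler_Rintegral => //.
  exact: integrable_EFin_norm.
have h1 := N1 _ i1 (fun y => (twist_le u t s y).1).
have h2 := N1 _ i2 (fun y => (twist_le u t s y).2).
have sq (v : R) : `|v| <= F 1%:E -> v ^+ 2 <= F 1%:E ^+ 2.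
  by move=> vF; rewrite -real_normK ?num_real//; apply: lerXn2r; rewrite ?nnegrE.
have pt x : amp u t x <= Num.sqrt (8 * F 1%:E ^+ 2 / D).
  rewrite -[leLHS](ger0_norm (amp_ge0 _ _ _)) -sqrtr_sqr ler_wsqrtr// ler_pdivlMr// mulrC.
  apply: (le_trans (amp_le_ft hu ts x)).
  have a1 := sq _ (le_trans (norm_ft_cos_le kk i1 x) h1).
  have a2 := sq _ (le_trans (norm_ft_sin_le kk i1 x) h1).
  have a3 := sq _ (le_trans (norm_ft_cos_le kk i2 x) h2).
  have a4 := sq _ (le_trans (norm_ft_sin_le kk i2 x) h2).
  by lra.
have := all_Lp_sup_le gt pt => h.
rewrite mulrC -ler_pdivlMr// -[leRHS]sqr_sqrtr; last first.
  by rewrite divr_ge0 ?(ltW D0)// mulr_ge0 ?sqr_ge0.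
by apply: lerXn2r; rewrite ?nnegrE ?fLnorm_ge0 ?sqrtr_ge0.
Qed.

Let mc1 : measurable_fun [set: T] (ft_cos kk f1) := measurable_ft_cos kk i1.
Let ms1 : measurable_fun [set: T] (ft_sin kk f1) := measurable_ft_sin kk i1.
Let mc2 : measurable_fun [set: T] (ft_cos kk f2) := measurable_ft_cos kk i2.
Let ms2 : measurable_fun [set: T] (ft_sin kk f2) := measurable_ft_sin kk i2.

Let integral_amp (r w : R) : 0 < r ->
  (\int[mu]_y (amp u w y `^ r)%:E = (fLnorm mu r%:E (amp u w) `^ r)%:E)%E.
Proof. by move=> r0; exact: (all_Lp_integral muT (all_Lp_amp hu w) r0). Qed.

(** The frequency 1/(2|t-s|) makes the Plancherel constant equal to (4 pi |t-s|)^n, which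
cancels the normalization of the propagator. *)
Lemma dispersive_2 : G 2%:E ^+ 2 <= 2 * F 2%:E ^+ 2.
Proof.
have i2E w : (\int[mu]_y (amp u w y ^+ 2)%:E = (fLnorm mu 2%:E (amp u w) ^+ 2)%:E)%E.
  rewrite -powR_mulrn ?fLnorm_ge0// -(integral_amp w (ltr0Sn R 1)).
  by apply: eq_integral => y _; rewrite -powR_mulrn ?amp_ge0.
have mF (f g : T -> R) : measurable_fun [set: T] f -> measurable_fun [set: T] g ->
    measurable_fun [set: T] (fun x => (f x ^+ 2 + g x ^+ 2)%:E).
  by move=> mf mg; apply/measurable_EFinP; apply: measurable_funD; exact: measurable_funX.
have p1 := plancherel_le k0 i1; have p2 := plancherel_le k0 i2.
rewrite DE in p1 p2.
rewrite -(ler_pM2l D0) -lee_fin EFinM -i2E -(ge0_integralZl _ measurableT); last 3 first.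
- by apply/measurable_EFinP; apply: measurable_funX; exact: (measurable_amp hu t).
- by move=> y _; rewrite lee_fin sqr_ge0.
- by rewrite lee_fin ltW.
apply: (@le_trans _ _ (\int[mu]_x (2%:E * ((ft_cos kk f1 x ^+ 2 + ft_sin kk f1 x ^+ 2)%:E +
    (ft_cos kk f2 x ^+ 2 + ft_sin kk f2 x ^+ 2)%:E)))%E).
  apply: ge0_le_integral => //.
  - by move=> x _; rewrite -EFinM lee_fin mulr_ge0 ?sqr_ge0// ltW.
  - apply/measurable_EFinP; apply: measurable_funM => //; apply: measurable_funX.
    exact: (measurable_amp hu t).
  - by apply: emeasurable_funM => //; apply: emeasurable_funD; exact: mF.
  - by move=> x _; rewrite -EFinM -EFinD -EFinM lee_fin; exact: (amp_le_ft hu ts).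
rewrite ge0_integralZl//; last 2 first.
- by apply: emeasurable_funD; exact: mF.
- by move=> x _; rewrite -EFinD lee_fin !addr_ge0 ?sqr_ge0.
rewrite (ge0_integralD _ measurableT); last 4 first.
- by move=> x _; rewrite lee_fin addr_ge0 ?sqr_ge0.
- exact: mF.
- by move=> x _; rewrite lee_fin addr_ge0 ?sqr_ge0.
- exact: mF.
have [mf1 mf2] := measurable_twist hu t s.
have -> : (D * (2 * F 2%:E ^+ 2))%:E =
    (2%:E * (D%:E * \int[mu]_y (f1 y ^+ 2)%:E + D%:E * \int[mu]_y (f2 y ^+ 2)%:E))%E.
  rewrite -ge0_muleDr ?integral_ge0//; last 2 first.
  - by move=> x _; rewrite lee_fin sqr_ge0.
  - by move=> x _; rewrite lee_fin sqr_ge0.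
  rewrite -(ge0_integralD _ measurableT); last 4 first.
  - by move=> x _; rewrite lee_fin sqr_ge0.
  - by apply/measurable_EFinP; exact: measurable_funX.
  - by move=> x _; rewrite lee_fin sqr_ge0.
  - by apply/measurable_EFinP; exact: measurable_funX.
  under eq_integral do rewrite -EFinD twist_sqr.
  by rewrite i2E -!EFinM; congr EFin; ring.
by apply: lee_wpmul2l => //; exact: leeD.
Qed.

(** The interpolated inequality is applied to each of the four cosine and sine
transforms. *)
Lemma dispersive_r (q r : R) : 1 < q < 2 -> (q - 1) * r = q -> 0 < F q%:E ->
  G r%:E `^ r <= (2 / D) `^ (r / 2) * (2 `^ (r / 2) * 2 `^ (r / 2)) *
    (4 * (4 * D * (2 * F q%:E `^ q) `^ (r - 2) * F q%:E `^ q)).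
Proof.
move=> q12 qr F0; have /andP[q1 q2] := q12.
have r2 : 2 < r by nra.
have r0 : 0 < r by lra.
have q0 : 0 < q by lra.
have rp : 0 <= r / 2 by lra.
set N := F q%:E `^ q; have N0 : 0 < N by exact: powR_gt0.
set K := (2 / D) `^ _ * _; set B := 4 * D * _ * N.
have K0 : 0 <= K by rewrite !mulr_ge0 ?powR_ge0.
have fN (f : T -> R) : measurable_fun [set: T] f -> (forall y, `|f y| <= amp u s y) ->
    (\int[mu]_y (`|f y| `^ q)%:E <= N%:E)%E.
  move=> mf fa; rewrite -(integral_amp s q0); apply: ge0_le_integral.
  - exact: measurableT.
  - by move=> y _; rewrite lee_fin powR_ge0.
  - apply/measurable_EFinP; apply: (measurableT_comp (measurable_powR q)).
    exact: measurableT_comp.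
  - apply/measurable_EFinP; apply: (measurableT_comp (measurable_powR q)).
    exact: (measurable_amp hu s).
  - move=> y _; rewrite lee_fin; apply: ge0_ler_powR; rewrite ?nnegrE ?amp_ge0 ?(ltW q0)//.
have [mf1 mf2] := measurable_twist hu t s.
have h1 := fN _ mf1 (fun y => (twist_le u t s y).1).
have h2 := fN _ mf2 (fun y => (twist_le u t s y).2).
have [c1 s1] := hausdorff_young k0 i1 q12 qr N0 h1.
have [c2 s2] := hausdorff_young k0 i2 q12 qr N0 h2.
rewrite DE -/B in c1 s1 c2 s2.
have sqp (v : R) : (v ^+ 2) `^ (r / 2) = `|v| `^ r.
  rewrite -real_normK ?num_real// -powR_mulrn// -powRrM.
  by congr (_ `^ _); field.
have pt x : amp u t x `^ r <= K * (`|ft_cos kk f1 x| `^ r + `|ft_sin kk f1 x| `^ r +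
    (`|ft_cos kk f2 x| `^ r + `|ft_sin kk f2 x| `^ r)).
  rewrite -[in leLHS](ger0_norm (amp_ge0 _ _ _)) -!sqp.
  have := amp_le_ft hu ts x.
  move: (ft_cos _ _ _) (ft_sin _ _ _) (ft_cos _ _ _) (ft_sin _ _ _) => c d a b h.
  apply: (@le_trans _ _ ((2 / D * (a ^+ 2 + b ^+ 2 + (c ^+ 2 + d ^+ 2))) `^ (r / 2))).
    apply: ge0_ler_powR => //; rewrite ?nnegrE ?sqr_ge0//.
      by rewrite mulr_ge0 ?divr_ge0 ?(ltW D0)// !addr_ge0 ?sqr_ge0.
    by rewrite mulrAC ler_pdivlMr// mulrC.
  rewrite powRM ?divr_ge0 ?(ltW D0)//; last by rewrite !addr_ge0 ?sqr_ge0.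
  rewrite /K -[leRHS]mulrA; apply: ler_wpM2l; first exact: powR_ge0.
  apply: (le_trans (powRD_le rp _ _)); rewrite ?addr_ge0 ?sqr_ge0//.
  rewrite -[leRHS]mulrA; apply: ler_wpM2l; first exact: powR_ge0.
  by rewrite mulrDr; apply: lerD; apply: powRD_le; rewrite ?sqr_ge0.
have mp (f : T -> R) : measurable_fun [set: T] f ->
    measurable_fun [set: T] (fun x => (`|f x| `^ r)%:E).
  move=> mf; apply/measurable_EFinP; apply: (measurableT_comp (measurable_powR r)).
  exact: measurableT_comp.
have p0 (f : T -> R) x : (0 <= (`|f x| `^ r)%:E)%E by rewrite lee_fin powR_ge0.
rewrite -lee_fin -(integral_amp t r0).
apply: (@le_trans _ _ (\int[mu]_x (K%:E * (((`|ft_cos kk f1 x| `^ r)%:E + (`|ft_sin kk f1 x| `^ r)%:E) +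
    ((`|ft_cos kk f2 x| `^ r)%:E + (`|ft_sin kk f2 x| `^ r)%:E))))%E).
  apply: ge0_le_integral.
  - exact: measurableT.
  - by move=> x _; rewrite lee_fin powR_ge0.
  - apply/measurable_EFinP; apply: (measurableT_comp (measurable_powR r)).
    exact: (measurable_amp hu t).
  - by apply: emeasurable_funM => //; do !apply: emeasurable_funD; exact: mp.
  - by move=> x _; rewrite -!EFinD -EFinM lee_fin.
rewrite ge0_integralZl//; last 2 first.
- by do !apply: emeasurable_funD; exact: mp.
- by move=> x _; rewrite !adde_ge0.
have add (g h : T -> \bar R) : (forall x, 0 <= g x)%E -> (forall x, 0 <= h x)%E ->
    measurable_fun [set: T] g -> measurable_fun [set: T] h ->
    (\int[mu]_x (g x + h x) = \int[mu]_x g x + \int[mu]_x h x)%E.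
  by move=> g0 h0 mg mh; rewrite ge0_integralD.
have pa (f g : T -> R) x : (0 <= (`|f x| `^ r)%:E + (`|g x| `^ r)%:E)%E by rewrite adde_ge0.
have ma (f g : T -> R) : measurable_fun [set: T] f -> measurable_fun [set: T] g ->
    measurable_fun [set: T] (fun x => (`|f x| `^ r)%:E + (`|g x| `^ r)%:E)%E.
  by move=> mf mg; apply: emeasurable_funD; exact: mp.
rewrite (add _ _ (pa _ _) (pa _ _) (ma _ _ mc1 ms1) (ma _ _ mc2 ms2)).
have addp (f g : T -> R) : measurable_fun [set: T] f -> measurable_fun [set: T] g ->
    (\int[mu]_x (`|f x| `^ r)%:E <= B%:E)%E -> (\int[mu]_x (`|g x| `^ r)%:E <= B%:E)%E ->
    (\int[mu]_x ((`|f x| `^ r)%:E + (`|g x| `^ r)%:E) <= B%:E + B%:E)%E.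
  move=> mf mg fB gB; rewrite (add _ _ (p0 f) (p0 g) (mp f mf) (mp g mg)).
  exact: (leeD fB gB).
rewrite [leRHS]EFinM; apply: lee_wpmul2l; first by rewrite lee_fin.
rewrite (_ : (4 * B)%:E = ((B%:E + B%:E) + (B%:E + B%:E))%E); last first.
  by rewrite -!EFinD; congr EFin; ring.
apply: leeD.
  exact: (addp _ _ mc1 ms1 c1 s1).
exact: (addp _ _ mc2 ms2 c2 s2).
Qed.

End dispersive_powers.

Section dispersive.
Context {R : realType} {n : nat}.
Local Notation Rn := 'rV[R]_n.
Local Notation mR := (measurableTypeR R).
Local Notation T := (n.-tuple mR).
Local Notation mu := (@lebesgue_tuple R n).
Let muT := @lebesgue_tuple_setT_gt0 R n.

Lemma ln_le (a b : R) : 0 < a -> a <= b -> ln a <= ln b.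
Proof. by move=> a0 ab; rewrite ler_ln ?posrE// (lt_le_trans a0). Qed.

Lemma lnMp (a b : R) : 0 < a -> 0 < b -> ln (a * b) = ln a + ln b.
Proof. by move=> a0 b0; rewrite lnM ?posrE. Qed.

Lemma lnXp (a : R) m : 0 < a -> ln (a ^+ m) = m%:R * ln a.
Proof. by move=> a0; rewrite lnXn// mulr_natl. Qed.

Lemma fLnorm_amp_gt0 (u0 : Rn -> R[i]) (u : R -> Rn -> R[i]) (w : R) (p : \bar R) :
  free_schrodinger u0 u -> u0 <> (fun=> 0) -> (0 < p)%E -> 0 < fLnorm mu p (amp u w).
Proof.
move=> hu u0n p0; apply: (all_Lp_fLnorm_gt0 muT (all_Lp_amp hu w)) => //.
exact: (amp_neq0 hu u0n).
Qed.

(** The constant depends on q and n only, and t and s may be exchanged, so the estimate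
bounds the solution at either time by the solution at the other one. *)
Lemma dispersive (q : R) (r : \bar R) : 1 <= q <= 2 -> (0 < r)%E -> recip r = 1 - q^-1 ->
  exists c : R, forall (u0 : Rn -> R[i]) (u : R -> Rn -> R[i]),
    free_schrodinger u0 u -> u0 <> (fun=> 0) -> forall t s, t != s ->
    ln (fLnorm mu r (amp u t)) <=
      c - (q^-1 - 2^-1) * (n%:R * ln `|t - s|) + ln (fLnorm mu q%:E (amp u s)).
Proof.
move=> /andP[q1 q2] r0 rq.
have q0 : 0 < q by lra.
have pi4 : 0 < 4 * pi :> R by rewrite mulr_gt0// pi_gt0.
have lnD (h : R) : 0 < h -> ln ((4 * pi * h) ^+ n) = n%:R * ln (4 * pi) + n%:R * ln h.
  by move=> h0; rewrite lnXp ?(mulr_gt0 pi4 h0)// lnMp// mulrDr.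
have [q1E|q1n] := eqVneq q 1.
  have -> : r = +oo%E by apply: recip_inj; rewrite ?ltry// recipy rq q1E invr1 subrr.
  exists ((ln 8 - n%:R * ln (4 * pi)) / 2) => u0 u hu u0n t s ts.
  have h0 : 0 < `|t - s| by rewrite normr_gt0 subr_eq0.
  have G0 := fLnorm_amp_gt0 t hu u0n (ltry (0 : R) : (0 < +oo%E :> \bar R)%E); have F0 := fLnorm_amp_gt0 s hu u0n (lte01 : (0 < 1%:E :> \bar R)%E).
  have D0 : 0 < (4 * pi * `|t - s|) ^+ n by rewrite exprn_gt0// !mulr_gt0 ?pi_gt0.
  have := ln_le (mulr_gt0 D0 (exprn_gt0 2 G0)) (dispersive_1 hu ts).
  rewrite q1E invr1 (lnMp D0 (exprn_gt0 2 G0)) (lnMp _ (exprn_gt0 2 F0))//.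
  by rewrite lnD// !lnXp//; lra.
have [q2E|q2n] := eqVneq q 2.
  have -> : r = 2%:E.
    by apply: recip_inj => //; rewrite recip_EFin// rq q2E; field.
  have t0e2 : (0 < 2%:E :> \bar R)%E by rewrite lte_fin.
  exists (ln 2 / 2) => u0 u hu u0n t s ts.
  have G0 := fLnorm_amp_gt0 t hu u0n t0e2.
  have F0 := fLnorm_amp_gt0 s hu u0n t0e2.
  have := ln_le (exprn_gt0 2 G0) (dispersive_2 hu ts).
  by rewrite q2E subrr mul0r subr0 (lnMp _ (exprn_gt0 2 F0))// !lnXp//; lra.
have q12 : 1 < q < 2 by rewrite !lt_neqAle q1 q2 eq_sym q1n q2n.
have /andP[q1' q2'] := q12.
pose p := q / (q - 1); have p0 : 0 < p by rewrite divr_gt0 ?subr_gt0.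
have -> : r = p%:E.
  apply: recip_inj => //.
  by rewrite recip_EFin// rq /p invf_div; field; rewrite gt_eqF.
have qp : (q - 1) * p = q by rewrite /p; field; rewrite subr_eq0.
pose L : R := n%:R * ln (4 * pi).
exists ((p / 2 * (ln 2 - L) + p * ln 2 + 2 * ln 4 + L + (p - 2) * ln 2) / p) => u0 u hu u0n t s ts.
have h0 : 0 < `|t - s| by rewrite normr_gt0 subr_eq0.
have p0e : (0 < p%:E)%E by rewrite lte_fin.
have q0e : (0 < q%:E)%E by rewrite lte_fin.
have G0 := fLnorm_amp_gt0 t hu u0n p0e; have F0 := fLnorm_amp_gt0 s hu u0n q0e.
have D0 : 0 < (4 * pi * `|t - s|) ^+ n by rewrite exprn_gt0// !mulr_gt0 ?pi_gt0.
have Fq : 0 < fLnorm mu q%:E (amp u s) `^ q by exact: powR_gt0.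
have := ln_le (powR_gt0 p G0) (dispersive_r hu ts q12 qp F0).
have D2 := divr_gt0 (ltr0Sn R 1) D0; have p2 := powR_gt0 (p / 2) (ltr0Sn R 1).
have F2 := mulr_gt0 (ltr0Sn R 1) Fq.
have P1 := powR_gt0 (p / 2) D2; have P2 := mulr_gt0 p2 p2.
have P3 := powR_gt0 (p - 2) F2; have P4 := mulr_gt0 (ltr0Sn R 3) D0.
have P5 := mulr_gt0 P4 P3; have P6 := mulr_gt0 P5 Fq; have P7 := mulr_gt0 (ltr0Sn R 3) P6.
rewrite (lnMp (mulr_gt0 P1 P2) P7) (lnMp P1 P2) (lnMp p2 p2) (lnMp _ P6)// (lnMp P5 Fq).
rewrite (lnMp P4 P3) (lnMp _ D0)// !ln_powR (lnMp _ Fq)// ln_powR.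
rewrite (lnMp _ (_ : 0 < _^-1)) ?invr_gt0// lnV ?posrE// lnD// => h.
rewrite -(ler_pM2l p0); apply: (le_trans h).
move: (ln (fLnorm mu q%:E _)) (ln `|_|) => Y Z.
have -> : q^-1 = 1 - p^-1 by rewrite /p; field; rewrite (gt_eqF q0) subr_eq0 (gt_eqF q1').
rewrite -/L [leRHS](_ : _ = p / 2 * (ln 2 - L) + p * ln 2 + 2 * ln 4 + L + (p - 2) * ln 2
  - (p / 2 - 1) * (n%:R * Z) + p * Y); last by field; rewrite gt_eqF.
have -> : p * Y = (p - 1) * q * Y by congr (_ * _); clear -qp; lra.
by clear; lra.
Qed.

End dispersive.

(** * The uncertainty inequality *)

Section exponents.
Context {R : realType}.

(** Here w is the reciprocal of one critical exponent and v that of the other k.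
If w > 1 then q = 1 will do; otherwise 1/q is chosen strictly between max(1/2, 1 - v)
and w. *)
Lemma exists_dual_exponent (w v : R) : 2^-1 < w -> 0 <= v -> (w <= 1 -> 1 - w < v) ->
  exists q (r : \bar R), [/\ 1 <= q <= 2, 2^-1 < q^-1, q^-1 < w, (0 < r)%E & recip r = 1 - q^-1] /\
    1 - q^-1 <= v.
Proof.
move=> w2 v0 wv.
suff [h [h2 h1 hw hv]] : exists h : R, [/\ 2^-1 < h, h <= 1, h < w & 1 - h <= v].
  have h0 : 0 < h by lra.
  have [r [r0 rE]] : exists r : \bar R, (0 < r)%E /\ recip r = 1 - h.
    have [->|hn1] := eqVneq h 1; first by exists +oo%E; rewrite ltry recipy subrr.
    have h1' : 0 < 1 - h by rewrite subr_gt0 lt_neqAle hn1.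
    exists ((1 - h)^-1)%:E; rewrite lte_fin invr_gt0; split => //.
    by rewrite recip_EFin ?invr_gt0// invrK.
  exists h^-1, r; rewrite invrK; split => //; split => //; apply/andP; split.
    by rewrite invf_ge1.
  by rewrite -[leRHS]invrK lef_pV2 ?posrE ?invr_gt0// ltW.
have [w1|w1] := leP w 1; last by exists 1; split => //; lra.
have := wv w1; set m := Order.max 2^-1 (1 - v) => wv1.
have m1 : m < w by rewrite gt_max w2; lra.
have m2 : 2^-1 <= m by rewrite le_max lexx.
have m3 : 1 - v <= m by rewrite le_max lexx orbT.
by exists ((m + w) / 2); split; lra.
Qed.

Lemma lt_hoelder_conjugate (p : R) (k : \bar R) : 1 <= p -> (0 < k)%E ->
  (k < hoelder_conjugate p%:E)%E -> 1 - p^-1 < recip k.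
Proof.
move=> p1 /lt0e_cases[[r r0 ->]|->]; last by rewrite lt_neqAle leye_eq andbC; case: eqP => // ->; rewrite eqxx.
rewrite recip_EFin//; have [->|pn1] := eqVneq p 1.
  by rewrite invr1 subrr invr_gt0.
have p1' : 0 < p - 1 by rewrite subr_gt0 lt_neqAle eq_sym pn1.
have p0 : 0 < p by lra.
rewrite /hoelder_conjugate /= eqe (gt_eqF p0) -EFinB inver (gt_eqF p1') -EFinM lte_fin => h.
rewrite -(ltr_pM2l p0) mulrBr mulr1 divff ?gt_eqF// ltr_pdivlMr//.
by rewrite mulrC -ltr_pdivlMr.
Qed.

Lemma crit_expE n (a : \bar R) (b : R) : (0 < n)%N -> (0 < a)%E -> 0 < b ->
  crit_exp n a b = (recip a + b / n%:R)^-1 /\ 0 < recip a + b / n%:R.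
Proof.
move=> n0 a0 b0; have n0' : 0 < n%:R :> R by rewrite ltr0n.
have r0 := recip_ge0 a0.
have w0 : 0 < recip a + b / n%:R by rewrite ltr_wpDl// divr_gt0.
split => //; rewrite /crit_exp; have d0 : 0 < recip a * n%:R + b by rewrite ltr_wpDl// mulr_ge0.
have -> : recip a * n%:R + b = n%:R * (recip a + b / n%:R) by field; rewrite gt_eqF.
by rewrite invfM mulrA divff ?mul1r// gt_eqF.
Qed.

End exponents.

(** The four inequalities form a cycle: F1, F2, G1 and G2 cancel in their sum. *)
Lemma chain_bound {R : realFieldType} (h1 h2 L X Y F1 F2 G1 G2 cA cB cC cD : R) :
  0 < h1 + h2 - 1 ->
  F1 <= cA + (h1 - (1 - h2)) * X + F2 -> F2 <= cB - (h2 - 2^-1) * L + G1 ->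
  G1 <= cC + (h2 - (1 - h1)) * Y + G2 -> G2 <= cD - (h1 - 2^-1) * L + F1 ->
  L - (cA + cB + cC + cD) / (h1 + h2 - 1) <= X + Y.
Proof.
move=> e0 hA hB hC hD.
rewrite lerBlDr -lerBlDl ler_pdivlMr//; lra.
Qed.

Section uncertainty.
Context {R : realType} {n : nat}.
Local Notation Rn := 'rV[R]_n.
Local Notation mR := (measurableTypeR R).
Local Notation T := (n.-tuple mR).
Local Notation mu := (@lebesgue_tuple R n).
Local Notation moment b x0 g := (fun t => dist_to x0 t `^ b * g t).
Let muT := @lebesgue_tuple_setT_gt0 R n.

(** The cycle localization, dispersion, localization, dispersion, from time 0 to time t and
back. *)
Lemma ln_uncertainty (a1 a2 k1 k2 : \bar R) (b1 b2 : R) :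
  let w1 := recip a1 + b1 / n%:R in let w2 := recip a2 + b2 / n%:R in
  (0 < n)%N -> (0 < a1)%E -> (0 < a2)%E -> (0 < k1)%E -> (0 < k2)%E -> 0 < b1 -> 0 < b2 ->
  2^-1 < w1 -> 2^-1 < w2 -> recip k1 < w1 -> recip k2 < w2 ->
  (w2 <= 1 -> 1 - w2 < recip k1) -> (w1 <= 1 -> 1 - w1 < recip k2) ->
  exists C : R, forall (u0 : Rn -> R[i]) (u : R -> Rn -> R[i]),
    free_schrodinger u0 u -> u0 <> (fun=> 0) -> forall (t : R) x0 x1, t != 0 ->
    let A1 := fLnorm mu a1 (moment b1 x0 (amp u 0)) in
    let A2 := fLnorm mu a2 (moment b2 x1 (amp u t)) in
    [/\ 0 < A1, 0 < A2 &
      n%:R * ln `|t| - C <= (ln A1 - ln (fLnorm mu k1 (amp u 0))) / (w1 - recip k1) +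
        (ln A2 - ln (fLnorm mu k2 (amp u t))) / (w2 - recip k2)].
Proof.
move=> w1 w2 n0 a10 a20 k10 k20 b10 b20 w1h w2h kw1 kw2 c1 c2.
have [q1 [r1 [[q1b q1h q1w r10 r1E] q1v]]] := exists_dual_exponent w1h (recip_ge0 k20) c2.
have [q2 [r2 [[q2b q2h q2w r20 r2E] q2v]]] := exists_dual_exponent w2h (recip_ge0 k10) c1.
have q10 : 0 < q1 by case/andP: q1b => h _; exact: lt_le_trans ltr01 h.
have q20 : 0 < q2 by case/andP: q2b => h _; exact: lt_le_trans ltr01 h.
have s1 : recip r2 <= recip k1 by rewrite r2E.
have s1' : recip r2 < q1^-1 by rewrite r2E; clear -q1h q2h; lra.
have s2 : recip r1 <= recip k2 by rewrite r1E.
have s2' : recip r1 < q2^-1 by rewrite r1E; clear -q1h q2h; lra.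
have [CA HA] := ln_localization n0 q10 b10 a10 k10 r20 kw1 q1w s1 s1'.
have [CC HC] := ln_localization n0 q20 b20 a20 k20 r10 kw2 q2w s2 s2'.
have [CB HB] := @dispersive R n q2 r2 q2b r20 r2E.
have [CD HD] := @dispersive R n q1 r1 q1b r10 r1E.
have e0 : 0 < q1^-1 + q2^-1 - 1 by rewrite subr_gt0 (splitr 1) mul1r ltrD.
exists ((CA + CB + CC + CD) / (q1^-1 + q2^-1 - 1)) => u0 u hu u0n t x0 x1 t0 A1 A2.
have [A10 hA] := HA _ x0 (all_Lp_amp hu 0) (all_Lp_moment hu x0 0 b10) (amp_neq0 hu u0n (s := 0)).
have [A20 hC] := HC _ x1 (all_Lp_amp hu t) (all_Lp_moment hu x1 t b20) (amp_neq0 hu u0n (s := t)).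
split => //.
have t0' : 0 != t by rewrite eq_sym.
have hB := HB _ _ hu u0n _ _ t0'; have hD := HD _ _ hu u0n _ _ t0.
rewrite sub0r normrN in hB; rewrite subr0 in hD.
rewrite r2E in hA; rewrite r1E in hC.
exact: chain_bound e0 hA hB hC hD.
Qed.

End uncertainty.

Section Lp_norms.
Context {R : realType} {n : nat}.
Local Notation Rn := 'rV[R]_n.
Local Notation mR := (measurableTypeR R).
Local Notation mu := (@lebesgue_tuple R n).
Variables (u0 : Rn -> R[i]) (u : R -> Rn -> R[i]).
Hypothesis hu : free_schrodinger u0 u.

Lemma Lp_norm_amp (p : \bar R) s : (0 < p)%E -> Lp_norm p (u s) = (fLnorm mu p (amp u s))%:E.
Proof. exact: (all_Lp_Lnorm (@lebesgue_tuple_setT_gt0 R n) (all_Lp_amp hu s)). Qed.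

Lemma Lp_norm_weighted (p : \bar R) (b : R) x0 s : (0 < p)%E -> 0 < b ->
  Lp_norm p (weighted b x0 (u s)) = (fLnorm mu p (fun t => dist_to x0 t `^ b * amp u s t))%:E.
Proof.
move=> p0 b0.
rewrite -(all_Lp_Lnorm (@lebesgue_tuple_setT_gt0 R n) (all_Lp_moment hu x0 s b0) p0).
apply: eq_Lnorm => t; congr EFin.
by rewrite ComplexField.Normc.normcM normc_real ger0_norm ?powR_ge0.
Qed.

End Lp_norms.

Lemma le_powR_of_ln {R : realType} (c T A F B G d1 d2 e : R) :
  0 < T -> 0 < A -> 0 < F -> 0 < B -> 0 < G ->
  c + e * ln T <= d2 * (ln A - ln F) + d1 * (ln B - ln G) ->
  expR c * T `^ e <= (A / F) `^ d2 * (B / G) `^ d1.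
Proof.
move=> T0 A0 F0 B0 G0 h.
rewrite -ler_ln ?posrE ?mulr_gt0 ?expR_gt0 ?powR_gt0 ?divr_gt0//.
rewrite !lnM ?posrE ?expR_gt0 ?powR_gt0 ?divr_gt0// expRK !ln_powR.
by rewrite !ln_div ?posrE.
Qed.

Lemma ediv_EFin {R : realType} (x y : R) : 0 < y -> (x%:E / y%:E)%E = (x / y)%:E.
Proof. by move=> y0; rewrite inver gt_eqF. Qed.

Theorem theorem1p7 (R : realType) (n : nat) (n_gt0 : (0 < n)%N) :
  (forall (a1 a2 k1 k2 : \bar R) (b1 b2 : R),
    (0 < a1)%E -> (0 < a2)%E -> (0 < k1)%E -> (0 < k2)%E ->
    0 < b1 -> 0 < b2 ->
    ((crit_exp n a1 b1)%:E < Order.min 2%:E k1)%E ->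
    ((crit_exp n a2 b2)%:E < Order.min 2%:E k2)%E ->
    (1 <= crit_exp n a2 b2 ->
       (k1 < hoelder_conjugate (crit_exp n a2 b2)%:E)%E) ->
    (1 <= crit_exp n a1 b1 ->
       (k2 < hoelder_conjugate (crit_exp n a1 b1)%:E)%E) ->
    exists c : R, 0 < c /\
      forall (u0 : 'rV[R]_n -> R[i]) (u : R -> 'rV[R]_n -> R[i]),
        schwartz u0 -> u0 <> (fun=> 0) -> free_schrodinger u0 u ->
        forall (t : R) (x0 x1 : 'rV[R]_n), t != 0 ->
          ((c * `|t| `^ (n%:R * gap_exp n a1 b1 k1 * gap_exp n a2 b2 k2))%:E <=
           (Lp_norm a1 (weighted b1 x0 u0) / Lp_norm k1 u0)
             `^ gap_exp n a2 b2 k2 *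
           (Lp_norm a2 (weighted b2 x1 (u t)) / Lp_norm k2 (u t))
             `^ gap_exp n a1 b1 k1)%E) /\
  (forall (a : \bar R) (b : R),
    (0 < a)%E -> 0 < b -> crit_exp n a b < 2 ->
    forall u0 : 'rV[R]_n -> R[i], schwartz u0 -> u0 <> (fun=> 0) ->
    exists c' : R, 0 < c' /\
      forall u : R -> 'rV[R]_n -> R[i], free_schrodinger u0 u ->
        forall (t : R) (x0 : 'rV[R]_n), t != 0 ->
          ((c' * `|t| `^ (n%:R * (recip a + b / n%:R - 2^-1)))%:E <=
           Lp_norm a (weighted b x0 (u t)))%E).
Proof.
split.
  move=> a1 a2 k1 k2 b1 b2 a10 a20 k10 k20 b10 b20.
  have [-> w10] := crit_expE n_gt0 a10 b10; have [-> w20] := crit_expE n_gt0 a20 b20.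
  set w1 := recip a1 + b1 / n%:R in w10 *; set w2 := recip a2 + b2 / n%:R in w20 *.
  have half w (k : \bar R) : 0 < w -> (w^-1%:E < Order.min 2%:E k)%E -> 2^-1 < w /\ recip k < w.
    move=> w0; rewrite lt_min lte_fin => /andP[h2 hk]; split.
      by rewrite -[ltRHS]invrK ltf_pV2 ?posrE// invr_gt0.
    have := recip_lt _ hk; rewrite invr_gt0 => /(_ w0).
    by rewrite mulrC ltr_pdivrMr// mul1r.
  have conj w (k : \bar R) : 0 < w -> (0 < k)%E ->
      (1 <= w^-1 -> (k < hoelder_conjugate w^-1%:E)%E) -> w <= 1 -> 1 - w < recip k.
    move=> w0 k0 h w1'; have w1'' : 1 <= w^-1 by rewrite invf_ge1.
    by rewrite -{1}[w]invrK; apply: lt_hoelder_conjugate => //; exact: h.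
  move=> /(half _ _ w10)[w1h kw1] /(half _ _ w20)[w2h kw2].
  move=> /(conj _ _ w20 k10) c1 /(conj _ _ w10 k20) c2.
  have [C HC] := ln_uncertainty n_gt0 a10 a20 k10 k20 b10 b20 w1h w2h kw1 kw2 c1 c2.
  rewrite /gap_exp -/w1 -/w2.
  set d1 := w1 - recip k1; set d2 := w2 - recip k2.
  have d10 : 0 < d1 by rewrite subr_gt0.
  have d20 : 0 < d2 by rewrite subr_gt0.
  exists (expR (- (d1 * d2 * C))); split; first exact: expR_gt0.
  move=> u0 u _ u0n hu t x0 x1 t0.
  have [A10 A20 h] := HC u0 u hu u0n t x0 x1 t0.
  have F0 := fLnorm_amp_gt0 0 hu u0n k10; have G0 := fLnorm_amp_gt0 t hu u0n k20.
  have uE : u 0 = u0 by have [] := hu.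
  rewrite -[in Lp_norm a1 _]uE -[in Lp_norm k1 _]uE.
  rewrite !(Lp_norm_weighted hu)// !(Lp_norm_amp hu)//.
  rewrite (ediv_EFin _ F0) (ediv_EFin _ G0) !poweR_EFin -EFinM lee_fin.
  apply: le_powR_of_ln => //; first by rewrite normr_gt0.
  move: h; set X := ln _ - ln _; set Y := ln _ - ln _ => h.
  have E : d2 * X + d1 * Y = d1 * d2 * (X / d1 + Y / d2) by field; rewrite !gt_eqF.
  rewrite E [leLHS](_ : _ = d1 * d2 * (n%:R * ln `|t| - C)); last by ring.
  by rewrite ler_pM2l// mulr_gt0.
move=> a b a0 b0; have [-> w0] := crit_expE n_gt0 a0 b0.
set w := recip a + b / n%:R in w0 * => w2 u0 _ u0n.
have two0 : (0 < 2%:E :> \bar R)%E by rewrite lte_fin.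
have r2 : recip (2%:E : \bar R) = 2^-1 by rewrite recip_EFin.
have wh : 2^-1 < w by rewrite -[ltRHS]invrK ltf_pV2 ?posrE// invr_gt0.
have kw : recip 2%:E < w by rewrite r2.
have cw : w <= 1 -> 1 - w < recip 2%:E by rewrite r2; lra.
have [C HC] := ln_uncertainty n_gt0 a0 a0 two0 two0 b0 b0 wh wh kw kw cw cw.
have q2 : 1 <= (2 : R) <= 2 by rewrite ler1n lexx.
have [|c Hc] := @dispersive R n 2 2%:E q2 two0; first by rewrite r2; field.
pose A := fLnorm (@lebesgue_tuple R n) a (fun t => dist_to 0 t `^ b * amp (fun=> u0) 0 t).
pose F := fLnorm (@lebesgue_tuple R n) 2%:E (amp (fun=> u0) 0).
pose d := w - 2^-1; have d0 : 0 < d by rewrite subr_gt0.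
exists (expR (- (d * C) - (ln A - ln F) + ln F - c)); split; first exact: expR_gt0.
move=> u hu t x0 t0; have uE : u 0 = u0 by have [] := hu.
have [A10 A20] := HC u0 u hu u0n t 0 x0 t0.
have -> : amp u 0 = amp (fun=> u0) 0 by rewrite /amp uE.
rewrite r2 -/d -/A -/F => h; rewrite (Lp_norm_weighted hu)// lee_fin.
have t0' : 0 != t by rewrite eq_sym.
have := Hc u0 u hu u0n 0 t t0'; rewrite subrr mul0r subr0.
have -> : amp u 0 = amp (fun=> u0) 0 by rewrite /amp uE.
rewrite -/F => hG.
rewrite -ler_ln ?posrE ?mulr_gt0 ?expR_gt0 ?powR_gt0 ?normr_gt0//.
rewrite lnM ?posrE ?expR_gt0 ?powR_gt0 ?normr_gt0// expRK ln_powR.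
move: h; rewrite -mulrDl ler_pdivlMr// => h.
by rewrite mulrAC; move: h; rewrite mulrBl => h; clear -h hG; lra.
Qed.
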